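(* Let $n,k,j$ be integers with $0\leq j\leq n-k-1\leq n-1$ and let $K$ be a centered convex body in $\mathbb{R}^n$. Then $$\gamma_{n,k,j}\left(\frac{n-k-j+1}{n+1}\right)^{n-k-j}W_j(K)\leq W_{n-k}(K)\cdot\max_{F\in G_{n,n-k}}W_j(K\cap F),$$ where $\gamma_{n,k,j}=\dfrac{\omega_{n-k}\,\omega_{n-j}}{\omega_{n-k-j}\,\omega_k}$.
   Context: A convex body in $\mathbb{R}^n$ is a compact convex set with non-empty interior; it is centered if its barycenter $\frac{1}{|K|}\int_K x\,dx$ is the origin. $|\cdot|$ denotes volume in the appropriate dimension, $B_2^m$ is the Euclidean unit ball of $\mathbb{R}^m$ and $\omega_m=|B_2^m|$ ($\omega_0=1$). $G_{n,m}$ is the Grassmann manifold of $m$-dimensional linear subspaces of $\mathbb{R}^n$. For a convex body $L$ in an $m$-dimensional Euclidean space, the quermassintegrals $W_0(L),\ldots,W_m(L)$ are defined by Steiner's formula $|L+\lambda B|=\sum_{i=0}^m\binom{m}{i}W_i(L)\lambda^i$ for $\lambda\geq 0$, where $B$ is the Euclidean unit ball of that space; equivalently $W_i(L)$ is the mixed volume of $m-i$ copies of $L$ and $i$ copies of $B$. Here $W_j(K)$ and $W_{n-k}(K)$ are taken in dimension $n$, and for $F\in G_{n,n-k}$ the quantity $W_j(K\cap F)$ is taken in the $(n-k)$-dimensional space $F$. *)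

(* Defs.v *)
From HB Require Import structures.
From mathcomp Require Import all_boot all_order all_algebra.
From mathcomp Require Import all_classical all_reals all_analysis.

Set Implicit Arguments.
Unset Strict Implicit.
Unset Printing Implicit Defensive.

Import Order.TTheory GRing.Theory Num.Theory.
Import numFieldNormedType.Exports.

Local Open Scope classical_set_scope.
Local Open Scope ring_scope.

Definition measure_rV_display : measure_display.
Proof. exact: default_measure_display. Qed.

(* Borel sigma-algebra of R^n, generated by the coordinate maps, in the same
   way as the library does for n.-tuple. *)
Section measurable_rV.
Context {R : realType} (n : nat).

Let coor (i : 'I_n) (v : 'rV[R]_n) : measurableTypeR R := v ord0 i.

Let rV_set0 : g_sigma_preimage coor set0.
Proof. exact: sigma_algebra0. Qed.

Let rV_setC A : g_sigma_preimage coor A -> g_sigma_preimage coor (~` A).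
Proof. exact: sigma_algebraC. Qed.

Let rV_bigcup (F : (set 'rV[R]_n)^nat) :
  (forall i, g_sigma_preimage coor (F i)) ->
  g_sigma_preimage coor (\bigcup_i (F i)).
Proof. exact: sigma_algebra_bigcup. Qed.

HB.instance Definition _ := @isMeasurable.Build measure_rV_display
  'rV[R]_n (g_sigma_preimage coor) rV_set0 rV_setC rV_bigcup.

Lemma measurable_fun_rVP d (T : measurableType d) (f : T -> 'rV[R]_n) :
  (forall i, measurable_fun setT (fun x => f x ord0 i : measurableTypeR R)) ->
  measurable_fun setT f.
Proof.
move=> mf; suff : g_sigma_preimage (fun i => coor i \o f) `<=` measurable.
  rewrite g_sigma_preimage_comp => sub _ A mA.
  by apply: sub; exists A.
apply: smallest_sub; first exact: sigma_algebra_measurable.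
elim/big_ind: _ => //; first by move=> A B sA sB C [/sA|/sB].
by move=> i _ _ [B mB <-]; exact: mf.
Qed.

Lemma measurable_rV_coor i :
  measurable_fun setT (fun v : 'rV[R]_n => v ord0 i : measurableTypeR R).
Proof.
move=> _ A mA; apply: sub_sigma_algebra => /=.
by rewrite -bigcup_seq/=; exists i => /=; [rewrite mem_index_enum | exists A].
Qed.

End measurable_rV.

Section lebesgue_rVS.
Context {R : realType} (n : nat).
Variable mu : {sigma_finite_measure set 'rV[R]_n -> \bar R}.

Definition cons_rV (p : measurableTypeR R * 'rV[R]_n) : 'rV[R]_n.+1 :=
  row_mx (p.1 : R)%:M p.2.

Lemma cons_rVl p (i : 'I_1) : cons_rV p ord0 (lshift n i) = p.1.
Proof. by rewrite (@row_mxEl R 1 1 n) (ord1 i) mxE. Qed.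

Lemma cons_rVr p (i : 'I_n) : cons_rV p ord0 (rshift 1 i) = p.2 ord0 i.
Proof. exact: (@row_mxEr R 1 1 n). Qed.

Lemma measurable_cons_rV : measurable_fun setT cons_rV.
Proof.
apply: measurable_fun_rVP => i; case: (@split_ordP 1 n i) => j ->.
  by under eq_fun do rewrite cons_rVl; exact: measurable_fst.
under eq_fun do rewrite cons_rVr.
exact: measurableT_comp (measurable_rV_coor j) measurable_snd.
Qed.

Definition lebesgue_rVS : set 'rV[R]_n.+1 -> \bar R :=
  pushforward (lebesgue_measure \x mu)%E cons_rV.

Let lebesgue_rVS0 : lebesgue_rVS set0 = 0%E.
Proof. by rewrite /lebesgue_rVS /pushforward preimage_set0 measure0. Qed.

Let lebesgue_rVS_ge0 A : (0 <= lebesgue_rVS A)%E.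
Proof. by rewrite /lebesgue_rVS /pushforward; exact: measure_ge0. Qed.

Let lebesgue_rVS_sigma_additive : semi_sigma_additive lebesgue_rVS.
Proof.
move=> F mF tF mUF; rewrite /lebesgue_rVS /pushforward preimage_bigcup.
apply: measure_semi_sigma_additive.
- by move=> i; rewrite -[X in measurable X]setTI; exact: measurable_cons_rV.
- apply/trivIsetP => /= i j _ _ ij; rewrite -preimage_setI.
  by move/trivIsetP : tF => /(_ _ _ _ _ ij) ->//; rewrite preimage_set0.
- rewrite -preimage_bigcup -[X in measurable X]setTI.
  exact: measurable_cons_rV.
Qed.

HB.instance Definition _ := isMeasure.Build _ _ _ lebesgue_rVS
  lebesgue_rVS0 lebesgue_rVS_ge0 lebesgue_rVS_sigma_additive.

Let lebesgue_rVS_sigma_finite : sigma_finite setT lebesgue_rVS.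
Proof.
have /sigma_finiteP[F [FT ndF Foo]] := sigma_finiteT (@lebesgue_measure R).
have /sigma_finiteP[G [GT ndG Goo]] := sigma_finiteT mu.
pose uncons (v : 'rV[R]_n.+1) : measurableTypeR R * 'rV[R]_n :=
  (v ord0 ord0, \row_j v ord0 (rshift 1 j)).
have muncons : measurable_fun setT uncons.
  apply: measurable_fun_pair; first exact: measurable_rV_coor.
  apply: measurable_fun_rVP => j.
  apply: (eq_measurable_fun (fun v : 'rV[R]_n.+1 => v ord0 (rshift 1 j))).
    by move=> v _; rewrite mxE.
  exact: measurable_rV_coor.
have consK : cancel cons_rV uncons.
  case=> x v; congr pair => /=.
    rewrite (_ : ord0 = lshift n (ord0 : 'I_1)); last exact: val_inj.
    exact: cons_rVl.
  by apply/rowP => j; rewrite mxE cons_rVr.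
exists (fun i => uncons @^-1` (F i `*` G i)) => [|i].
  rewrite -preimage_bigcup (_ : \bigcup_i _ = setT) ?preimage_setT//.
  rewrite -subTset => -[x v] _.
  have [[i _ Fx] [j _ Gv]] : (\bigcup_i F i) x /\ (\bigcup_i G i) v.
    by rewrite -FT -GT.
  exists (maxn i j) => //; split=> /=.
    by move: x Fx; exact/subsetPset/ndF/leq_maxl.
  by move: v Gv; exact/subsetPset/ndG/leq_maxr.
have [[mF Fi] [mG Gi]] := (Foo i, Goo i); split.
  by rewrite -[X in measurable X]setTI; apply: muncons => //; exact: measurableX.
rewrite /lebesgue_rVS /pushforward -comp_preimage.
rewrite (_ : uncons \o cons_rV = id); last by apply/funext => x; exact: consK.
by rewrite preimage_id product_measure1E// lte_mul_pinfty// ge0_fin_numE.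
Qed.

HB.instance Definition _ := Measure_isSigmaFinite.Build _ _ _ lebesgue_rVS
  lebesgue_rVS_sigma_finite.

End lebesgue_rVS.

Fixpoint lebesgue_rV {R : realType} (n : nat) :
    {sigma_finite_measure set 'rV[R]_n -> \bar R} :=
  match n with
  | 0 => dirac (0 : 'rV[R]_0)
  | m.+1 => lebesgue_rVS (lebesgue_rV m)
  end.

(* The box formula characterizes this measure as n-dimensional Lebesgue
   measure. *)
Lemma lebesgue_rV_box {R : realType} (n : nat)
    (A : 'I_n -> set (measurableTypeR R)) :
  (forall i, measurable (A i)) ->
  (lebesgue_rV n [set v : 'rV[R]_n | forall i, A i (v ord0 i)] =
   \prod_(i < n) lebesgue_measure (A i))%E.
Proof.
elim: n A => [|n IH] A mA.
  by rewrite big_ord0 /= diracE mem_set// => -[].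
rewrite big_ord_recl /= -IH//.
rewrite -product_measure1E//.
  congr ((_ \x _)%E _); apply/seteqP; split=> -[x v] /=.
    move=> Av; split=> [|i].
      by have := Av ord0; rewrite (_ : ord0 = lshift n (ord0 : 'I_1)) ?cons_rVl//; exact: val_inj.
    by have := Av (rshift 1 i); rewrite cons_rVr (_ : rshift 1 i = lift ord0 i)//; exact: val_inj.
  move=> [Ax Av] i; case: (@split_ordP 1 n i) => l ->.
    by rewrite cons_rVl (_ : lshift n l = ord0)//; apply: val_inj; rewrite /= (ord1 l).
  by rewrite cons_rVr (_ : rshift 1 l = lift ord0 l)//; exact: val_inj.
rewrite (_ : [set _ | _] = \bigcap_(i in [set: 'I_n])
    (fun v : 'rV[R]_n => v ord0 i) @^-1` A (lift ord0 i)); last first.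
  by apply/seteqP; split=> v Av i //=; exact: Av.
apply: fin_bigcap_measurable => // i _.
by rewrite -[X in measurable X]setTI; exact: measurable_rV_coor.
Qed.

Section convex_geometry.
Context {R : realType}.

Definition convex_body n (K : set 'rV[R]_n) : Prop :=
  [/\ compact K, convex_set (K : set (convex_lmodType 'rV[R]_n)) &
      K° !=set0].

Definition barycenter n (K : set 'rV[R]_n) : 'rV[R]_n :=
  \row_i ((fine (lebesgue_rV n K))^-1 *
          \int[lebesgue_rV n]_(x in K) (x ord0 i)).

Definition centered n (K : set 'rV[R]_n) : Prop := barycenter K = 0.

(* The norm of the library on 'rV[R]_n is the sup norm, hence the explicit
   sum of squares. *)
Definition ball2 n : set 'rV[R]_n :=
  [set x | Num.sqrt (\sum_i x ord0 i ^+ 2) <= 1].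
Arguments ball2 n : clear implicits.

Definition omega m : R := fine (lebesgue_rV m (ball2 m)).

Definition minkowski_sum (T : lmodType R) (A B : set T) : set T :=
  [set x + y | x in A & y in B].

Definition dilate (T : lmodType R) (lam : R) (A : set T) : set T :=
  [set lam *: x | x in A].

(* W is a system of coefficients for Steiner's formula in a Euclidean space of
   dimension m with volume vol and unit ball B. *)
Definition steiner (T : lmodType R) (vol : set T -> \bar R) (B : set T)
    (m : nat) (L : set T) (W : nat -> R) : Prop :=
  forall lam : R, 0 <= lam ->
    vol (minkowski_sum L (dilate lam B)) =
    (\sum_(i < m.+1) 'C(m, i)%:R * W i * lam ^+ i)%:E.

(* For i <= m, Steiner's formula determines W i, so that there is at most one
   candidate w. *)
Definition quermass_gen (T : lmodType R) (vol : set T -> \bar R) (B : set T)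
    (m : nat) (L : set T) (i : nat) : R :=
  xget 0 [set w | exists2 W, steiner vol B m L W & w = W i].

Definition quermass n (K : set 'rV[R]_n) (i : nat) : R :=
  quermass_gen (lebesgue_rV n) (ball2 n) n K i.

Definition grassmannian n m : set {vspace 'rV[R]_n} := [set F | \dim F = m].
Arguments grassmannian n m : clear implicits.

Definition orthonormal_frame n (F : {vspace 'rV[R]_n})
    (U : 'M[R]_(\dim F, n)) : Prop :=
  U *m U^T = 1%:M /\ forall i, row i U \in F.

(* Lebesgue measure of the Euclidean space F, read through the isometry
   y |-> y *m U of R^(\dim F) onto F given by an orthonormal basis (the rows of
   U); by rotation invariance the choice of the basis is irrelevant. *)
Definition vol_in n (F : {vspace 'rV[R]_n}) (A : set 'rV[R]_n) : \bar R :=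
  lebesgue_rV (\dim F)
    ((fun y => y *m xget 0 (@orthonormal_frame n F)) @^-1` A).

Definition quermass_in n (F : {vspace 'rV[R]_n}) (L : set 'rV[R]_n)
    (i : nat) : R :=
  quermass_gen (vol_in F) (ball2 n `&` [set` F]) (\dim F) L i.

Definition is_max (A : set R) (M : R) : Prop := A M /\ ubound A M.

Definition gamma_coef (n k j : nat) : R :=
  omega (n - k)%N * omega (n - j)%N / (omega (n - k - j)%N * omega k).

End convex_geometry.
Arguments ball2 {R} n.
Arguments grassmannian {R} n m.

(* Main.v *)
(* Write R^n = R^j x R^m x R^k with m = n - k - j, and let X be a rotation of K.
   Over x in R^k let f x be the volume of the slice of X and w x the m-th root of
   the volume of the projection of that slice to R^m. By Brunn-Minkowski w is
   concave, and
     f ((1-e) x + e x0) (w x)^m >= (1-e)^j ((1-e) w x + e w x0)^m f x.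
   Multiplying by w ((1-e) x + e x0), integrating and letting e tend to 0 gives
   (n+1) int w f >= (m+1) w x0 int f, while int w f <= w 0 int f by Jensen, since
   the barycenter of X is 0. Hence w x0 <= (n+1)/(m+1) w 0, and integrating w^m,
     |pr_{m+k} X| <= ((n+1)/(m+1))^m |pr_m (X cap R^{j+m})| |pr_k X|.
   Averaging this over rotations of R^{j+m} and then of R^n turns the three
   volumes into quermassintegrals by Kubota's formula.

   Averages over O(n) are limits of averages over nets of minimal cardinality,
   which are asymptotically invariant. Steiner's and Kubota's formulas are proved
   together by approximating the ball by zonotopes, starting from
   |X + t [-u, u]| = |X| + 2 t |u| |pr_{u^perp} X|. *)
Require Import Defs.
From mathcomp Require Import all_boot all_order all_algebra.
From mathcomp Require Import all_classical all_reals all_analysis.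
From mathcomp Require Import measurable_realfun ring lra zify.
Set Implicit Arguments.
Unset Strict Implicit.
Unset Printing Implicit Defensive.
Import Order.TTheory GRing.Theory Num.Theory.
Import numFieldNormedType.Exports.
Local Open Scope classical_set_scope.
Local Open Scope ring_scope.

(** * Lebesgue measure on row vectors *)

(** The overview's m is [m.+1] in the code, whence the constants [m.+2]; the hypotheses on j and k
    make it positive. The extra factor w serves to linearize. After division by (w x)^m the left
    side contains ((1-e) w x + e w x0)^(m+1) / (w x)^m, which by Bernoulli is at least w x + (m+1) e
    (w x0 - w x). This is affine in w x, so integration against f leaves only the integral of w f,
    which Jensen controls, and the volume. The constant n + 1 counts first-order losses in e: j from
    the shrunk fibres, k from the substitution x -> (1-e) x + e x0, and m + 1 from Bernoulli. Two
    obstacles shape the rest. Continuity of w at 0 is not at hand, so the supporting affine function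
    in Jensen's inequality is replaced by an affine majorant up to an error. Limits along an
    ultrafilter need not commute, so the double average over rotations has a finite net outside and
    the limit inside. *)

Section BorelMeasure.
Context {R : realType}.

Lemma measurable_box n (A : 'I_n -> set (measurableTypeR R)) :
  (forall i, measurable (A i)) ->
  measurable [set v : 'rV[R]_n | forall i, A i (v ord0 i)].
Proof.
move=> mA; rewrite (_ : [set _ | _] = \bigcap_(i in [set: 'I_n])
    (fun v : 'rV[R]_n => v ord0 i) @^-1` A i); last first.
  by apply/seteqP; split=> v Av i //=; exact: Av.
apply: fin_bigcap_measurable => // i _.
by rewrite -[X in measurable X]setTI; exact: measurable_rV_coor.
Qed.

Lemma open_measurable_rV n (A : set 'rV[R]_n) : open A -> measurable A.
Proof.
move=> oA.
(* Cubes with rational centre and radius, enumerated by [unpickle]; an index whose cube is not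
   inside [A] contributes the empty set. *)
pose B (p : 'rV[rat]_n * rat) : set 'rV[R]_n :=
  [set v | forall i, (`](ratr (p.1 ord0 i) - ratr p.2), (ratr (p.1 ord0 i) + ratr p.2)[%classic : set R) (v ord0 i)].
pose C k : set 'rV[R]_n := if @unpickle ('rV[rat]_n * rat)%type k is Some p then
   (if `[< B p `<=` A >] then B p else set0) else set0.
rewrite (_ : A = \bigcup_k C k).
  apply: bigcupT_measurable => k; rewrite /C; case: unpickle => [p|]; last exact: measurable0.
  case: asboolP => _; last exact: measurable0.
  apply: (@measurable_box n (fun i => `](ratr (p.1 ord0 i) - ratr p.2), (ratr (p.1 ord0 i) + ratr p.2)[%classic)) => i; exact: measurable_itv.
apply/seteqP; split => [x Ax|x [k _]]; last first.
  by rewrite /C; case: unpickle => [p|] //; case: asboolP => // BA /BA.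
have [e /= e0 eA] : nbhs_ball x A by rewrite nbhs_ballE; exact: open_nbhs_nbhs.
have [r] := rat_in_itvoo (divr_gt0 e0 (ltr0n R 2)).
rewrite in_itv /= => /andP[r0 re].
have hq (i : 'I_n) : exists q : rat, ratr q \in `](x ord0 i - ratr r), (x ord0 i + ratr r)[.
  by apply: rat_in_itvoo; rewrite ltrBlDr -addrA ltrDl addr_gt0.
have [q Hq] := choice hq.
pose p := (\row_i q i, r).
exists (pickle p) => //; rewrite /C pickleK.
have Bx : B p x.
  move=> i /=; rewrite mxE in_itv /=; have := Hq i; rewrite in_itv /=; lra.
case: asboolP => // -[] v Bv; apply: eA; split=> // i j; have -> : i = ord0 by exact: ord1.
have := Bv j; rewrite /p /= in_itv /= mxE => /andP[h1 h2]; have := Hq j; rewrite in_itv /= => /andP[h3 h4].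
rewrite -ball_normE /= ltr_norml; apply/andP; split; lra.
Qed.

Lemma closed_measurable_rV n (A : set 'rV[R]_n) : closed A -> measurable A.
Proof. by move=> /closed_openC /open_measurable_rV /measurableC; rewrite setCK. Qed.

Lemma compact_measurable_rV n (A : set 'rV[R]_n) : compact A -> measurable A.
Proof. by move=> /compact_closed cA; apply: closed_measurable_rV; apply: cA; exact: norm_hausdorff. Qed.

Local Notation mu := (@lebesgue_measure R).
Lemma lebesgue_measure_shift (a : R) (A : set R) : measurable A ->
  mu ((fun x => x + a) @^-1` A) = mu A.
Proof.
move=> mA.
have mf : measurable_fun setT (fun x : measurableTypeR R => (x + a) : measurableTypeR R).
  by apply: measurable_funD => //; exact: measurable_id.
have -> : mu ((fun x => x + a) @^-1` A) = pushforward mu (fun x : measurableTypeR R => (x + a : measurableTypeR R)) A by [].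
apply/esym/lebesgue_measure_unique => //= _ [[x y]] _ <-.
rewrite /pushforward (_ : _ @^-1` _ = `](x - a), (y - a)]%classic); last first.
  by apply/seteqP; split => z /=; rewrite !in_itv /=; lra.
rewrite !lebesgue_measure_itv/= !lte_fin ltrD2r; case: ifP => // _.
by rewrite -!EFinB; congr (_ %:E); ring.
Qed.
Lemma lebesgue_measure_scale (c : R) (A : set R) : 0 < c -> measurable A ->
  (c%:E * mu ((fun x : R => (c * x)%R) @^-1` A) = mu A)%E.
Proof.
move=> c0 mA.
have mf : measurable_fun setT (fun x : measurableTypeR R => (c * x) : measurableTypeR R).
  by apply: measurable_funM => //; exact: measurable_id.
have cn : 0 <= c by exact: ltW.
pose m := mscale (NngNum cn) (pushforward mu (fun x : measurableTypeR R => (c * x : measurableTypeR R))).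
have -> : (c%:E * mu ((fun x : R => (c * x)%R) @^-1` A))%E = m mf A by [].
apply/esym/lebesgue_measure_unique => //= _ [[x y]] _ <-.
rewrite /m /mscale /= /pushforward (_ : _ @^-1` _ = `](x / c), (y / c)]%classic); last first.
  by apply/seteqP; split => z /=; rewrite !in_itv /= ltr_pdivrMr// ler_pdivlMr// ![z * c]mulrC.
rewrite !lebesgue_measure_itv/= !lte_fin ltr_pM2r ?invr_gt0//; case: ifP => // _; last by rewrite mule0.
by rewrite -!EFinB -EFinM; congr (_ %:E); field; rewrite gt_eqF.
Qed.

Lemma cover_box n : \bigcup_k [set v : 'rV[R]_n | forall i, (`](- k%:R)%R, k%:R%R]%classic : set R) (v ord0 i)] = setT.
Proof.
rewrite -subTset => v _.
pose M := (\sum_i `|v ord0 i|).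
exists (Num.truncn M).+1 => // i /=; rewrite in_itv /=.
have h : `|v ord0 i| < (Num.truncn M).+1%:R.
  apply: (le_lt_trans _ (Num.Theory.truncnS_gt M)).
  by rewrite /M (bigD1 i) //= lerDl sumr_ge0.
by move: h; rewrite ltr_norml => /andP[-> /ltW ->].
Qed.

(** Boxes form a generating pi-system and the cubes exhaust the space with finite measure. Shifts,
    scalings and regroupings of coordinates are thereby checked on boxes alone. *)
Lemma measure_rV_unique n (m1 m2 : {measure set 'rV[R]_n -> \bar R}) :
  (forall A : 'I_n -> set (measurableTypeR R), (forall i, measurable (A i)) ->
    m1 [set v | forall i, A i (v ord0 i)] = m2 [set v | forall i, A i (v ord0 i)]) ->
  (forall k : nat, (m1 [set v | forall i, (`](- k%:R)%R, k%:R%R]%classic : set R) (v ord0 i)] < +oo)%E) ->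
  forall A, measurable A -> m1 A = m2 A.
Proof.
move=> h1 h2.
pose G : set (set 'rV[R]_n) := [set B | exists2 A : 'I_n -> set (measurableTypeR R), (forall i, measurable (A i)) & B = [set v : 'rV[R]_n | forall i, A i (v ord0 i)]].
apply: (@measure_unique _ _ _ G (fun k : nat => [set v : 'rV[R]_n | forall i, (`](- k%:R)%R, k%:R%R]%classic : set R) (v ord0 i)])) => //.
- apply/seteqP; split; last first.
    apply: smallest_sub; first exact: sigma_algebra_measurable.
    by move=> _ [A mA ->]; exact: measurable_box.
  apply: smallest_sub; first exact: smallest_sigma_algebra.
  elim/big_ind: _ => //; first by move=> A B sA sB C [/sA|/sB].
  move=> i _ _ [B mB <-]; apply: sub_sigma_algebra; rewrite setTI.
  exists (fun j => if j == i then B else setT); first by move=> j; case: ifP.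
  apply/seteqP; split => v /= h; last by have := h i; rewrite eqxx.
  by move=> j; case: eqP => [->|].
- move=> _ _ [A mA ->] [B mB ->]; exists (fun i => A i `&` B i); first by move=> i; exact: measurableI.
  by apply/seteqP; split => v /= => [[h h'] i|h]; split => // i; have [] := h i.
- by move=> k; exists (fun=> `](- k%:R)%R, k%:R%R]%classic).
- exact: cover_box.
- by move=> _ [A mA ->]; exact: h1.
Qed.
End BorelMeasure.

Section LebesgueMeasure.
Context {R : realType}.
Local Notation lam n := (@lebesgue_rV R n).

Lemma lam_cube_fin n (k : nat) : (lam n [set v | forall i, (`](- k%:R)%R, k%:R%R]%classic : set R) (v ord0 i)] < +oo)%E.
Proof.
rewrite (@lebesgue_rV_box R n (fun=> `](- k%:R)%R, k%:R]%classic)) //.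
under eq_bigr do rewrite lebesgue_measure_itv /=.
by rewrite ltey_eq prode_fin_num// => i _; case: ifP.
Qed.

Lemma measurable_mulmx n p (M : 'M[R]_(n, p)) : measurable_fun setT (fun x : 'rV[R]_n => x *m M).
Proof.
apply: measurable_fun_rVP => i.
apply: (eq_measurable_fun (fun x : 'rV[R]_n => (\sum_j x ord0 j * M j i : measurableTypeR R))).
  by move=> x _; rewrite mxE.
apply: measurable_sum => j; apply: measurable_funM => //.
exact: measurable_rV_coor.
Qed.

Lemma measurable_addmx n d (T : measurableType d) (f g : T -> 'rV[R]_n) :
  measurable_fun setT f -> measurable_fun setT g -> measurable_fun setT (fun x => f x + g x).
Proof.
move=> mf mg; apply: measurable_fun_rVP => i.
apply: (eq_measurable_fun (fun x => (f x ord0 i + g x ord0 i : measurableTypeR R))).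
  by move=> x _; rewrite mxE.
apply: measurable_funD; exact: (measurableT_comp (measurable_rV_coor i)).
Qed.

Lemma measurable_scalemx n (c : R) : measurable_fun setT (fun x : 'rV[R]_n => c *: x).
Proof.
rewrite (_ : (fun x => c *: x) = (fun x : 'rV[R]_n => x *m c%:M)); last by apply/funext => x; rewrite mul_mx_scalar.
exact: measurable_mulmx.
Qed.

Lemma measurable_preim d d' (T : measurableType d) (U : measurableType d') (f : T -> U) (A : set U) :
  measurable_fun setT f -> measurable A -> measurable (f @^-1` A).
Proof. by move=> mf mA; rewrite -[X in measurable X]setTI; exact: mf. Qed.

Lemma measurable_shift n (a : 'rV[R]_n) (A : set 'rV[R]_n) : measurable A -> measurable ((fun x => x + a) @^-1` A).
Proof.
apply: (measurable_preim (f := fun x : 'rV[R]_n => x + a)).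
by apply: measurable_addmx => //; exact: measurable_cst.
Qed.

Lemma lam_shift n (a : 'rV[R]_n) (A : set 'rV[R]_n) : measurable A ->
  lam n ((fun x => x + a) @^-1` A) = lam n A.
Proof.
have mf : measurable_fun setT (fun x : 'rV[R]_n => x + a).
  by apply: measurable_addmx => //; exact: measurable_cst.
have boxE (B : 'I_n -> set (measurableTypeR R)) : (forall i, measurable (B i)) ->
    lam n ((fun x => x + a) @^-1` [set v | forall i, B i (v ord0 i)]) = lam n [set v | forall i, B i (v ord0 i)].
  move=> mB; have mB' i : measurable ((fun x : measurableTypeR R => x + a ord0 i : measurableTypeR R) @^-1` B i).
    apply: measurable_preim => //; apply: measurable_funD => //; exact: measurable_id.
  rewrite [RHS]lebesgue_rV_box//.
  transitivity (lam n [set v | forall i, ((fun x : measurableTypeR R => x + a ord0 i : measurableTypeR R) @^-1` B i) (v ord0 i)]).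
    by congr (lam n _); apply/seteqP; split => v /= h i; have := h i; rewrite mxE.
  rewrite (@lebesgue_rV_box R n (fun i => (fun x : measurableTypeR R => x + a ord0 i : measurableTypeR R) @^-1` B i))//.
  by apply: eq_bigr => i _; exact: (lebesgue_measure_shift (a ord0 i) (mB i)).
apply: (@measure_rV_unique R n (pushforward (lam n) (fun x : 'rV[R]_n => x + a) )) => //.
move=> k; apply: (le_lt_trans _ (lam_cube_fin n k)); rewrite le_eqVlt; apply/orP; left; apply/eqP.
by apply: (boxE (fun=> `](- k%:R), k%:R]%classic)) => i; exact: measurable_itv.
Qed.

Lemma lam_scale n (c : R) (A : set 'rV[R]_n) : 0 < c -> measurable A ->
  ((c ^+ n)%:E * lam n ((fun x : 'rV[R]_n => c *: x)%R @^-1` A) = lam n A)%E.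
Proof.
move=> c0; have mf := @measurable_scalemx n c.
have cn : 0 <= c ^+ n by rewrite exprn_ge0 // ltW.
have boxE (B : 'I_n -> set (measurableTypeR R)) : (forall i, measurable (B i)) ->
    ((c ^+ n)%:E * lam n ((fun x : 'rV[R]_n => c *: x)%R @^-1` [set v | forall i, B i (v ord0 i)]) = lam n [set v | forall i, B i (v ord0 i)])%E.
  move=> mB; have mB' i : measurable ((fun x : measurableTypeR R => c * x : measurableTypeR R) @^-1` B i).
    apply: measurable_preim => //; apply: measurable_funM => //; exact: measurable_id.
  rewrite [RHS]lebesgue_rV_box//.
  transitivity ((c ^+ n)%:E * lam n [set v | forall i, ((fun x : measurableTypeR R => (c * x)%R : measurableTypeR R) @^-1` B i) (v ord0 i)])%E.
    by congr (_ * lam n _)%E; apply/seteqP; split => v /= h i; have := h i; rewrite mxE.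
  rewrite (@lebesgue_rV_box R n (fun i => (fun x : measurableTypeR R => (c * x)%R : measurableTypeR R) @^-1` B i))//.
  rewrite (_ : (c ^+ n)%:E = \prod_(i < n) c%:E)%E; last by rewrite prodEFin prodr_const card_ord.
  by rewrite -big_split /=; apply: eq_bigr => i _; exact: (lebesgue_measure_scale c0 (mB i)).
pose m := mscale (NngNum cn) (pushforward (lam n) (fun x : 'rV[R]_n => c *: x)).
apply: (@measure_rV_unique R n (m mf)) => //.
move=> k; apply: (le_lt_trans _ (lam_cube_fin n k)); rewrite le_eqVlt; apply/orP; left; apply/eqP.
by apply: (boxE (fun=> `](- k%:R), k%:R]%classic)) => i; exact: measurable_itv.
Qed.

Lemma measurable_row_mx p q : measurable_fun setT (fun z : 'rV[R]_p * 'rV[R]_q => row_mx z.1 z.2).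
Proof.
apply: measurable_fun_rVP => i; case: (split_ordP i) => j ->.
  apply: (eq_measurable_fun (fun z : 'rV[R]_p * 'rV[R]_q => (z.1 ord0 j : measurableTypeR R))).
    by move=> z _; rewrite row_mxEl.
  by apply: (measurableT_comp (measurable_rV_coor j)); exact: measurable_fst.
apply: (eq_measurable_fun (fun z : 'rV[R]_p * 'rV[R]_q => (z.2 ord0 j : measurableTypeR R))).
  by move=> z _; rewrite row_mxEr.
by apply: (measurableT_comp (measurable_rV_coor j)); exact: measurable_snd.
Qed.

(** The measure is built by splitting off one coordinate at a time; this regroups it for an
    arbitrary splitting, which is what Fubini over fibres and projections needs. *)
Lemma lam_row_mx p q (A : set 'rV[R]_(p + q)) : measurable A ->
  lam (p + q)%N A = (lam p \x lam q)%E ((fun z : 'rV[R]_p * 'rV[R]_q => row_mx z.1 z.2) @^-1` A).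
Proof.
have mf := @measurable_row_mx p q.
have boxE (B : 'I_(p + q) -> set (measurableTypeR R)) : (forall i, measurable (B i)) ->
   lam (p + q)%N [set v | forall i, B i (v ord0 i)] =
  (lam p \x lam q)%E ((fun z : 'rV[R]_p * 'rV[R]_q => row_mx z.1 z.2) @^-1` [set v | forall i, B i (v ord0 i)]).
  move=> mB; rewrite lebesgue_rV_box// (_ : _ @^-1` _ =
    [set v : 'rV[R]_p | forall i, B (lshift q i) (v ord0 i)] `*` [set v : 'rV[R]_q | forall i, B (rshift p i) (v ord0 i)]).
    rewrite product_measure1E; [|exact: (@measurable_box R p (fun i => B (lshift q i)))|exact: (@measurable_box R q (fun i => B (rshift p i)))].
    by rewrite big_split_ord; congr (_ * _)%E; apply/esym; [exact: (@lebesgue_rV_box R p (fun i => B (lshift q i)))|exact: (@lebesgue_rV_box R q (fun i => B (rshift p i)))].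
  apply/seteqP; split => -[x y] /= h; first split => i.
  - by have := h (lshift q i); rewrite row_mxEl.
  - by have := h (rshift p i); rewrite row_mxEr.
  by case: h => h1 h2 i; case: (split_ordP i) => j ->; rewrite ?row_mxEl ?row_mxEr.
apply: (@measure_rV_unique R _ (lam (p + q)%N) (pushforward (lam p \x lam q)%E (fun z : 'rV[R]_p * 'rV[R]_q => row_mx z.1 z.2))) => //.
move=> k; exact: lam_cube_fin.
Qed.

Lemma product_measure12 d1 d2 (T1 : measurableType d1) (T2 : measurableType d2)
  (m1 : {sigma_finite_measure set T1 -> \bar R}) (m2 : {sigma_finite_measure set T2 -> \bar R}) (A : set (T1 * T2)) :
  measurable A -> ((m1 \x m2) A = \int[m2]_y m1 (ysection A y))%E.
Proof.
move=> mA; rewrite (@product_measure_unique _ _ _ _ _ m1 m2 (product_measure2 m1 m2))// => B C mB mC.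
exact: product_measure2E.
Qed.

Lemma lam_fubini2 p q (A : set 'rV[R]_(p + q)) : measurable A ->
  (lam (p + q)%N A = \int[lam q]_y lam p [set x | A (row_mx x y)])%E.
Proof.
move=> mA; rewrite lam_row_mx// product_measure12; last by apply: measurable_preim => //; exact: measurable_row_mx.
apply: eq_integral => x _; congr (lam p _).
by apply/seteqP; split => y; rewrite /ysection /= inE.
Qed.

Lemma measurable_slice2 p q (A : set 'rV[R]_(p + q)) : measurable A ->
  measurable_fun setT ((fun y => lam p [set x | A (row_mx x y)]) : 'rV[R]_q -> \bar R).
Proof.
move=> mA; have mB := measurable_preim (@measurable_row_mx p q) mA.
have := @measurable_fun_ysection _ _ _ _ R (lam p) _ mB; apply: eq_measurable_fun => x _.
by rewrite /=; congr (lam p _); apply/seteqP; split => y; rewrite /ysection /= inE.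
Qed.
End LebesgueMeasure.

(** * Euclidean geometry and compact convex sets *)

Section Euclid.
Context {R : realType}.
Implicit Types n p q : nat.

Definition dot n (x y : 'rV[R]_n) : R := \sum_i x ord0 i * y ord0 i.
Definition enorm n (x : 'rV[R]_n) : R := Num.sqrt (\sum_i x ord0 i ^+ 2).

Lemma dotC n (x y : 'rV[R]_n) : dot x y = dot y x.
Proof. by apply: eq_bigr => i _; rewrite mulrC. Qed.
Lemma dotE n (x y : 'rV[R]_n) : dot x y = (x *m y^T) ord0 ord0.
Proof. by rewrite mxE; apply: eq_bigr => i _; rewrite mxE. Qed.
Lemma dotDl n (x y z : 'rV[R]_n) : dot (x + y) z = dot x z + dot y z.
Proof. by rewrite -big_split /=; apply: eq_bigr => i _; rewrite mxE mulrDl. Qed.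
Lemma dotZl n c (x z : 'rV[R]_n) : dot (c *: x) z = c * dot x z.
Proof. by rewrite mulr_sumr; apply: eq_bigr => i _; rewrite mxE mulrA. Qed.
Lemma dotNl n (x z : 'rV[R]_n) : dot (- x) z = - dot x z.
Proof. by rewrite -scaleN1r dotZl mulN1r. Qed.
Lemma dotBl n (x y z : 'rV[R]_n) : dot (x - y) z = dot x z - dot y z.
Proof. by rewrite dotDl dotNl. Qed.
Lemma dotDr n (x y z : 'rV[R]_n) : dot z (x + y) = dot z x + dot z y.
Proof. by rewrite dotC dotDl !(dotC _ z). Qed.
Lemma dotZr n c (x z : 'rV[R]_n) : dot z (c *: x) = c * dot z x.
Proof. by rewrite dotC dotZl dotC. Qed.
Lemma dotNr n (x z : 'rV[R]_n) : dot z (- x) = - dot z x.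
Proof. by rewrite dotC dotNl dotC. Qed.
Lemma dotBr n (x y z : 'rV[R]_n) : dot z (x - y) = dot z x - dot z y.
Proof. by rewrite dotDr dotNr. Qed.
Lemma dot0l n (x : 'rV[R]_n) : dot 0 x = 0.
Proof. by rewrite /dot big1// => i _; rewrite mxE mul0r. Qed.
Lemma dot_mulmx n p (x : 'rV[R]_n) (M : 'M[R]_(n, p)) y : dot (x *m M) y = dot x (y *m M^T).
Proof. by rewrite !dotE trmx_mul trmxK mulmxA. Qed.
Lemma dotxx n (x : 'rV[R]_n) : dot x x = enorm x ^+ 2.
Proof. by rewrite sqr_sqrtr ?sumr_ge0// => i _; exact: sqr_ge0. Qed.
Lemma enorm_ge0 n (x : 'rV[R]_n) : 0 <= enorm x. Proof. exact: sqrtr_ge0. Qed.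
Lemma enormZ n c (x : 'rV[R]_n) : enorm (c *: x) = `|c| * enorm x.
Proof.
rewrite /enorm -sqrtr_sqr -sqrtrM ?sqr_ge0//; congr Num.sqrt.
by rewrite mulr_sumr; apply: eq_bigr => i _; rewrite mxE exprMn.
Qed.
Lemma enormN n (x : 'rV[R]_n) : enorm (- x) = enorm x.
Proof. by rewrite -scaleN1r enormZ normrN1 mul1r. Qed.
Lemma enorm0 n : enorm (0 : 'rV[R]_n) = 0.
Proof. by rewrite /enorm big1 ?sqrtr0// => i _; rewrite mxE expr0n. Qed.
Lemma enorm_coor n (x : 'rV[R]_n) i : `|x ord0 i| <= enorm x.
Proof.
rewrite -sqrtr_sqr ler_sqrt; last by rewrite sumr_ge0// => j _; exact: sqr_ge0.
by rewrite (bigD1 i)//= lerDl sumr_ge0// => j _; exact: sqr_ge0.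
Qed.
Lemma enorm_eq0 n (x : 'rV[R]_n) : enorm x = 0 -> x = 0.
Proof.
by move=> h; apply/rowP => i; rewrite mxE; apply/eqP; rewrite -normr_le0 -h; exact: enorm_coor.
Qed.
Lemma cauchy_schwarz n (x y : 'rV[R]_n) : dot x y <= enorm x * enorm y.
Proof.
have [h|h] := eqVneq (enorm y) 0.
  by rewrite h mulr0 (enorm_eq0 h) dotC dot0l.
have y0 : 0 < enorm y by rewrite lt_neqAle eq_sym h enorm_ge0.
have : 0 <= dot (enorm y ^+ 2 *: x - dot x y *: y) (enorm y ^+ 2 *: x - dot x y *: y).
  by rewrite dotxx sqr_ge0.
rewrite !(dotBl, dotBr, dotZl, dotZr) (dotC y x) !dotxx => h1.
have h2 : dot x y ^+ 2 <= (enorm x * enorm y) ^+ 2.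
  rewrite -(ler_pM2l (exprn_gt0 2 y0)); move: h1; set a := enorm x; set b := enorm y; set c := dot x y.
  by move=> h1; nra.
apply: (le_trans (ler_norm _)); rewrite -ler_sqr ?nnegrE ?mulr_ge0 ?enorm_ge0//.
by rewrite real_normK ?num_real.
Qed.
Lemma enormD n (x y : 'rV[R]_n) : enorm (x + y) <= enorm x + enorm y.
Proof.
rewrite -ler_sqr ?nnegrE ?addr_ge0 ?enorm_ge0// -dotxx dotDl !dotDr !dotxx (dotC y x).
have := cauchy_schwarz x y; nra.
Qed.
Lemma enormB n (x y : 'rV[R]_n) : enorm (x - y) <= enorm x + enorm y.
Proof. by rewrite -(enormN y) enormD. Qed.
Lemma coor_sup n (x : 'rV[R]_n) i : `|x ord0 i| <= `|x|.
Proof. by rewrite [leRHS]mx_normrE (le_bigmax _ (fun ij : 'I_1 * 'I_n => `|x ij.1 ij.2|) (ord0, i)). Qed.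
Lemma enorm_sup n (x : 'rV[R]_n) : enorm x <= Num.sqrt n%:R * `|x|.
Proof.
have h : \sum_i x ord0 i ^+ 2 <= n%:R * `|x| ^+ 2.
  rewrite -[X in X%:R * _](card_ord n) mulr_natl -sumr_const; apply: ler_sum => i _.
  rewrite -real_normK ?num_real// ler_sqr ?nnegrE//.
  exact: coor_sup.
apply: (le_trans (ler_wsqrtr h)).
by rewrite sqrtrM ?ler0n// sqrtr_sqr normr_id.
Qed.
Lemma sup_enorm n (x : 'rV[R]_n) : `|x| <= enorm x.
Proof.
rewrite [leLHS]mx_normrE; apply: bigmax_le; first exact: enorm_ge0.
by move=> [i j] _ /=; rewrite (ord1 i); exact: enorm_coor.
Qed.
Lemma ball2E n (x : 'rV[R]_n) : ball2 n x = (enorm x <= 1) :> Prop.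
Proof. by []. Qed.

Definition orth n (g : 'M[R]_n) : Prop := g *m g^T = 1%:M.
Lemma orthV n (g : 'M[R]_n) : orth g -> g^T *m g = 1%:M.
Proof. exact: mulmx1C. Qed.
Lemma orthT n (g : 'M[R]_n) : orth g -> orth g^T.
Proof. by move=> /orthV; rewrite /orth trmxK. Qed.
Lemma orthM n (g h : 'M[R]_n) : orth g -> orth h -> orth (g *m h).
Proof. by move=> og oh; rewrite /orth trmx_mul mulmxA -(mulmxA g) oh mulmx1. Qed.
Lemma orth1 n : orth (1%:M : 'M[R]_n).
Proof. by rewrite /orth trmx1 mulmx1. Qed.
Lemma orthK n p (g : 'M[R]_n) (x : 'M[R]_(p, n)) : orth g -> x *m g *m g^T = x.
Proof. by move=> og; rewrite -mulmxA og mulmx1. Qed.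
Lemma orthKV n p (g : 'M[R]_n) (x : 'M[R]_(p, n)) : orth g -> x *m g^T *m g = x.
Proof. by move=> og; rewrite -mulmxA orthV// mulmx1. Qed.
Lemma dot_orth n (g : 'M[R]_n) x y : orth g -> dot (x *m g) (y *m g) = dot x y.
Proof. by move=> og; rewrite dot_mulmx orthK. Qed.
Lemma enorm_orth n (g : 'M[R]_n) x : orth g -> enorm (x *m g) = enorm x.
Proof.
move=> og; apply/eqP; rewrite -(@eqrXn2 _ 2)// ?enorm_ge0//.
by rewrite -!dotxx dot_orth.
Qed.

(** The topology of ['rV[R]_n] is that of the sup norm, which bounds [enorm] up to the factor sqrt
    n. *)
Lemma enorm_lip n (V : normedModType R) (f : 'rV[R]_n -> V) C :
  (forall x y, `|f x - f y| <= C * enorm (x - y)) -> continuous f.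
Proof.
move=> h x; apply/(@cvgrPdist_le R V _ (nbhs x) (nbhs_filter x)) => e e0.
(* The added ones keep [D] positive when [C] or [n] vanishes. *)
pose D := (`|C| + 1) * (Num.sqrt n%:R + 1).
have D0 : 0 < D by rewrite mulr_gt0 // ltr_wpDl ?sqrtr_ge0//.
apply/nbhs_ballP; exists (e / D) => /=; first by rewrite divr_gt0.
move=> y; rewrite -ball_normE /= => xy.
apply: (le_trans (h _ _)).
apply: (@le_trans _ _ (D * `|x - y|)); last by rewrite mulrC -ler_pdivlMr// ltW.
apply: (@le_trans _ _ ((`|C| + 1) * enorm (x - y))).
  by rewrite ler_wpM2r ?enorm_ge0// (le_trans (ler_norm C))// lerDl.
rewrite /D -mulrA ler_wpM2l ?addr_ge0// (le_trans (enorm_sup _))// ler_wpM2r//.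
by rewrite lerDl.
Qed.
Lemma enormBC n (x y : 'rV[R]_n) : enorm (x - y) = enorm (y - x).
Proof. by rewrite -enormN opprB. Qed.
Lemma enorm_dist n (x y : 'rV[R]_n) : `|enorm x - enorm y| <= enorm (x - y).
Proof.
have := enormD (x - y) y; have := enormD (y - x) x; rewrite !subrK enormBC ler_norml => h1 h2.
apply/andP; split; lra.
Qed.
Lemma enorm_continuous n : continuous (@enorm n : 'rV[R]_n -> R).
Proof. by apply: (@enorm_lip _ _ _ 1) => x y; rewrite mul1r; exact: enorm_dist. Qed.
Lemma mulmx_bound n p (M : 'M[R]_(n, p)) : exists2 C, 0 <= C & forall x : 'rV[R]_n, enorm (x *m M) <= C * enorm x.
Proof.
pose S := \sum_i enorm (row i M^T).
have S0 : 0 <= S by apply: sumr_ge0 => i _; exact: enorm_ge0.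
exists (Num.sqrt p%:R * S); first by rewrite mulr_ge0 ?sqrtr_ge0.
move=> x; apply: (le_trans (enorm_sup _)); rewrite -mulrA ler_wpM2l ?sqrtr_ge0//.
rewrite [leLHS]mx_normrE; apply: bigmax_le; first by rewrite mulr_ge0 ?enorm_ge0.
move=> [i j] _ /=; rewrite (ord1 i).
have -> : (x *m M) 0 j = dot x (row j M^T) by rewrite mxE; apply: eq_bigr => l _; rewrite !mxE.
have h : enorm (row j M^T) <= S.
  by rewrite /S (bigD1 j)//= lerDl sumr_ge0// => l _; exact: enorm_ge0.
rewrite ler_norml -lerNl -dotNl; have h1 := cauchy_schwarz x (row j M^T); have := cauchy_schwarz (- x) (row j M^T).
rewrite enormN => h2; apply/andP; split; [apply: (le_trans h2)|apply: (le_trans h1)];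
  by rewrite mulrC ler_wpM2r ?enorm_ge0.
Qed.
Lemma mulmx_continuous n p (M : 'M[R]_(n, p)) : continuous (fun x : 'rV[R]_n => x *m M).
Proof.
have [C C0 h] := mulmx_bound M.
apply: (@enorm_lip _ _ _ C) => x y; rewrite -mulmxBl.
by apply: (le_trans (sup_enorm _)); exact: h.
Qed.
Lemma bounded_enorm n (A : set 'rV[R]_n) r : (forall x, A x -> enorm x <= r) -> bounded_set A.
Proof.
move=> h; exists r; split; first exact: num_real.
move=> s rs x Ax; apply: (le_trans (sup_enorm x)); apply: (le_trans (h _ Ax)); exact: ltW.
Qed.
Lemma compact_enorm n (A : set 'rV[R]_n) : compact A -> exists2 r, 0 < r & forall x, A x -> enorm x <= r.
Proof.
move=> /compact_bounded[M [Mr h]]; exists (Num.sqrt n%:R * (`|M| + 1) + 1).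
  by rewrite ltr_wpDl// mulr_ge0 ?sqrtr_ge0// addr_ge0.
move=> x Ax; apply: (le_trans (enorm_sup x)); rewrite ler_wpDr// ler_wpM2l ?sqrtr_ge0//.
by apply: h => //; rewrite (le_lt_trans (ler_norm M))// ltrDl.
Qed.
Lemma closed_enorm n r : closed [set x : 'rV[R]_n | enorm x <= r].
Proof.
apply: (@preimage_closed _ _ (@enorm n) [set x : R | x <= r]); last exact: closed_le.
by move=> x _; exact: enorm_continuous.
Qed.
End Euclid.

Section CompactConvexSets.
Context {R : realType}.
Local Notation lam n := (@lebesgue_rV R n).

Definition cvx n (X : set 'rV[R]_n) : Prop :=
  forall x y (t : R), 0 <= t -> t <= 1 -> X x -> X y -> X (t *: x + (1 - t) *: y).
Definition img n p (g : 'M[R]_(n, p)) (X : set 'rV[R]_n) : set 'rV[R]_p :=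
  [set x *m g | x in X].
(** Since [fine] sends an infinite measure to 0, this is the true volume only under finiteness,
    supplied by compactness in [lam_vol]. *)
Definition vol n (X : set 'rV[R]_n) : R := fine (lam n X).

Lemma convex_set_cvx n (X : set 'rV[R]_n) :
  convex_set (X : set (convex_lmodType 'rV[R]_n)) -> cvx X.
Proof.
move=> h x y t t0 t1 Xx Xy.
by have := h x y (Itv01 t0 t1); rewrite !inE => /(_ Xx Xy).
Qed.

Lemma cvx_img n p (g : 'M[R]_(n, p)) X : cvx X -> cvx (img g X).
Proof.
move=> cX _ _ t t0 t1 [x Xx <-] [y Xy <-]; exists (t *: x + (1 - t) *: y); first exact: cX.
by rewrite mulmxDl -!scalemxAl.
Qed.
Lemma cvx_sum n (X Y : set 'rV[R]_n) : cvx X -> cvx Y -> cvx (minkowski_sum X Y).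
Proof.
move=> cX cY _ _ t t0 t1 [x Xx [y Yy <-]] [x' Xx' [y' Yy' <-]].
exists (t *: x + (1 - t) *: x'); first exact: cX.
exists (t *: y + (1 - t) *: y'); first exact: cY.
by rewrite !scalerDr addrACA.
Qed.
Lemma cvx_dilate n c (X : set 'rV[R]_n) : cvx X -> cvx (dilate c X).
Proof.
move=> cX _ _ t t0 t1 [x Xx <-] [y Xy <-]; exists (t *: x + (1 - t) *: y); first exact: cX.
by rewrite scalerDr !scalerA ![c * _]mulrC.
Qed.
Lemma cvx_ball2 n : cvx (@ball2 R n).
Proof.
move=> x y t t0 t1; rewrite !ball2E => hx hy.
apply: (le_trans (enormD _ _)); rewrite !enormZ !ger0_norm ?subr_ge0//.
have := enorm_ge0 x; have := enorm_ge0 y; nra.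
Qed.

Lemma compact_img n p (g : 'M[R]_(n, p)) X : compact X -> compact (img g X).
Proof.
move=> cX; apply: continuous_compact => //; apply: continuous_subspaceT; exact: mulmx_continuous.
Qed.
Lemma compact_dilate n c (X : set 'rV[R]_n) : compact X -> compact (dilate c X).
Proof.
move=> cX; apply: continuous_compact => //; apply: continuous_subspaceT; exact: scaler_continuous.
Qed.
Lemma compact_sum n (X Y : set 'rV[R]_n) : compact X -> compact Y -> compact (minkowski_sum X Y).
Proof.
move=> cX cY.
have -> : minkowski_sum X Y = (fun z : 'rV[R]_n * 'rV[R]_n => z.1 + z.2) @` (X `*` Y).
  apply/seteqP; split => [_ [x Xx [y Yy <-]]|_ [[x y] [/= Xx Yy] <-]].
    by exists (x, y).
  by exists x => //; exists y.
apply: continuous_compact; last exact: compact_setX.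
apply: continuous_subspaceT; exact: add_continuous.
Qed.
Lemma compact_ball2 n : compact (@ball2 R n).
Proof.
apply: bounded_closed_compact; last exact: (@closed_enorm R n 1).
by apply: (@bounded_enorm R n _ 1) => x; rewrite ball2E.
Qed.
Lemma measurable_ball2 n : measurable (@ball2 R n).
Proof. by apply: compact_measurable_rV; exact: compact_ball2. Qed.

Lemma lam_bounded_fin n (A : set 'rV[R]_n) r : (forall x, A x -> enorm x <= r) -> measurable A ->
  lam n A \is a fin_num.
Proof.
move=> h mA; rewrite ge0_fin_numE//.
pose k := (Num.truncn r).+1.
have hk : r < k%:R by exact: truncnS_gt.
apply: (le_lt_trans _ (@lam_cube_fin R n k)); apply: le_measure; rewrite ?inE//.
  by apply: (@measurable_box R n (fun=> `](- k%:R)%R, k%:R]%classic)) => i; exact: measurable_itv.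
move=> x Ax i /=; rewrite in_itv /=.
have := le_lt_trans (le_trans (enorm_coor x i) (h x Ax)) hk.
by rewrite ltr_norml => /andP[-> /ltW ->].
Qed.
Lemma compact_fin n (A : set 'rV[R]_n) : compact A -> lam n A \is a fin_num.
Proof.
move=> cA; have [r _ h] := compact_enorm cA.
by apply: lam_bounded_fin h _; exact: compact_measurable_rV.
Qed.
Lemma lam_vol n (A : set 'rV[R]_n) : compact A -> lam n A = (vol A)%:E.
Proof. by move=> cA; rewrite /vol fineK// compact_fin. Qed.
Lemma vol_ge0 n (A : set 'rV[R]_n) : 0 <= vol A.
Proof. by rewrite /vol fine_ge0. Qed.
Lemma vol_le n (A B : set 'rV[R]_n) : compact A -> compact B -> A `<=` B -> vol A <= vol B.
Proof.
by move=> cA cB AB; rewrite -lee_fin -!lam_vol//; apply: le_measure => //; rewrite inE; exact: compact_measurable_rV.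
Qed.
Lemma dilateE n c (X : set 'rV[R]_n) : 0 < c -> dilate c X = (fun x => c^-1 *: x) @^-1` X.
Proof.
move=> c0; apply/seteqP; split => [_ [x Xx <-]|x Xx] /=.
  by rewrite scalerA mulVf ?scale1r// gt_eqF.
by exists (c^-1 *: x) => //; rewrite scalerA mulfV ?scale1r// gt_eqF.
Qed.
Lemma lam_dilate n c (X : set 'rV[R]_n) : 0 < c -> measurable X -> lam n (dilate c X) = ((c ^+ n)%:E * lam n X)%E.
Proof.
move=> c0 mX; have ci : 0 < c^-1 by rewrite invr_gt0.
rewrite dilateE// -(lam_scale ci mX) muleA -EFinM -exprMn mulfV ?gt_eqF// expr1n mul1e //.
Qed.
Lemma vol_dilate n c (X : set 'rV[R]_n) : 0 < c -> compact X -> vol (dilate c X) = c ^+ n * vol X.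
Proof.
move=> c0 cX; rewrite /vol lam_dilate//; last exact: compact_measurable_rV.
by rewrite fineM// compact_fin.
Qed.
Lemma vol_dilate0 n c (X : set 'rV[R]_n) : (0 < n)%N -> 0 <= c -> compact X -> X !=set0 -> vol (dilate c X) = c ^+ n * vol X.
Proof.
move=> n0; rewrite le_eqVlt => /orP[/eqP <-|c0] cX [x Xx]; last exact: vol_dilate.
rewrite expr0n gtn_eqF// mul0r.
have -> : dilate 0 X = [set v | forall i, [set 0 : R] (v ord0 i)].
  apply/seteqP; split => [_ [y Xy <-] i|y hy] /=; first by rewrite mxE mul0r.
  by exists x => //; rewrite scale0r; apply/rowP => i; rewrite mxE hy.
rewrite /vol (@lebesgue_rV_box R n (fun=> [set 0])) => [|i]; last exact: measurable_set1.
rewrite (eq_bigr (fun=> 0%E)) => [|i _]; last exact: lebesgue_measure_set1.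
by case: n n0 X cX x Xx => // n _ X cX x Xx; rewrite big_ord_recl mul0e.
Qed.
Lemma shiftE n (a : 'rV[R]_n) X : [set x + a | x in X] = (fun x => x - a) @^-1` X.
Proof.
apply/seteqP; split => [_ [x Xx <-]|x Xx] /=; first by rewrite addrK.
by exists (x - a) => //; rewrite subrK.
Qed.
Lemma lam_translate n (a : 'rV[R]_n) (X : set 'rV[R]_n) : measurable X -> lam n [set x + a | x in X] = lam n X.
Proof. by move=> mX; rewrite shiftE lam_shift. Qed.
Lemma ball_enormE n r : 0 < r -> dilate r (@ball2 R n) = [set x | enorm x <= r].
Proof.
move=> r0; rewrite dilateE//; apply/seteqP; split => x /=; rewrite ball2E enormZ ger0_norm ?invr_ge0 ?(ltW r0)//.
  by rewrite mulrC ler_pdivrMr// mul1r.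
by rewrite mulrC ler_pdivrMr// mul1r.
Qed.
Lemma omega_gt0 n : 0 < @omega R n.
Proof.
(* Half-side of a cube inside the unit ball, by the comparison of the two norms; the added 1 covers
   n = 0. *)
pose c : R := (Num.sqrt n%:R + 1)^-1.
have d0 : 0 < Num.sqrt n%:R + 1 :> R by rewrite ltr_wpDl ?sqrtr_ge0.
have c0 : 0 < c by rewrite invr_gt0.
rewrite /omega -lte_fin -[X in (_ < X)%E]/(vol (@ball2 R n))%:E -lam_vol; last exact: compact_ball2.
apply: (@lt_le_trans _ _ (lam n [set v | forall i, (`[-c, c]%classic : set R) (v ord0 i)])).
  rewrite (@lebesgue_rV_box R n (fun=> `[-c, c]%classic)) => [|i]; last exact: measurable_itv.
  under eq_bigr do rewrite lebesgue_measure_itv /= lte_fin (lt_trans _ c0) ?oppr_lt0// -EFinB.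
  by rewrite prodEFin lte_fin prodr_gt0// => i _; rewrite opprK addr_gt0.
apply: le_measure; rewrite ?inE; last 2 first.
- exact: measurable_ball2.
- move=> x h; rewrite ball2E; apply: (le_trans (enorm_sup _)).
  have : `|x| <= c.
    rewrite [leLHS]mx_normrE; apply: bigmax_le; first exact: ltW.
    by move=> [i j] _ /=; rewrite (ord1 i); have := h j; rewrite /= in_itv /= ler_norml.
  move=> h1; apply: (@le_trans _ _ ((Num.sqrt n%:R + 1) * c)); last by rewrite mulfV ?gt_eqF.
  by rewrite ler_pM ?sqrtr_ge0// lerDl.
by apply: (@measurable_box R n (fun=> `[-c, c]%classic)) => i; exact: measurable_itv.
Qed.
Lemma lam_ball_gt0 n (p : 'rV[R]_n) r A : 0 < r -> measurable A -> (forall x, enorm (x - p) <= r -> A x) -> (0 < lam n A)%E.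
Proof.
move=> r0 mA h.
have mB : measurable (dilate r (@ball2 R n)) by apply: compact_measurable_rV; apply: compact_dilate; exact: compact_ball2.
apply: (@lt_le_trans _ _ (lam n [set x + p | x in dilate r (@ball2 R n)])).
  rewrite lam_translate// lam_dilate//; last exact: measurable_ball2.
  rewrite lam_vol; last exact: compact_ball2.
  by rewrite -EFinM lte_fin mulr_gt0 ?exprn_gt0//; exact: omega_gt0.
apply: le_measure; rewrite ?inE//.
  rewrite shiftE; apply: measurable_preim => //; apply: measurable_addmx => //; exact: measurable_cst.
by rewrite ball_enormE// => _ [x hx <-]; apply: h; rewrite addrK.
Qed.

End CompactConvexSets.

Section RotationInvariance.
Context {R : realType}.
Local Notation lam n := (@lebesgue_rV R n).
Local Open Scope ereal_scope.

Lemma integral_if_cst d (T : measurableType d) (mu : {measure set T -> \bar R}) (B : set T) c (f : T -> \bar R) :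
  measurable B -> 0 <= c -> (forall x, B x -> f x = c) -> (forall x, ~ B x -> f x = 0) ->
  \int[mu]_x f x = mu B * c.
Proof.
move=> mB c0 h1 h2; transitivity (\int[mu]_x ((\1_B x)%:E * c)).
  apply: eq_integral => x _; rewrite indicE; have [Bx|Bx] := pselect (B x).
    by rewrite mem_set// mul1e h1.
  by rewrite memNset// mul0e h2.
rewrite ge0_integralZr//; first by rewrite integral_indic// setIT.
by apply/measurable_EFinP; exact: measurable_indic.
Qed.

(* By Tonelli, the measure of {(x, y) | |x| <= 1, y g + x in A} is both
   |B| |A g^-1| and |B g^-1| |A|; and the ball satisfies B g^-1 = B. *)
Lemma lam_orth n (g : 'M[R]_n) (A : set 'rV[R]_n) : orth g -> measurable A ->
  lam n ((fun x => x *m g) @^-1` A) = lam n A.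
Proof.
move=> og mA.
set C := _ @^-1` A.
have mg := @measurable_mulmx R _ _ g.
have mC : measurable C by exact: measurable_preim.
have mB := @measurable_ball2 R n.
pose T := ('rV[R]_n * 'rV[R]_n)%type.
have m1 : measurable_fun setT (fst : T -> 'rV[R]_n) by exact: measurable_fst.
have m2 : measurable_fun setT (snd : T -> 'rV[R]_n) by exact: measurable_snd.
have m2g : measurable_fun setT (fun z : T => z.2 *m g) by exact: (measurableT_comp mg).
have m2ng : measurable_fun setT (fun z : T => - (z.2 *m g))%R.
  rewrite (_ : (fun z : T => - (z.2 *m g))%R = (fun z : T => (z.2 *m g) *m (- 1)%:M)).
    by apply: (measurableT_comp (@measurable_mulmx R _ _ _)).
  by apply/funext => z; rewrite mul_mx_scalar scaleN1r.
pose D : set T := [set z | ball2 n z.1 /\ A (z.2 *m g + z.1)%R].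
pose E : set T := [set z | A z.1 /\ ball2 n (z.1 - z.2 *m g)%R].
have mD : measurable D.
  have -> : D = (fst @^-1` (ball2 n)) `&` ((fun z : T => z.2 *m g + z.1)%R @^-1` A) by [].
  by apply: measurableI; apply: measurable_preim => //; exact: measurable_addmx.
have mE : measurable E.
  have -> : E = (fst @^-1` A) `&` ((fun z : T => z.1 - z.2 *m g)%R @^-1` (ball2 n)) by [].
  by apply: measurableI; apply: measurable_preim => //; exact: measurable_addmx.
have e1 : (lam n \x lam n) D = lam n (ball2 n) * lam n C.
  apply: integral_if_cst => // x hx.
    rewrite -(lam_shift (x *m g^T) mC); congr (lam n _).
    apply/seteqP; split => y; rewrite /xsection /= inE /D /C /= mulmxDl (orthKV _ og); [by case|by split].
  rewrite /= (_ : xsection D x = set0) ?measure0//.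
  by apply/seteqP; split => // y; rewrite /xsection /= inE /D /= => -[].
have e2 : (lam n \x lam n) E = lam n A * lam n (ball2 n).
  apply: integral_if_cst => // x hx.
    rewrite -(lam_shift (- (x *m g^T))%R mB); congr (lam n _).
    have e y : enorm (x - y *m g) = enorm (y - x *m g^T).
      by rewrite enormBC -(enorm_orth _ (orthT og)) mulmxBl orthK.
    apply/seteqP; split => y; rewrite /xsection /= inE /E /= !ball2E e; [by case|by split].
  rewrite /= (_ : xsection E x = set0) ?measure0//.
  by apply/seteqP; split => // y; rewrite /xsection /= inE /E /= => -[].
have e3 : (lam n \x lam n) D = (lam n \x lam n) E.
  rewrite !product_measure12//; apply: eq_integral => y _.
  have mEy : measurable (ysection E y) by exact: measurable_ysection.
  rewrite -(lam_shift (y *m g) mEy); congr (lam n _).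
  apply/seteqP; split => x; rewrite /ysection /= !inE /E /D /= addrK addrC //.
    by case => ? ?; split; rewrite // addrC.
  by case => ? ?; split; rewrite // addrC.
have b0 := @omega_gt0 R n; rewrite -lte_fin in b0.
move: e1; rewrite e3 e2 (lam_vol (@compact_ball2 R n)).
rewrite muleC => /esym h.
have := congr1 (fun x => ((vol (@ball2 R n))^-1)%:E * x) h.
by rewrite !muleA -!EFinM mulVf ?mul1e// gt_eqF// -lte_fin.
Qed.

Lemma img_orthE n (g : 'M[R]_n) (X : set 'rV[R]_n) : orth g -> img g X = (fun x => x *m g^T) @^-1` X.
Proof.
move=> og; apply/seteqP; split => [_ [x Xx <-]|x Xx] /=; first by rewrite orthK.
by exists (x *m g^T) => //; rewrite orthKV.
Qed.
Lemma lam_img n (g : 'M[R]_n) (X : set 'rV[R]_n) : orth g -> measurable X -> lam n (img g X) = lam n X.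
Proof. by move=> og mX; rewrite img_orthE// lam_orth//; exact: orthT. Qed.
Lemma vol_img n (g : 'M[R]_n) (X : set 'rV[R]_n) : orth g -> measurable X -> vol (img g X) = vol X.
Proof. by move=> og mX; rewrite /vol lam_img. Qed.
End RotationInvariance.

(** * Separating a point from a convex set *)

Section Separation.
Context {R : realType}.

Lemma enorm_sqrD n (x y : 'rV[R]_n) t :
  enorm (x + t *: y) ^+ 2 = enorm x ^+ 2 + 2%:R * t * dot y x + t ^+ 2 * enorm y ^+ 2.
Proof. by rewrite -!dotxx dotDl !dotDr !dotZl !dotZr (dotC x y); ring. Qed.

Lemma small_step (D M : R) : 0 < D -> 0 < M -> exists t, [/\ 0 < t, t <= 1 & t * M <= D / 4%:R].
Proof.
move=> D0 M0; have DM : 0 < D + M by exact: addr_gt0.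
exists (D / (D + M) / 4%:R); split.
- by apply: divr_gt0 => //; exact: divr_gt0.
- rewrite ler_pdivrMr// ler_pdivrMr//; nra.
- rewrite mulrAC ler_wpM2r// mulrAC ler_pdivrMr//; nra.
Qed.

(* An approximate nearest point of a bounded convex set already separates. *)
Lemma separation n (H : set 'rV[R]_n) y d r : cvx H -> 0 < d ->
  (forall z, H z -> d <= enorm (z - y)) -> (forall z, H z -> enorm z <= r) ->
  exists v, exists2 c, 0 < c & forall z, H z -> c <= dot (z - y) v.
Proof.
move=> cH d0 hd hr.
have [[z1 Hz1]|H0] := pselect (exists z, H z); last first.
  by exists 0, 1 => // z Hz; case: H0; exists z.
pose S := [set enorm (z - y) ^+ 2 | z in H].
have hS : has_inf S.
  split; first by exists (enorm (z1 - y) ^+ 2); exists z1.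
  by exists 0 => _ [z _ <-]; exact: sqr_ge0.
pose M := (r + r) ^+ 2 + 1.
have M0 : 0 < M by rewrite ltr_wpDl// sqr_ge0.
pose I := inf S.
have I1 : d ^+ 2 <= I.
  apply: lb_le_inf; first by case: hS.
  by move=> _ [z Hz <-]; rewrite ler_sqr ?nnegrE ?enorm_ge0 ?(ltW d0)//; exact: hd.
pose D := d ^+ 2.
have D0 : 0 < D by rewrite exprn_gt0.
have [t [t0 t1 tM]] := small_step D0 M0.
(* [z0] is optimal up to t^2. Moving it by the fraction t towards [z] gains 2 t
   [dot (z - z0) (z0 - y)] plus a term of order t^2; after division by t both errors are at most D /
   4, against a squared distance of at least D. *)
have [_ [z0 Hz0 <-] h0] := inf_adherent (exprn_gt0 2 t0) hS.
exists (z0 - y), (D / 4%:R); first by rewrite divr_gt0.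
move=> z Hz.
have Hw : H (t *: z + (1 - t) *: z0) by apply: cH => //; exact: ltW.
have h2 : I <= enorm (t *: z + (1 - t) *: z0 - y) ^+ 2 by apply: ge_inf; [case: hS|exists (t *: z + (1 - t) *: z0)].
have e : t *: z + (1 - t) *: z0 - y = (z0 - y) + t *: (z - z0).
  by apply/rowP => i; rewrite !mxE; ring.
have h3 : enorm (z - z0) ^+ 2 <= M.
  have : enorm (z - z0) <= r + r by apply: (le_trans (enormB _ _)); apply: lerD; exact: hr.
  have := enorm_ge0 (z - z0); rewrite /M; nra.
have e2 : z - y = (z - z0) + (z0 - y) by rewrite addrA subrK.
rewrite e2 dotDl dotxx.
move: h2; rewrite e enorm_sqrD.
move: h0; rewrite -/I; set a := enorm (z0 - y) ^+ 2; set b := dot (z - z0) _; set c := enorm (z - z0) ^+ 2 in h3 *.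
move=> h0 h2.
have h6 : D <= a by apply: (le_trans I1); apply: ge_inf; [case: hS|exists z0].
have h7 : t <= D / 4%:R.
  apply: le_trans tM; rewrite ler_peMr ?(ltW t0)// /M; have := sqr_ge0 (r + r); lra.
clearbody I D M a b c.
have h4 : - t <= 2%:R * b + t * c.
  rewrite -(ler_pM2l t0); nra.
have h5 : t * c <= t * M by rewrite ler_wpM2l// ltW.
by move: h4 h5 h6 h7 tM t1 t0; clear; lra.
Qed.

Lemma compact_dist n (X : set 'rV[R]_n) y : compact X -> ~ X y ->
  exists2 d, 0 < d & forall z, X z -> d <= enorm (z - y).
Proof.
move=> cX Xy.
have cl : closed X by apply: compact_closed => //; exact: norm_hausdorff.
have : nbhs y (~` X) by apply: open_nbhs_nbhs; split => //; exact: closed_openC.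
move=> /nbhs_ballP[e /= e0 h]; exists e => // z Xz; rewrite leNgt; apply/negP => hz.
have : (~` X) z.
  by apply: h; rewrite -ball_normE /=; apply: (le_lt_trans (sup_enorm _)); rewrite enormBC.
exact.
Qed.

Lemma compact_separation n (X : set 'rV[R]_n) y : compact X -> cvx X -> ~ X y ->
  exists v, exists2 c, 0 < c & forall z, X z -> c <= dot (z - y) v.
Proof.
move=> cX vX /(compact_dist cX)[d d0 hd]; have [r _ hr] := compact_enorm cX.
exact: separation vX d0 hd hr.
Qed.
End Separation.

(** * Orthogonal matrices and invariant averages *)

Section OrthogonalMatrices.
Context {R : realType}.

Definition e0 n : 'rV[R]_n.+1 := delta_mx 0 0.

Lemma enorm_e0 n : enorm (e0 n) = 1.
Proof.
rewrite /enorm /e0 (bigD1 ord0)//= big1 => [|i i0]; first by rewrite mxE !eqxx expr1n addr0 sqrtr1.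
by rewrite mxE (negbTE i0) andbF expr0n.
Qed.

(** The reflection in the hyperplane orthogonal to [u - enorm u *: e0 n] exchanges these two vectors
    of equal norm; it is undefined exactly when they coincide, and then the identity serves. *)
Lemma householder n (u : 'rV[R]_n.+1) : exists2 g, orth g & u *m g = enorm u *: e0 n.
Proof.
have [h|h] := eqVneq u (enorm u *: e0 n).
  by exists 1%:M; [exact: orth1|rewrite mulmx1].
pose w := u - enorm u *: e0 n.
have w0 : enorm w != 0.
  by apply/negP => /eqP /enorm_eq0 /eqP; rewrite subr_eq0 (negbTE h).
pose c := 2%:R / enorm w ^+ 2.
pose P : 'M[R]_n.+1 := w^T *m w.
have wT : w *m w^T = (enorm w ^+ 2)%:M by rewrite [LHS]mx11_scalar -dotE dotxx.
have PP : P *m P = enorm w ^+ 2 *: P.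
  by rewrite /P mulmxA -(mulmxA _ w) wT mul_mx_scalar -scalemxAl.
have uP : u *m P = dot u w *: w.
  by rewrite /P mulmxA [u *m w^T]mx11_scalar -dotE mul_scalar_mx.
have uw : 2%:R * dot u w = enorm w ^+ 2.
  rewrite -dotxx /w !(dotBl, dotBr, dotZl, dotZr) (dotC (e0 n) u) !dotxx enorm_e0.
  by ring.
pose g : 'M[R]_n.+1 := 1%:M - c *: P.
have gT : g^T = g by rewrite /g linearB /= linearZ /= trmx_mul trmxK trmx1.
exists g.
  clearbody P; rewrite /orth gT /g mulmxBl mul1mx mulmxBr mulmx1 -scalemxAl -scalemxAr PP !scalerA.
  have -> : c * c * enorm w ^+ 2 = 2%:R * c by rewrite /c; field.
  by apply/matrixP => i j; rewrite !mxE; ring.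
rewrite /g mulmxBr mulmx1 -scalemxAr uP scalerA.
have -> : c * dot u w = 1.
  by rewrite /c mulrAC uw mulfV// expf_neq0.
by rewrite scale1r /w opprB addrC subrK.
Qed.

(** Up to a rotation every linear functional is a multiple of the first coordinate, so that sums of
    [dot] over the rows of a net reduce to averages of the single entry [g 0 0]. *)
Lemma unit_dir n (v : 'rV[R]_n.+1) : exists2 h, orth h &
  forall x, dot x v = enorm v * (x *m h) 0 0.
Proof.
have [h oh vh] := householder v; exists h => // x.
rewrite -(dot_orth x v oh) vh dotZr; congr (_ * _).
rewrite /dot (bigD1 ord0)//= big1 => [|i i0]; first by rewrite [e0 _ _ _]mxE !eqxx mulr1 addr0.
by rewrite [e0 _ _ _]mxE (negbTE i0) andbF mulr0.
Qed.

Lemma orth_block n (g : 'M[R]_n) m : orth g -> orth (block_mx (1%:M : 'M[R]_m) 0 0 g).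
Proof.
move=> og; rewrite /orth tr_block_mx mulmx_block !trmx0 !(mulmx0, mul0mx, addr0, add0r) trmx1 mulmx1 og.
by rewrite -scalar_mx_block.
Qed.
Lemma orth_blockl n (g : 'M[R]_n) m : orth g -> orth (block_mx g 0 0 (1%:M : 'M[R]_m)).
Proof.
move=> og; rewrite /orth tr_block_mx mulmx_block !trmx0 !(mulmx0, mul0mx, addr0, add0r) trmx1 mulmx1 og.
by rewrite -scalar_mx_block.
Qed.

Lemma pid_block1 d p : block_mx (1%:M : 'M[R]_1) 0 0 (pid_mx d : 'M[R]_(d, p)) =
  (pid_mx d.+1 : 'M[R]_(1 + d, 1 + p)).
Proof.
apply/matrixP => i j; case: (@split_ordP 1 d i) => i' ->; case: (@split_ordP 1 p j) => j' ->.
- by rewrite block_mxEul (ord1 i') (ord1 j') !mxE.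
- by rewrite block_mxEur (ord1 i') !mxE.
- by rewrite block_mxEdl (ord1 j') !mxE.
- by rewrite block_mxEdr !mxE.
Qed.

(** Once a reflection sends the first row to the first axis, orthonormality makes the other rows
    vanish in the first column; what remains of them is a shorter frame in one dimension less. *)
Lemma frame_to_std d k (U : 'M[R]_(d, d + k)) : U *m U^T = 1%:M ->
  exists2 g, orth g & U *m g = pid_mx d.
Proof.
elim: d U => [|d IH] U hU.
  by exists 1%:M; [exact: orth1|apply/matrixP => -[]].
pose u : 'rV[R]_(d + k).+1 := row 0 U.
have [g1 og1 hu] := @householder (d + k)%N u.
have u1 : enorm u = 1.
  apply/eqP; rewrite -(@eqrXn2 _ 2)// ?enorm_ge0// -dotxx expr1n.
  have h : (U *m U^T) 0 0 = 1 by rewrite hU mxE eqxx.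
  by apply/eqP; rewrite -h mxE; apply: eq_bigr => i _; rewrite !mxE.
rewrite u1 scale1r in hu.
pose V : 'M[R]_(1 + d, 1 + (d + k)) := U *m g1.
have VV : V *m V^T = 1%:M by rewrite /V trmx_mul mulmxA orthK.
have eV : V = block_mx 1%:M 0 (dlsubmx V) (drsubmx V).
  rewrite -[LHS]submxK; congr block_mx.
    apply/matrixP => i j; rewrite !ord1.
    have h : (u *m g1) 0 0 = 1 by rewrite hu mxE !eqxx.
    rewrite [RHS]mxE eqxx -h !mxE; apply: eq_bigr => l _; rewrite !mxE; congr (U _ _ * g1 _ _); exact: val_inj.
  apply/matrixP => i j; rewrite !ord1.
  have h : (u *m g1) 0 (rshift 1 j) = 0 by rewrite hu mxE.
  rewrite [RHS]mxE -h !mxE; apply: eq_bigr => l _; rewrite !mxE; congr (U _ _ * g1 _ _); exact: val_inj.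
move: VV; rewrite eV tr_block_mx mulmx_block !trmx0 !trmx1 !(mulmx0, mul0mx, mulmx1, mul1mx, addr0, add0r).
rewrite (scalar_mx_block 1 d 1) => /eq_block_mx[_ _ C0 WW].
rewrite C0 mul0mx add0r in WW.
have [g2 og2 h2] := IH _ WW.
exists (g1 *m (block_mx (1%:M : 'M[R]_1) 0 0 g2 : 'M[R]_(1 + (d + k)))).
  exact: (orthM og1 (@orth_block _ g2 1 og2)).
transitivity (V *m (block_mx (1%:M : 'M[R]_1) 0 0 g2 : 'M[R]_(1 + (d + k)))).
  exact: mulmxA.
rewrite eV C0 mulmx_block !(mulmx0, mul0mx, mulmx1, mul1mx, addr0, add0r) h2.
exact: pid_block1.
Qed.

(** The Frobenius norm. Flattening places O(n) in a Euclidean space, where compactness is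
    available. *)
Definition fn n p (A : 'M[R]_(n, p)) : R := enorm (mxvec A).
Lemma fn_sqr n p (A : 'M[R]_(n, p)) : fn A ^+ 2 = \tr (A *m A^T).
Proof.
rewrite -dotxx /dot (reindex _ (curry_mxvec_bij n p)) /=.
transitivity (\sum_(p0 : 'I_n * 'I_p) A p0.1 p0.2 * A p0.1 p0.2).
  by apply: eq_bigr => -[i j] _ /=; rewrite mxvecE.
rewrite -(pair_bigA _ (fun i j => A i j * A i j)) /=.
by apply: eq_bigr => i _; rewrite mxE; apply: eq_bigr => j _; rewrite mxE.
Qed.
Lemma fn_ge0 n p (A : 'M[R]_(n, p)) : 0 <= fn A. Proof. exact: enorm_ge0. Qed.
Lemma fn_orth n p (A : 'M[R]_(n, p)) g : orth g -> fn (A *m g) = fn A.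
Proof.
move=> og; apply/eqP; rewrite -(@eqrXn2 _ 2)// ?fn_ge0// !fn_sqr trmx_mul mulmxA.
by rewrite orthK.
Qed.
Lemma fnD n p (A B : 'M[R]_(n, p)) : fn (A + B) <= fn A + fn B.
Proof. by rewrite /fn linearD; exact: enormD. Qed.
Lemma fnBC n p (A B : 'M[R]_(n, p)) : fn (A - B) = fn (B - A).
Proof. by rewrite /fn !linearB /= enormBC. Qed.
Lemma fn_coor n p (A : 'M[R]_(n, p)) i j : `|A i j| <= fn A.
Proof. by rewrite -mxvecE; exact: enorm_coor. Qed.
Lemma fn_of_orth n (g : 'M[R]_n) : orth g -> fn g = Num.sqrt n%:R.
Proof.
move=> og; apply/eqP; rewrite -(@eqrXn2 _ 2)// ?fn_ge0 ?sqrtr_ge0// fn_sqr og sqr_sqrtr ?ler0n//.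
by rewrite mxtrace1.
Qed.
Lemma fn_mul n p (x : 'rV[R]_n) (A : 'M[R]_(n, p)) : enorm (x *m A) <= enorm x * fn A.
Proof.
rewrite -ler_sqr ?nnegrE ?mulr_ge0 ?enorm_ge0// exprMn -(dotxx (_ *m _)).
rewrite fn_sqr -mxtrace_tr trmx_mul trmxK mxtrace_mulC /mxtrace mulr_sumr.
rewrite /dot; apply: ler_sum => j _.
have e : (x *m A) 0 j = dot x (row j A^T) by rewrite mxE; apply: eq_bigr => l _; rewrite !mxE.
have -> : (A^T *m A) j j = enorm (row j A^T) ^+ 2.
  by rewrite -dotxx mxE; apply: eq_bigr => l _; rewrite !mxE.
rewrite [leLHS](_ : _ = (x *m A) 0 j ^+ 2)// e -exprMn -[leLHS]real_normK ?num_real//.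
rewrite ler_sqr ?nnegrE ?mulr_ge0 ?enorm_ge0// ler_norml cauchy_schwarz andbT -lerNl -dotNl.
by rewrite -(enormN x) cauchy_schwarz.
Qed.
End OrthogonalMatrices.

(** * Minimal nets of O(n) and their asymptotic invariance *)

Section OrthogonalNets.
Context {R : realType}.

(** The counts say that, after sorting, each entry of [X] is at most the corresponding entry of [Y].
    Removing the two maxima preserves the hypothesis. *)
Lemma leq_sum_count (X Y : seq R) : size X = size Y ->
  (forall t, count (fun x => (t < x)%R) X <= count (fun x => (t < x)%R) Y)%N ->
  \sum_(x <- X) x <= \sum_(y <- Y) y.
Proof.
have maxP (Z : seq R) : Z != [::] -> exists2 z, z \in Z & forall x, x \in Z -> x <= z.
  elim: Z => // a Z IH _; have [->|/IH[z zZ hz]] := eqVneq Z [::].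
    by exists a; [rewrite mem_head|move=> x; rewrite inE => /eqP ->].
  have [az|za] := leP a z.
    by exists z; [rewrite inE zZ orbT|move=> x; rewrite inE => /orP[/eqP ->|/hz]].
  exists a; first by rewrite mem_head.
  by move=> x; rewrite inE => /orP[/eqP ->|/hz h]//; exact: (le_trans h (ltW za)).
have c0 (Z : seq R) z : (forall x, x \in Z -> x <= z) -> forall t, z <= t -> count (fun x => t < x) Z = 0%N.
  move=> hz t zt; apply/eqP; rewrite -leqn0 leqNgt -has_count; apply/hasP => -[x xZ].
  by rewrite ltNge (le_trans (hz x xZ) zt).
move: {2}(size X) (erefl (size X)) => m; elim: m X Y => [|m IH] X Y sX sXY h.
  by move: sX sXY => /size0nil ->; move=> /esym /size0nil ->; rewrite !big_nil.
have X0 : X != [::] by rewrite -size_eq0 sX.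
have Y0 : Y != [::] by rewrite -size_eq0 -sXY sX.
have [x xX hx] := maxP _ X0; have [y yY hy] := maxP _ Y0.
have xy : x <= y.
  rewrite leNgt; apply/negP => yx; have := h y; rewrite (c0 _ _ hy)// leqn0 => /eqP h0.
  have : (0 < count (fun z => (y < z)%R) X)%N by rewrite -has_count; apply/hasP; exists x.
  by rewrite h0.
rewrite (perm_big _ (perm_to_rem xX)) (perm_big _ (perm_to_rem yY)) /= !big_cons.
apply: lerD => //; apply: IH; rewrite ?size_rem ?sX// -?sXY ?sX//.
move=> t; rewrite !count_rem xX yY /=.
have := h t; have [ty|ty] := ltP t y; have [tx|tx] := ltP t x => //=.
- by move=> ?; rewrite leq_sub2r.
- by rewrite (c0 _ _ hx).
- by have := lt_le_trans tx (le_trans xy ty); rewrite ltxx.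
- by rewrite !subn0.
Qed.

Definition is_net n (e : R) (S : seq 'M[R]_n) : Prop :=
  (forall s, s \in S -> orth s) /\ forall g, orth g -> exists2 s, s \in S & fn (g - s) <= e.

Lemma orth_closed n : closed [set v : 'rV[R]_(n * n) | orth (vec_mx v)].
Proof.
have -> : [set v : 'rV[R]_(n * n) | orth (vec_mx v)] =
  \bigcap_(ij in [set: 'I_n * 'I_n]) ((fun v : 'rV[R]_(n * n) => (vec_mx v *m (vec_mx v)^T) ij.1 ij.2) @^-1` [set (ij.1 == ij.2)%:R]).
  apply/seteqP; split => [v h [i j] _ /=|v h].
    by rewrite h mxE.
  by apply/matrixP => i j; rewrite [RHS]mxE; exact: (h (i, j)).
apply: closed_bigI => -[i j] _ /=; apply: preimage_closed; last exact: closed_eq.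
rewrite (_ : (fun v : 'rV[R]_(n * n) => _) = fun v : 'rV[R]_(n * n) => \sum_l (v ord0 (mxvec_index i l) * v ord0 (mxvec_index j l))).
  move=> v _; apply: (@cvg_big _ _ _ _ xpredT _ _ (nbhs v) _ _ _ (nbhs_filter v)); first exact: add_continuous.
  by move=> l _; apply: (@cvgM _ _ (nbhs v) (nbhs_filter v)); exact: coord_continuous.
by apply/funext => w; rewrite mxE; apply: eq_bigr => l _; rewrite !mxE.
Qed.

Lemma orth_compact n : compact [set v : 'rV[R]_(n * n) | orth (vec_mx v)].
Proof.
apply: bounded_closed_compact; last exact: orth_closed.
apply: (@bounded_enorm R _ _ (Num.sqrt n%:R)) => v ov.
by rewrite -(fn_of_orth ov) /fn vec_mxK.
Qed.

Lemma net_exists n (e : R) : 0 < e -> exists S : seq 'M[R]_n, is_net e S.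
Proof.
move=> e0; have := @orth_compact n; rewrite compact_cover.
move=> /(_ 'rV[R]_(n * n) [set v | orth (vec_mx v)] (fun v => [set w | enorm (w - v) < e])).
have op (v : 'rV[R]_(n * n)) : [set w | orth (vec_mx w)] v -> open [set w | enorm (w - v) < e].
  move=> _; apply: (@open_comp _ _ (fun w : 'rV[R]_(n * n) => enorm (w - v)) [set x : R | x < e]); last exact: open_lt.
  move=> w _; apply: (@enorm_lip R _ _ _ 1) => x y; rewrite mul1r.
  by apply: (le_trans (enorm_dist _ _)); rewrite opprB addrA subrK.
move=> /(_ op) [].
  by move=> v ov; exists v => //=; rewrite subrr enorm0.
move=> D' hD' hc; exists [seq vec_mx v | v <- finmap.enum_fset D']; split.
  by move=> _ /mapP[v vD ->]; have := hD' v vD; rewrite inE.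
move=> g og; have [|v /= vD hv] := hc (mxvec g); first by rewrite /= mxvecK.
exists (vec_mx v); first by apply/mapP; exists v.
by rewrite /fn linearB /= vec_mxK ltW.
Qed.

Lemma min_net_exists n (e : R) : 0 < e -> exists S : seq 'M[R]_n, is_net e S /\ forall S' : seq 'M[R]_n, is_net e S' -> (size S <= size S')%N.
Proof.
move=> e0; pose P N := `[< exists S : seq 'M[R]_n, is_net e S /\ size S = N >].
have hP : exists N, P N.
  by have [S hS] := @net_exists n e e0; exists (size S); apply/asboolP; exists S.
case: (ex_minnP hP) => N /asboolP[S [hS <-]] hN; exists S; split => // S' hS'.
by apply: hN; apply/asboolP; exists S'.
Qed.

Definition avg n (S : seq 'M[R]_n) (phi : 'M[R]_n -> R) : R :=
  (\sum_(g <- S) phi g) / (size S)%:R.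

(* Among the points of S, replace those with phi > t by the points s h with
   phi (s h) + w > t: the result is still a net, so minimality compares the two
   counts. *)
Lemma min_net_count n (e : R) (S : seq 'M[R]_n) (phi : 'M[R]_n -> R) w h (t : R) : is_net e S ->
  (forall S' : seq 'M[R]_n, is_net e S' -> (size S <= size S')%N) -> orth h ->
  (forall g g', orth g -> orth g' -> fn (g - g') <= e + e -> phi g <= phi g' + w) ->
  (count (fun s => (t < phi s)%R) S <= count (fun s => (t < phi (s *m h) + w)%R) S)%N.
Proof.
move=> [oS nS] mS oh hphi.
pose A := fun s => t < phi s; pose B := fun s => t < phi (s *m h) + w.
pose S' := [seq s <- S | ~~ A s] ++ [seq s *m h | s <- S & B s].
have : is_net e S'.
  split.
    move=> s; rewrite mem_cat mem_filter => /orP[/andP[_ /oS]//|/mapP[s' ]].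
    by rewrite mem_filter => /andP[_ /oS os'] ->; exact: orthM.
  move=> g og; have [s sS hs] := nS g og.
  have [As|As] := boolP (A s); last by exists s => //; rewrite mem_cat mem_filter As sS.
  have [s' s'S hs'] := nS (g *m h^T) (orthM og (orthT oh)).
  have hs2 : fn (g - s' *m h) <= e.
    by rewrite -(fn_orth _ (orthT oh)) mulmxBl orthK.
  exists (s' *m h) => //; rewrite mem_cat; apply/orP; right; apply/mapP; exists s' => //.
  rewrite mem_filter s'S andbT /B; apply: (lt_le_trans As); apply: hphi; first exact: oS.
    by apply: orthM => //; exact: oS.
  have -> : s - s' *m h = (s - g) + (g - s' *m h) by rewrite addrA subrK.
  by apply: (le_trans (fnD _ _)); rewrite lerD// fnBC.
move=> /mS; rewrite size_cat size_map !size_filter => hS.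
have := count_predC A S; rewrite -/A -/B; move: hS; rewrite -[count (fun s => ~~ A s) S]/(count (predC A) S).
by move=> h1 h2; rewrite -(leq_add2r (count (predC A) S)) h2 addnC.
Qed.

(** Comparing counts at every threshold compares the sums, which gives one inequality. The other is
    the same inequality for the translate of [phi] by [h], translated back by [h^T]; right
    multiplication by [h] preserves [fn], so this translate has the same modulus of continuity. *)
Lemma avg_invar n (e : R) (S : seq 'M[R]_n) phi w h : is_net e S ->
  (forall S' : seq 'M[R]_n, is_net e S' -> (size S <= size S')%N) -> orth h ->
  (forall g g', orth g -> orth g' -> fn (g - g') <= e + e -> phi g <= phi g' + w) ->
  `|avg S (fun g => phi (g *m h)) - avg S phi| <= w.
Proof.
move=> nS mS oh hphi.
have main psi k : orth k -> (forall g g', orth g -> orth g' -> fn (g - g') <= e + e -> psi g <= psi g' + w) ->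
   avg S psi <= avg S (fun g => psi (g *m k)) + w.
  move=> ok hpsi.
  have : \sum_(g <- S) psi g <= \sum_(g <- S) (psi (g *m k) + w).
    have := @leq_sum_count [seq psi g | g <- S] [seq psi (g *m k) + w | g <- S].
    rewrite !big_map !size_map; apply => // t; rewrite !count_map.
    exact: (min_net_count t nS mS ok hpsi).
  have S0 : 0 < (size S)%:R :> R.
    by have [s] := nS.2 _ (@orth1 R n); rewrite ltr0n; case: (S).
  rewrite big_split /= big_const_seq count_predT iter_addr_0 -mulr_natl => h1.
  by rewrite /avg ler_pdivrMr// mulrDl mulfVK ?gt_eqF// [w * _]mulrC.
have h1 := main phi h oh hphi.
have h2 := main (fun g => phi (g *m h)) h^T (orthT oh).
rewrite ler_norml; apply/andP; split; first by lra.
rewrite lerBlDr [w + _]addrC.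
have -> : avg S phi = avg S (fun g => phi (g *m h^T *m h)).
  by congr (_ / _); apply: eq_bigr => g _; rewrite orthKV.
apply: h2 => g g' og og' gg'; apply: hphi; try exact: orthM.
by rewrite -mulmxBl fn_orth.
Qed.

Definition net n (N : nat) : seq 'M[R]_n := sval (cid (@min_net_exists n N.+1%:R^-1 (ltac:(by rewrite invr_gt0)))).
Lemma net_size n N : (0 < size (net n N))%N.
Proof.
rewrite /net; case: cid => S /= [[_ nS] _].
by have [s] := nS _ (@orth1 R n); case: (S).
Qed.
Lemma net_orth n N g : g \in net n N -> orth g.
Proof. by rewrite /net; case: cid => S /= [[oS _] _]; exact: oS. Qed.
Lemma net_invar n N phi w h : orth h ->
  (forall g g', orth g -> orth g' -> fn (g - g') <= 2%:R / N.+1%:R -> phi g <= phi g' + w) ->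
  `|avg (net n N) (fun g => phi (g *m h)) - avg (net n N) phi| <= w.
Proof.
rewrite /net; case: cid => S /= [nS mS] oh hphi; apply: (avg_invar nS mS oh) => g g' og og' hg.
by apply: hphi => //; rewrite mulr_natl mulr2n.
Qed.
End OrthogonalNets.

(** * An invariant mean for continuous functions on O(n) *)

Section Mean.
Context {R : realType}.

(* Successive nets are unrelated, so limits of averages are taken along a fixed
   free ultrafilter. *)
Definition UF : set_system nat := sval (cid (@ultraFilterLemma nat \oo _)).
Lemma UF_ultra : UltraFilter UF.
Proof. by rewrite /UF; case: cid => G /= []. Qed.
Lemma UF_oo : \oo `<=` UF.
Proof. by rewrite /UF; case: cid => G /= []. Qed.
#[local] Instance UF_proper : ProperFilter UF := @ultra_proper _ _ UF_ultra.

Definition ulim (u : nat -> R) : R := lim (u N @[N --> UF]).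
Definition bnd (u : nat -> R) : Prop := exists b, forall N, `|u N| <= b.

(** The image of an ultrafilter is an ultrafilter, and an ultrafilter on a compact interval
    converges. *)
Lemma ulimP u : bnd u -> u N @[N --> UF] --> ulim u.
Proof.
move=> [b hb]; have := @segment_compact R (- b) b; rewrite compact_ultra.
have FU : UltraFilter (u N @[N --> UF]).
  split; first exact: fmap_proper_filter.
  move=> G PG sG; apply/funext => A; apply/propext; split; last exact: sG.
  move=> GA; rewrite /fmap /=.
  have [//|nA] := in_ultra_setVsetC (u @^-1` A) UF_ultra.
  have : G (A `&` ~` A) by apply: filterI => //; apply: sG.
  by rewrite setICr => /filter_not_empty.
move=> /(_ _ FU) [].
  by apply: (@filterE _ UF) => N /=; rewrite in_itv /= -ler_norml.
by move=> l [_ hl]; rewrite /ulim (cvg_lim _ hl).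
Qed.
Lemma ulim_eq u l : u N @[N --> UF] --> l -> ulim u = l.
Proof. by move=> h; apply: cvg_lim. Qed.
Lemma UF_near (P : nat -> Prop) N0 : (forall N, (N0 <= N)%N -> P N) -> \forall N \near UF, P N.
Proof. by move=> h; apply: UF_oo; exists N0. Qed.
Lemma ulim_le u v N0 : bnd u -> bnd v -> (forall N, (N0 <= N)%N -> u N <= v N) -> ulim u <= ulim v.
Proof.
move=> bu bv h; apply: (@ler_cvg_to _ _ _ _ u v _ _ (ulimP bu) (ulimP bv)).
exact: UF_near h.
Qed.
Lemma ulimD u v : bnd u -> bnd v -> ulim (fun N => u N + v N) = ulim u + ulim v.
Proof. by move=> bu bv; apply: ulim_eq; apply: cvgD; exact: ulimP. Qed.
Lemma ulimZ c u : bnd u -> ulim (fun N => c * u N) = c * ulim u.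
Proof. by move=> bu; apply: ulim_eq; apply: cvgMr; exact: ulimP. Qed.
Lemma ulim_cst c : ulim (fun=> c) = c.
Proof. by apply: ulim_eq; exact: cvg_cst. Qed.
Lemma bndD u v : bnd u -> bnd v -> bnd (fun N => u N + v N).
Proof. by move=> [b hb] [c hc]; exists (b + c) => N; rewrite (le_trans (ler_normD _ _))// lerD. Qed.
Lemma bndZ c u : bnd u -> bnd (fun N => c * u N).
Proof. by move=> [b hb]; exists (`|c| * b) => N; rewrite normrM ler_wpM2l. Qed.
Lemma bnd_cst c : bnd (fun=> c). Proof. by exists `|c|. Qed.
Lemma bndM u v : bnd u -> bnd v -> bnd (fun N => u N * v N).
Proof. by move=> [b hb] [c hc]; exists (b * c) => N; rewrite normrM ler_pM. Qed.
Lemma bnd_sum (I : Type) (s : seq I) (u : I -> nat -> R) : (forall i, bnd (u i)) ->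
  bnd (fun N => \sum_(i <- s) u i N).
Proof.
move=> h; elim: s => [|i s IH].
  by exists 0 => N; rewrite big_nil normr0.
have [b hb] := bndD (h i) IH; exists b => N; rewrite big_cons; exact: hb.
Qed.
Lemma ulim_sum (I : Type) (s : seq I) (u : I -> nat -> R) : (forall i, bnd (u i)) ->
  ulim (fun N => \sum_(i <- s) u i N) = \sum_(i <- s) ulim (u i).
Proof.
move=> h; elim: s => [|i s IH].
  by rewrite big_nil -[RHS](ulim_cst 0); congr ulim; apply/funext => N; rewrite big_nil.
rewrite big_cons -IH -ulimD//; last exact: bnd_sum.
by congr ulim; apply/funext => N; rewrite big_cons.
Qed.

Lemma avg_le n (S : seq 'M[R]_n) phi psi : (forall g, g \in S -> phi g <= psi g) -> avg S phi <= avg S psi.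
Proof.
move=> h; rewrite /avg ler_wpM2r ?invr_ge0 ?ler0n//.
by rewrite big_seq [leRHS]big_seq; exact: ler_sum.
Qed.
Lemma avg_eq n (S : seq 'M[R]_n) phi psi : (forall g, g \in S -> phi g = psi g) -> avg S phi = avg S psi.
Proof. by move=> h; rewrite /avg big_seq [in RHS]big_seq; congr (_ / _); exact: eq_bigr. Qed.
Lemma avg_cst n (S : seq 'M[R]_n) c : (0 < size S)%N -> avg S (fun=> c) = c.
Proof.
move=> S0; rewrite /avg big_const_seq count_predT iter_addr_0 -[c *+ _]mulr_natr mulfK//.
by rewrite pnatr_eq0 -lt0n.
Qed.
Lemma avgD n (S : seq 'M[R]_n) phi psi : avg S (fun g => phi g + psi g) = avg S phi + avg S psi.
Proof. by rewrite /avg big_split mulrDl. Qed.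
Lemma avgZ n (S : seq 'M[R]_n) c phi : avg S (fun g => c * phi g) = c * avg S phi.
Proof. by rewrite /avg -mulr_sumr mulrA. Qed.
Lemma avg_sum n (S : seq 'M[R]_n) (I : Type) (s : seq I) phi :
  avg S (fun g => \sum_(i <- s) phi i g) = \sum_(i <- s) avg S (phi i).
Proof. by rewrite /avg exchange_big /= mulr_suml. Qed.

Definition obnd n (phi : 'M[R]_n -> R) : Prop := exists b, forall g, orth g -> `|phi g| <= b.
(** Uniform continuity on O(n): the one-sided bound gives the other side by exchanging [g] and
    [g']. *)
Definition ucont n (phi : 'M[R]_n -> R) : Prop := forall e, 0 < e -> exists2 d, 0 < d &
  forall g g', orth g -> orth g' -> fn (g - g') <= d -> phi g <= phi g' + e.

Lemma avg_bnd n (phi : 'M[R]_n -> R) : obnd phi -> bnd (fun N => avg (net n N) phi).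
Proof.
move=> [b hb]; exists b => N; rewrite ler_norml; apply/andP; split.
  rewrite -[X in X <= _](avg_cst (- b) (net_size n N)); apply: avg_le => g /net_orth og.
  by have := hb g og; rewrite ler_norml => /andP[].
rewrite -[X in _ <= X](avg_cst b (net_size n N)); apply: avg_le => g /net_orth og.
by have := hb g og; rewrite ler_norml => /andP[].
Qed.

(* Plays the part of the integral against the Haar probability of O(n). *)
Definition mean n (phi : 'M[R]_n -> R) : R := ulim (fun N => avg (net n N) phi).

Lemma mean_le n (phi psi : 'M[R]_n -> R) : obnd phi -> obnd psi -> (forall g, orth g -> phi g <= psi g) -> mean phi <= mean psi.
Proof.
move=> bphi bpsi h; apply: (@ulim_le _ _ 0); try exact: avg_bnd.
by move=> N _; apply: avg_le => g /net_orth; exact: h.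
Qed.
Lemma mean_eq n (phi psi : 'M[R]_n -> R) : (forall g, orth g -> phi g = psi g) -> mean phi = mean psi.
Proof. by move=> h; congr ulim; apply/funext => N; apply: avg_eq => g /net_orth; exact: h. Qed.
Lemma mean_cst n c : mean (fun _ : 'M[R]_n => c) = c.
Proof. by rewrite /mean -[RHS](ulim_cst c); congr ulim; apply/funext => N; rewrite avg_cst// net_size. Qed.
Lemma meanD n (phi psi : 'M[R]_n -> R) : obnd phi -> obnd psi -> mean (fun g => phi g + psi g) = mean phi + mean psi.
Proof.
move=> bphi bpsi; rewrite /mean -ulimD; try exact: avg_bnd.
by congr ulim; apply/funext => N; rewrite avgD.
Qed.
Lemma meanZ n c (phi : 'M[R]_n -> R) : obnd phi -> mean (fun g => c * phi g) = c * mean phi.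
Proof.
move=> bphi; rewrite /mean -ulimZ; last exact: avg_bnd.
by congr ulim; apply/funext => N; rewrite avgZ.
Qed.
Lemma net_ucont n (phi : 'M[R]_n -> R) e : ucont phi -> 0 < e -> exists N0, forall N h, (N0 <= N)%N -> orth h ->
  `|avg (net n N) (fun g => phi (g *m h)) - avg (net n N) phi| <= e.
Proof.
move=> uphi e0; have [d d0 hd] := uphi e e0.
exists (Num.truncn (2%:R / d)) => N h hN oh; apply: net_invar => // g g' og og' hg.
apply: hd => //; apply: (le_trans hg).
rewrite ler_pdivrMr// mulrC -ler_pdivrMr//; apply/ltW; apply: (lt_le_trans (truncnS_gt _)).
by rewrite ler_nat.
Qed.
Lemma obnd_mulr n (phi : 'M[R]_n -> R) h : orth h -> obnd phi -> obnd (fun g => phi (g *m h)).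
Proof. by move=> oh [b hb]; exists b => g og; apply: hb; exact: orthM. Qed.
Lemma mean_invar n (phi : 'M[R]_n -> R) h : obnd phi -> ucont phi -> orth h ->
  mean (fun g => phi (g *m h)) = mean phi.
Proof.
move=> bphi uphi oh; have bphih := obnd_mulr oh bphi.
have key e : 0 < e -> `|mean (fun g => phi (g *m h)) - mean phi| <= e.
  move=> e0; have [N0 hN] := net_ucont uphi e0.
  have b1 := avg_bnd bphi; have b2 := avg_bnd bphih.
  rewrite ler_norml; apply/andP; split.
    rewrite lerNl opprB lerBlDr; rewrite /mean -[X in X + _](ulim_cst e) -ulimD//; last exact: bnd_cst.
    apply: (@ulim_le _ _ N0) => //; first by apply: bndD => //; exact: bnd_cst.
    by move=> N /hN /(_ oh); rewrite ler_norml => /andP[h1 h2]; lra.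
  rewrite lerBlDr; rewrite /mean -[X in X + _](ulim_cst e) -ulimD//; last exact: bnd_cst.
  apply: (@ulim_le _ _ N0) => //; first by apply: bndD => //; exact: bnd_cst.
  by move=> N /hN /(_ oh); rewrite ler_norml => /andP[h1 h2]; lra.
apply/eqP; rewrite -subr_eq0 -normr_le0 leNgt; apply/negP => h0.
by have := key _ (divr_gt0 h0 (ltr0n R 2)); lra.
Qed.

(** A linear upper bound on [0, 1]. With q = 3^d the induction step adds s, s q and s^2 q, three
    terms each at most s q, which explains the 3. *)
Lemma bernoulli3 (s : R) d : 0 <= s -> s <= 1 -> (1 + s) ^+ d <= 1 + s * 3%:R ^+ d.
Proof.
move=> s0 s1; elim: d => [|d IH]; first by rewrite !expr0; lra.
rewrite exprS; apply: (@le_trans _ _ ((1 + s) * (1 + s * 3%:R ^+ d))).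
  by rewrite ler_wpM2l//; lra.
have : 1 <= 3%:R ^+ d :> R by rewrite exprn_ege1// ler1n.
rewrite exprS; set q := 3%:R ^+ d => q1.
have h1 : s * 1 <= s * q by rewrite ler_wpM2l.
have h2 : s * (s * q) <= 1 * (s * q) by rewrite ler_wpM2r// mulr_ge0// (le_trans ler01).
lra.
Qed.

(** The displacement [x *m (g - g')] has length at most [Rr * d] and is absorbed by the ball of
    radius [r] inside [X]: [x *m g] is 1 + s times the image under [g'] of a convex combination of
    [x] and a point of that ball. *)
Lemma img_close n (X : set 'rV[R]_n) r Rr (d : R) g g' : 0 < r -> cvx X -> (forall x, enorm x <= r -> X x) ->
  (forall x, X x -> enorm x <= Rr) -> 0 < Rr -> 0 < d -> orth g -> orth g' -> fn (g - g') <= d ->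
  img g X `<=` dilate (1 + Rr * d / r) (img g' X).
Proof.
move=> r0 cX hr hR R0 d0 og og' gg' _ [x Xx <-].
pose s := Rr * d / r; have s0 : 0 < s by rewrite divr_gt0// mulr_gt0.
have c0 : 0 < 1 + s by rewrite addr_gt0.
pose z := x *m (g - g') *m g'^T.
have hz : enorm z <= Rr * d.
  rewrite /z enorm_orth; last exact: orthT.
  by apply: (le_trans (fn_mul _ _)); rewrite ler_pM ?enorm_ge0 ?fn_ge0// hR.
pose y := s^-1 *: z.
have Xy : X y.
  apply: hr; rewrite enormZ ger0_norm ?invr_ge0 ?(ltW s0)// ler_pdivrMl//.
  by rewrite /s divfK ?gt_eqF.
pose t := (1 + s)^-1.
have Xw : X (t *: x + (1 - t) *: y).
  by apply: cX => //; rewrite /t ?invr_ge0 ?(ltW c0)// invf_le1// lerDl ltW.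
exists ((t *: x + (1 - t) *: y) *m g'); first by exists (t *: x + (1 - t) *: y).
rewrite scalemxAl scalerDr !scalerA mulfV ?gt_eqF// scale1r.
have -> : (1 + s) * (1 - t) / s = 1 by rewrite /t; field; rewrite !gt_eqF.
by rewrite scale1r mulmxDl /z orthKV// mulmxBr addrC subrK.
Qed.

(** Geometric quantities that are monotone and homogeneous of degree p in the rotated body are
    thereby continuous in the rotation, since nearby rotations of [X] differ by a dilation close to
    1. It serves for volumes of projections and for averages over sections. *)
Lemma scale_ucont n (X : set 'rV[R]_n) r Rr p (phi : 'M[R]_n -> R) : 0 < r -> cvx X ->
  (forall x, enorm x <= r -> X x) -> (forall x, X x -> enorm x <= Rr) -> 0 < Rr ->
  (forall g, orth g -> 0 <= phi g) ->
  (forall g g' c, orth g -> orth g' -> 1 <= c -> img g X `<=` dilate c (img g' X) -> phi g <= c ^+ p * phi g') ->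
  obnd phi /\ ucont phi.
Proof.
move=> r0 cX hr hR R0 phi0 hphi.
have hc d g g' : 0 < d -> orth g -> orth g' -> fn (g - g') <= d -> phi g <= (1 + Rr * d / r) ^+ p * phi g'.
  move=> d0 og og' gg'; apply: hphi => //; first by rewrite lerDl divr_ge0 ?mulr_ge0 ?ltW.
  exact: (img_close (r := r)).
have [b [b0 hb]] : exists b, 0 < b /\ forall g, orth g -> phi g <= b.
  (* Orthogonal matrices have Frobenius norm sqrt n, so every rotation is within [d] of the
     identity, and one comparison with the identity bounds [phi]. *)
  pose d : R := Num.sqrt n%:R + Num.sqrt n%:R + 1.
  have d0 : 0 < d by rewrite ltr_wpDl ?addr_ge0 ?sqrtr_ge0.
  exists ((1 + Rr * d / r) ^+ p * phi 1%:M + 1); split.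
    by rewrite ltr_wpDl// mulr_ge0 ?phi0 ?exprn_ge0 ?addr_ge0 ?divr_ge0 ?mulr_ge0 ?ltW//; exact: orth1.
  move=> g og; apply: ler_wpDr => //; apply: hc => //; first exact: orth1.
  apply: (le_trans (fnD _ _)).
  have -> : fn (- 1%:M : 'M[R]_n) = fn (1%:M : 'M[R]_n) by rewrite /fn linearN /= enormN.
  by rewrite !fn_of_orth//; [rewrite /d lerDl|exact: orth1].
split; first by exists b => g og; rewrite ger0_norm ?phi0 ?hb.
move=> e e0.
(* By [bernoulli3], (1 + s)^p - 1 is at most s 3^p, hence at most e / b. *)
pose s := Num.min 1 (e / (b * 3%:R ^+ p)).
have q0 : 0 < b * 3%:R ^+ p by rewrite mulr_gt0 ?exprn_gt0.
have s0 : 0 < s by rewrite lt_min ltr01 divr_gt0.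
exists (s * r / Rr); first by rewrite divr_gt0// mulr_gt0.
move=> g g' og og' gg'.
have := hc _ g g' _ og og' gg'.
have -> : Rr * (s * r / Rr) / r = s by field; rewrite !gt_eqF.
move=> /(_ (divr_gt0 (mulr_gt0 s0 r0) R0)) h; apply: (le_trans h).
have s1 : s <= 1 by rewrite ge_min lexx.
have h3 := bernoulli3 p (ltW s0) s1.
apply: (@le_trans _ _ ((1 + s * 3%:R ^+ p) * phi g')); first by rewrite ler_wpM2r ?phi0.
rewrite mulrDl mul1r lerD2l; apply: (@le_trans _ _ (s * 3%:R ^+ p * b)).
  by rewrite ler_wpM2l ?hb// mulr_ge0 ?exprn_ge0// ltW.
by rewrite -mulrA [_ * b]mulrC -ler_pdivlMr// ge_min lexx orbT.
Qed.
End Mean.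

(** * Zonotopes and the formulas of Steiner and Kubota *)

Section Zonotope.
Context {R : realType}.
Local Notation lam n := (@lebesgue_rV R n).

(* x *m lastmx n q consists of the last q coordinates of x. *)
Definition lastmx n q : 'M[R]_(n, q) := \matrix_(i < n, l < q) ((i : nat) == (n - q + l)%N)%:R.

Lemma lastmx_id n : lastmx n n = 1%:M.
Proof. by apply/matrixP => i j; rewrite !mxE subnn add0n. Qed.

Lemma lastmxM n p q : (q <= p)%N -> (p <= n)%N -> lastmx n p *m lastmx p q = lastmx n q.
Proof.
move=> qp pn; apply/matrixP => i l; rewrite !mxE.
have hl : (p - q + l < p)%N by have := ltn_ord l; lia.
rewrite (bigD1 (Ordinal hl))//= big1 => [|a /eqP ha].
  rewrite !mxE /= eqxx mulr1 addr0; congr (_%:R); congr (nat_of_bool (_ == _)); lia.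
rewrite !mxE; case: (_ =P _) => h1; case: (_ =P _) => h2; rewrite ?mulr0 ?mul0r//.
by case: ha; apply: val_inj.
Qed.

Lemma lastmx_colE p q : lastmx (p + q) q = col_mx (0 : 'M[R]_(p, q)) 1%:M.
Proof.
apply/matrixP => i j; case: (split_ordP i) => i' ->.
  rewrite col_mxEu !mxE /=; case: eqP => //; have := ltn_ord i'; lia.
by rewrite col_mxEd !mxE /= addnK eqn_add2l.
Qed.

Lemma row_lastmx p q (x : 'rV[R]_p) (y : 'rV[R]_q) : row_mx x y *m lastmx (p + q) q = y.
Proof. by rewrite lastmx_colE mul_row_col mulmx0 add0r mulmx1. Qed.

Lemma meas_slice2 p q (A : set 'rV[R]_(p + q)) (y : 'rV[R]_q) : measurable A ->
  measurable [set x : 'rV[R]_p | A (row_mx x y)].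
Proof.
move=> mA; have := measurable_ysection y (measurable_preim (@measurable_row_mx R p q) mA).
rewrite (_ : ysection _ y = [set x : 'rV[R]_p | A (row_mx x y)])//.
by apply/seteqP; split => x; rewrite /ysection /= inE.
Qed.

Lemma lam1E (S : set 'rV[R]_1) : measurable S -> lam 1 S = lebesgue_measure [set r : R | S r%:M].
Proof.
pose f : measurableTypeR R -> 'rV[R]_1 := fun r => r%:M.
have mf : measurable_fun setT f.
  apply: measurable_fun_rVP => i; apply: (eq_measurable_fun (fun r => r : measurableTypeR R)).
    by move=> r _; rewrite !mxE (ord1 i).
  exact: measurable_id.
apply: (@measure_rV_unique R 1 (lam 1) (pushforward lebesgue_measure f)) => //.
  move=> A mA; transitivity (\prod_(i < 1) lebesgue_measure (A i))%E; first exact: lebesgue_rV_box.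
  rewrite big_ord_recl big_ord0 mule1 /pushforward.
  congr (lebesgue_measure _); apply/seteqP; split => r /= h.
    by move=> i; rewrite (ord1 i) /f mxE.
  by have := h ord0; rewrite /f mxE.
by move=> k; exact: lam_cube_fin.
Qed.

Lemma lam1_slice n (B : set 'rV[R]_(1 + n)) y : measurable B ->
  lam 1 [set x | B (row_mx x y)] = lebesgue_measure [set r : R | B (row_mx r%:M y)].
Proof. by move=> mB; rewrite lam1E//; exact: meas_slice2. Qed.

Lemma lebesgue_cc (a b : R) : a <= b -> lebesgue_measure (`[a, b]%classic : set R) = (b - a)%:E.
Proof.
move=> ab; rewrite lebesgue_measure_itv /= lte_fin; case: ifP => [_|/negbT]; first by rewrite EFinB.
by rewrite -leNgt => ba; rewrite (le_anti (introT andP (conj ab ba))) subrr.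
Qed.

Lemma img_mul n p q (g : 'M[R]_(n, p)) (h : 'M[R]_(p, q)) X : img (g *m h) X = img h (img g X).
Proof.
apply/seteqP; split => [_ [x Xx <-]|_ [_ [x Xx <-] <-]].
  by exists (x *m g); [exists x|rewrite mulmxA].
by exists x => //; rewrite mulmxA.
Qed.
Lemma img1 n (X : set 'rV[R]_n) : img 1%:M X = X.
Proof.
apply/seteqP; split => [_ [x Xx <-]|x Xx]; first by rewrite mulmx1.
by exists x => //; rewrite mulmx1.
Qed.
Lemma img_sum n p (g : 'M[R]_(n, p)) X Y : img g (minkowski_sum X Y) = minkowski_sum (img g X) (img g Y).
Proof.
apply/seteqP; split => [_ [_ [x Xx [y Yy <-]] <-]|_ [_ [x Xx <-] [_ [y Yy <-] <-]]].
  by exists (x *m g); [exists x|exists (y *m g); [exists y|rewrite mulmxDl]].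
by exists (x + y); [exists x => //; exists y|rewrite mulmxDl].
Qed.
Lemma img_dilate n p (g : 'M[R]_(n, p)) c X : img g (dilate c X) = dilate c (img g X).
Proof.
apply/seteqP; split => [_ [_ [x Xx <-] <-]|_ [_ [x Xx <-] <-]].
  by exists (x *m g); [exists x|rewrite scalemxAl].
by exists (c *: x); [exists x|rewrite scalemxAl].
Qed.
Lemma img_sub n p (g : 'M[R]_(n, p)) X Y : X `<=` Y -> img g X `<=` img g Y.
Proof. by move=> XY _ [x Xx <-]; exists x => //; exact: XY. Qed.
Lemma dilate_sub n c (X Y : set 'rV[R]_n) : X `<=` Y -> dilate c X `<=` dilate c Y.
Proof. by move=> XY _ [x Xx <-]; exists x => //; exact: XY. Qed.
Lemma sum_sub n (X Y X' Y' : set 'rV[R]_n) : X `<=` X' -> Y `<=` Y' -> minkowski_sum X Y `<=` minkowski_sum X' Y'.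
Proof. by move=> h1 h2 _ [x Xx [y Yy <-]]; exists x; [exact: h1|exists y; [exact: h2|]]. Qed.
Lemma dilate_sum n c (X Y : set 'rV[R]_n) : dilate c (minkowski_sum X Y) = minkowski_sum (dilate c X) (dilate c Y).
Proof.
apply/seteqP; split => [_ [_ [x Xx [y Yy <-]] <-]|_ [_ [x Xx <-] [_ [y Yy <-] <-]]].
  by exists (c *: x); [exists x|exists (c *: y); [exists y|rewrite scalerDr]].
by exists (x + y); [exists x => //; exists y|rewrite scalerDr].
Qed.
Lemma sumA n (X Y Z : set 'rV[R]_n) : minkowski_sum X (minkowski_sum Y Z) = minkowski_sum (minkowski_sum X Y) Z.
Proof.
apply/seteqP; split => [_ [x Xx [_ [y Yy [z Zz <-]] <-]]|_ [_ [x Xx [y Yy <-]] [z Zz <-]]].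
  by exists (x + y); [exists x => //; exists y|exists z => //; rewrite addrA].
by exists x => //; exists (y + z); [exists y => //; exists z|rewrite addrA].
Qed.
Lemma sumC n (X Y : set 'rV[R]_n) : minkowski_sum X Y = minkowski_sum Y X.
Proof.
by apply/seteqP; split => [_ [x Xx [y Yy <-]]|_ [x Xx [y Yy <-]]]; exists y => //; exists x => //; rewrite addrC.
Qed.
Lemma sum0 n (X : set 'rV[R]_n) : minkowski_sum X [set 0] = X.
Proof.
apply/seteqP; split => [_ [x Xx [_ -> <-]]|x Xx]; first by rewrite addr0.
by exists x => //; exists 0 => //; rewrite addr0.
Qed.
Lemma dilate_dilate n c d (X : set 'rV[R]_n) : dilate c (dilate d X) = dilate (c * d) X.
Proof.
apply/seteqP; split => [_ [_ [x Xx <-] <-]|_ [x Xx <-]]; first by exists x => //; rewrite scalerA.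
by exists (d *: x); [exists x|rewrite scalerA].
Qed.
Definition seg n (u : 'rV[R]_n) : set 'rV[R]_n := [set c *: u | c in `[(-1 : R), 1]%classic].
Lemma segP n (u : 'rV[R]_n) c : -1 <= c -> c <= 1 -> seg u (c *: u).
Proof. by move=> h1 h2; exists c => //=; rewrite in_itv /= h1 h2. Qed.
Lemma compact_seg n (u : 'rV[R]_n) : compact (seg u).
Proof.
apply: continuous_compact; last exact: segment_compact.
by apply: continuous_subspaceT => c; exact: scalel_continuous.
Qed.
Lemma cvx_seg n (u : 'rV[R]_n) : cvx (seg u).
Proof.
move=> _ _ t t0 t1 [c + <-] [d + <-]; rewrite /= !in_itv /= => /andP[c0 c1] /andP[d0 d1].
by rewrite !scalerA -scalerDl; apply: segP; nra.
Qed.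
Lemma img_seg n p (g : 'M[R]_(n, p)) u : img g (seg u) = seg (u *m g).
Proof.
apply/seteqP; split => [_ [_ [c hc <-] <-]|_ [c hc <-]]; first by exists c => //; rewrite scalemxAl.
by exists (c *: u); [exists c|rewrite scalemxAl].
Qed.
Lemma dilate_seg n t (u : 'rV[R]_n) : dilate t (seg u) = seg (t *: u).
Proof.
apply/seteqP; split => [_ [_ [c hc <-] <-]|_ [c hc <-]]; first by exists c => //; rewrite !scalerA mulrC.
by exists (c *: u); [exists c|rewrite !scalerA mulrC].
Qed.

Lemma closed_rV1 n (y : 'rV[R]_n) : closed [set y].
Proof. by apply: compact_closed; [exact: norm_hausdorff|exact: compact_set1]. Qed.
Lemma e0_row n : e0 n = row_mx (1%:M : 'M[R]_1) 0 :> 'rV[R]_(1 + n).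
Proof.
apply/rowP => i; case: (@split_ordP 1 n i) => j ->; [rewrite row_mxEl|rewrite row_mxEr]; rewrite !mxE//.
by rewrite (ord1 j).
Qed.

Lemma row_e0 n (r s : R) (y : 'rV[R]_n) : row_mx r%:M y + s *: e0 n = row_mx (r + s)%:M y :> 'rV[R]_(1 + n).
Proof.
apply/rowP => i; rewrite mxE [in X in _ + X]mxE (e0_row n); case: (@split_ordP 1 n i) => j ->.
  rewrite [row_mx r%:M y _ _]row_mxEl [row_mx (r + s)%:M y _ _]row_mxEl.
  rewrite [row_mx 1%:M 0 _ _](@row_mxEl R 1 1 n) (ord1 j) !mxE !eqxx.
  by rewrite mulr1.
rewrite [row_mx r%:M y _ _]row_mxEr [row_mx (r + s)%:M y _ _]row_mxEr.
by rewrite [row_mx 1%:M 0 _ _](@row_mxEr R 1 1 n) mxE mulr0 addr0.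
Qed.

(** Every nonempty fibre of [X] along the first axis is a compact interval, and adding the segment
    lengthens it by 2 t; empty fibres stay empty. Fubini then produces the volume of the
    projection. *)
Lemma vol_seg0 n (X : set 'rV[R]_(1 + n)) t : compact X -> cvx X -> 0 <= t ->
  vol (minkowski_sum X (seg (t *: e0 n))) = vol X + 2%:R * t * vol (img (lastmx (1 + n) n) X).
Proof.
move=> cX vX t0.
set A := minkowski_sum _ _; set L := lastmx _ _.
have cA : compact A by apply: compact_sum => //; exact: compact_seg.
have cP : compact (img L X) by exact: compact_img.
have mX := compact_measurable_rV cX; have mA := compact_measurable_rV cA; have mP := compact_measurable_rV cP.
have key (y : 'rV[R]_n) : (lam 1 [set x | A (row_mx x y)] = lam 1 [set x | X (row_mx x y)] + (2%:R * t)%:E * (\1_(img L X) y)%:E)%E.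
  rewrite !lam1_slice//.
  have [Py|Py] := pselect (img L X y); last first.
    rewrite indicE memNset// mule0 adde0.
    congr (lebesgue_measure _); apply/seteqP; split => r /= h; exfalso; apply: Py; last first.
      by exists (row_mx r%:M y) => //; rewrite row_lastmx.
    case: h => x Xx [_ [c _ <-] h]; exists x => //.
    rewrite /L -[RHS](row_lastmx r%:M y) -h mulmxDl -!scalemxAl.
    suff -> : e0 n *m lastmx (1 + n) n = 0 by rewrite !scaler0 addr0.
    have -> : e0 n = row_mx (1%:M : 'M[R]_1) 0 :> 'rV[R]_(1 + n) by exact: e0_row.
    exact: (@row_lastmx 1 n 1%:M 0).
  rewrite indicE mem_set// mule1.
  (* The fibre over [y], kept in the full space: its compactness makes the first coordinate attain a
     least value [a] and a largest value [b]. *)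
  pose F := X `&` ((fun v : 'rV[R]_(1 + n) => v *m L) @^-1` [set y]).
  have cF : compact F.
    apply: compact_closedI => //; apply: preimage_closed; last exact: closed_rV1.
    by move=> v _; exact: mulmx_continuous.
  have F0 : F !=set0 by case: Py => x Xx xy; exists x.
  have cc : {within F, continuous (fun v : 'rV[R]_(1 + n) => v ord0 ord0 : R)}.
    by apply: continuous_subspaceT; exact: coord_continuous.
  have rowE (v : 'rV[R]_(1 + n)) : v *m L = y -> v = row_mx (v ord0 ord0)%:M y.
    move=> vy; rewrite -[LHS]hsubmxK; move: vy; rewrite -{1}[v]hsubmxK row_lastmx => ->.
    by congr row_mx; apply/rowP => i; rewrite !mxE (ord1 i) /=; congr (v _ _); exact: val_inj.
  have [vb + hb] := EVT_max_rV F0 cF cc; rewrite inE => -[Xb /= /rowE eb].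
  have [va + ha] := EVT_min_rV F0 cF cc; rewrite inE => -[Xa /= /rowE ea].
  set b := vb ord0 ord0 in eb hb; set a := va ord0 ord0 in ea ha.
  have row0 (r : R) : (row_mx r%:M y : 'rV[R]_(1 + n)) ord0 ord0 = r.
    rewrite (_ : ord0 = lshift n (ord0 : 'I_1)); last exact: val_inj.
    by rewrite row_mxEl mxE.
  have XI r : X (row_mx r%:M y) -> a <= r <= b.
    move=> Xr; have Fr : row_mx r%:M y \in F by rewrite inE; split => //=; rewrite row_lastmx.
    by have := ha _ Fr; have := hb _ Fr; rewrite row0 => -> ->.
  have ab : a <= b by have := XI b; rewrite -eb => /(_ Xb)/andP[].
  have IX r : a <= r <= b -> X (row_mx r%:M y).
    move=> /andP[ar rb]; have [e|ne] := eqVneq a b.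
      have -> : r = b by apply: le_anti; rewrite rb -e ar.
      by rewrite -eb.
    have d0 : 0 < b - a by rewrite subr_gt0 lt_neqAle ne.
    have := vX va vb ((b - r) / (b - a)); rewrite divr_ge0 ?subr_ge0// => /(_ isT).
    rewrite ler_pdivrMr// mul1r lerD2l lerN2 => /(_ ar Xa Xb).
    rewrite ea eb !scale_row_mx add_row_mx; congr (X (row_mx _ _)).
      apply/rowP => i; rewrite !mxE (ord1 i) eqxx !mulr1n; field; by rewrite gt_eqF.
    by rewrite -scalerDl addrC subrK scale1r.
  have -> : [set r : R | X (row_mx r%:M y)] = `[a, b]%classic.
    by apply/seteqP; split => r /=; rewrite in_itv /=; [exact: XI|exact: IX].
  have -> : [set r : R | A (row_mx r%:M y)] = `[a - t, b + t]%classic.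
    apply/seteqP; split => r /=; rewrite in_itv /=.
      move=> [x Xx [_ [c /= hc <-] h]]; move: hc; rewrite in_itv /= => /andP[c1 c2].
      have xE : x = row_mx (r - c * t)%:M y.
        rewrite (_ : x = row_mx r%:M y - c *: (t *: e0 n)); last by rewrite -h addrK.
        by rewrite -scaleNr scalerA row_e0 mulNr.
      have := Xx; rewrite xE => /XI; have : `|c * t| <= t.
        by rewrite normrM (ger0_norm t0) ler_piMl// ler_norml c1 c2.
      rewrite ler_norml; lra.
    move=> /andP[h1 h2].
    (* [s] is the point of [a, b] nearest to [r]. *)
    have [s [/andP[as_ sb] hs]] : exists s, a <= s <= b /\ `|r - s| <= t.
      have [ra|ar] := leP r a; first by exists a; rewrite lexx ab ler_norml; split => //; apply/andP; split; lra.
      have [br|rb] := leP b r; first by exists b; rewrite lexx ab ler_norml; split => //; apply/andP; split; lra.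
      by exists r; rewrite (ltW ar) (ltW rb) subrr normr0.
    have [c [c1 c2 hc]] : exists c, [/\ -1 <= c, c <= 1 & c * t = r - s].
      have [t00|tn] := eqVneq t 0.
        exists 0; split; rewrite ?mul0r; try lra.
        by move: hs; rewrite t00 normr_le0 => /eqP ->.
      have tp : 0 < t by rewrite lt_neqAle eq_sym tn.
      move: hs; rewrite ler_norml => /andP[h3 h4].
      exists ((r - s) / t); rewrite mulfVK//; split => //.
        by rewrite ler_pdivlMr// mulN1r.
      by rewrite ler_pdivrMr// mul1r.
    exists (row_mx s%:M y); first by apply: IX; rewrite as_ sb.
    exists (c *: (t *: e0 n)); first exact: segP.
    by rewrite scalerA row_e0 hc addrC subrK.
  rewrite !lebesgue_cc//; last by lra.
  by rewrite -EFinD; congr (_ %:E); ring.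
suff : ((vol A)%:E = (vol X + 2%:R * t * vol (img L X))%:E)%E by case.
rewrite EFinD EFinM -!lam_vol//.
rewrite (lam_fubini2 (p := 1) (q := n) mA) (lam_fubini2 (p := 1) (q := n) mX).
rewrite -[lam n (img L X)](_ : (\int[lam n]_y (\1_(img L X) y)%:E)%E = _); last by rewrite integral_indic// setIT.
rewrite -ge0_integralZl//; last 2 first.
- by apply/measurable_EFinP; exact: measurable_indic.
- by rewrite lee_fin mulr_ge0.
rewrite -ge0_integralD//.
- by apply: eq_integral => y _; exact: key.
- exact: measurable_slice2.
- by move=> y _; rewrite -EFinM lee_fin !mulr_ge0.
- by apply: measurable_funeM; apply/measurable_EFinP; exact: measurable_indic.
Qed.
End Zonotope.

(** * Volumes of sums with zonotopes, and zonotopes close to the ball *)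

Section ZonotopeApproximation.
Context {R : realType}.
Local Notation lam n := (@lebesgue_rV R n).

Lemma dilate_set0 n t : dilate t [set (0 : 'rV[R]_n)] = [set 0].
Proof.
apply/seteqP; split => [_ [_ -> <-]|_ ->]; first by rewrite scaler0.
by exists 0 => //; rewrite scaler0.
Qed.
Lemma lastmx_blockE n (h : 'M[R]_n) : (block_mx (1%:M : 'M[R]_1) 0 0 h : 'M[R]_n.+1) *m @lastmx R (1 + n) n = @lastmx R (1 + n) n *m h.
Proof.
rewrite (@lastmx_colE R 1); transitivity (col_mx (0 : 'M[R]_(1, n)) h).
  transitivity (block_mx (1%:M : 'M[R]_1) 0 0 h *m col_mx (0 : 'M[R]_(1, n)) 1%:M); first by [].
  by rewrite mul_block_col !mulmx0 mul0mx mulmx1 !add0r.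
by rewrite mul_col_mx mul0mx mul1mx.
Qed.

(** The rotation depends on [u] alone and is fixed before [X] and [t]; this makes the coefficients
    in [zon_vol] the same for all bodies. *)
Lemma vol_seg n (u : 'rV[R]_n.+1) : exists2 g, orth g &
  forall X : set 'rV[R]_(1 + n), compact X -> cvx X -> forall t, 0 <= t ->
  vol (minkowski_sum X (dilate t (seg u))) = vol X + 2%:R * t * enorm u * vol (img (g *m @lastmx R (1 + n) n) X).
Proof.
have [g og ug] := householder u; exists g => // X cX vX t t0.
have cS : compact (minkowski_sum X (dilate t (seg u))).
  by apply: compact_sum => //; apply: compact_dilate; exact: compact_seg.
rewrite -(vol_img og (compact_measurable_rV cS)) img_sum img_dilate img_seg ug dilate_seg scalerA.
rewrite (@vol_seg0 R n (img g X)); last 3 first.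
- exact: compact_img.
- exact: cvx_img.
- by rewrite mulr_ge0 ?enorm_ge0.
by rewrite (vol_img og (compact_measurable_rV cX)) img_mul mulrA.
Qed.

Fixpoint zon n (U : seq 'rV[R]_n) : set 'rV[R]_n :=
  if U is u :: U' then minkowski_sum (seg u) (zon U') else [set 0].

Lemma compact_zon n (U : seq 'rV[R]_n) : compact (zon U).
Proof. by elim: U => [|u U IH] /=; [exact: compact_set1|apply: compact_sum => //; exact: compact_seg]. Qed.
Lemma cvx_zon n (U : seq 'rV[R]_n) : cvx (zon U).
Proof.
elim: U => [|u U IH] /=; last by apply: cvx_sum => //; exact: cvx_seg.
by move=> _ _ t _ _ -> ->; rewrite !scaler0 addr0.
Qed.
Lemma img_zon n p (g : 'M[R]_(n, p)) U : img g (zon U) = zon [seq u *m g | u <- U].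
Proof.
elim: U => [|u U IH] /=; last by rewrite img_sum img_seg IH.
apply/seteqP; split => [_ [_ -> <-]|_ ->]; first by rewrite mul0mx.
by exists 0 => //; rewrite mul0mx.
Qed.
(** The sum is the support function of the zonotope; [zon_attain] reaches it by giving each
    generator the sign of its product with [v]. *)
Lemma zon_le n (U : seq 'rV[R]_n) v z : zon U z -> dot z v <= \sum_(u <- U) `|dot u v|.
Proof.
elim: U z => [|u U IH] z /=; first by move=> ->; rewrite big_nil dot0l.
move=> [_ [c /= + <-] [y Zy <-]]; rewrite in_itv /= => /andP[c1 c2].
rewrite big_cons dotDl dotZl lerD//; last exact: IH.
apply: (le_trans (ler_norm _)); rewrite normrM ler_piMl// ler_norml c1 c2 //.
Qed.
Lemma zon_attain n (U : seq 'rV[R]_n) v : exists2 z, zon U z & dot z v = \sum_(u <- U) `|dot u v|.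
Proof.
elim: U => [|u U [z Zz hz]] /=; first by exists 0; rewrite // big_nil dot0l.
have [d0|d0] := leP 0 (dot u v).
  exists (1 *: u + z); first by exists (1 *: u); [apply: segP; lra|exists z].
  by rewrite big_cons dotDl scale1r hz ger0_norm.
exists (-1 *: u + z); first by exists (-1 *: u); [apply: segP; lra|exists z].
by rewrite big_cons dotDl scaleN1r dotNl hz ltr0_norm.
Qed.

(* Each entry (c, i, g) of T stands for a term c t^i |pr_{n-i} (X g)|; adding one
   segment u rotates u to the first axis and splits every term into two. *)
Lemma zon_vol n (U : seq 'rV[R]_n) : exists2 T : seq (R * nat * 'M[R]_n),
  (forall c, c \in T -> [/\ 0 <= c.1.1, (c.1.2 <= n)%N & orth c.2]) &
  forall X, compact X -> cvx X -> forall t, 0 <= t ->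
  vol (minkowski_sum X (dilate t (zon U))) =
  \sum_(c <- T) c.1.1 * t ^+ c.1.2 * vol (img (c.2 *m @lastmx R n (n - c.1.2)) X).
Proof.
have base m (V : seq 'rV[R]_m) : (forall X : set 'rV[R]_m, forall t, minkowski_sum X (dilate t (zon V)) = X) ->
  exists2 T : seq (R * nat * 'M[R]_m),
  (forall c, c \in T -> [/\ 0 <= c.1.1, (c.1.2 <= m)%N & orth c.2]) &
  forall X, compact X -> cvx X -> forall t, 0 <= t ->
  vol (minkowski_sum X (dilate t (zon V))) =
  \sum_(c <- T) c.1.1 * t ^+ c.1.2 * vol (img (c.2 *m @lastmx R m (m - c.1.2)) X).
  move=> h; exists [:: (1, 0%N, 1%:M)].
    by move=> c; rewrite inE => /eqP ->; split; [exact: ler01|done|exact: orth1].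
  move=> X cX vX t t0; rewrite h big_cons big_nil addr0 /= subn0 expr0 !mul1r mul1mx lastmx_id.
  by rewrite img1.
move: {2}(size U) (erefl (size U)) => s; elim: s n U => [|s IH] n U.
  move=> /size0nil ->; apply: base => X t /=.
  by rewrite dilate_set0 sum0.
case: U => // u U [sU]; case: n u U sU => [|n] u U sU.
  (* In dimension 0 the zonotope is the single point 0, and [zon_attain] is used only for its being
     nonempty. *)
  apply: base => X t; have [z Zz _] := zon_attain (u :: U) 0.
  apply/seteqP; split => [_ [x Xx [y _ <-]]|x Xx]; first by rewrite (thinmx0 y) addr0.
  by exists x => //; exists (t *: z); [exists z|rewrite (thinmx0 (t *: z)) addr0].
have [g og hg] := vol_seg u.
pose L := @lastmx R (1 + n) n.
have [T1 hT1 vT1] := IH n.+1 U sU.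
have [T2 hT2 vT2] := IH n [seq v *m (g *m L) | v <- U] (etrans (size_map _ _) sU).
pose B (h : 'M[R]_n) : 'M[R]_n.+1 := block_mx (1%:M : 'M[R]_1) 0 0 h.
(* The terms of [T2] come from the projection along [u]: they gain a factor 2 t |u|, and their
   rotations are extended by fixing the first axis. *)
exists (T1 ++ [seq (2%:R * enorm u * c.1.1, c.1.2.+1, g *m B c.2) | c <- T2]).
  move=> c; rewrite mem_cat => /orP[/hT1//|/mapP[c' /hT2[c0 c1 c2] ->]] /=; split => //.
    by rewrite !mulr_ge0 ?enorm_ge0.
  by apply: orthM => //; exact: (@orth_block R n c'.2 1).
move=> X cX vX t t0.
have cZ : compact (minkowski_sum X (dilate t (zon U))).
  by apply: compact_sum => //; apply: compact_dilate; exact: compact_zon.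
have vZ : cvx (minkowski_sum X (dilate t (zon U))).
  by apply: cvx_sum => //; apply: cvx_dilate; exact: cvx_zon.
rewrite /= dilate_sum [minkowski_sum (dilate t (seg u)) _]sumC sumA hg// vT1// big_cat /=; congr (_ + _).
rewrite img_sum img_dilate img_zon vT2//; last 2 first.
- exact: compact_img.
- exact: cvx_img.
rewrite big_map mulr_sumr /=; apply: eq_big_seq => c /hT2 [_ c1 _] /=.
have -> : vol (img (g *m B c.2 *m @lastmx R n.+1 (n.+1 - c.1.2.+1)) X) =
          vol (img (c.2 *m @lastmx R n (n - c.1.2)) (img (g *m L) X)).
  rewrite -img_mul; congr (vol (img _ X)); rewrite -!mulmxA; congr (_ *m _).
  rewrite mulmxA /L -lastmx_blockE -mulmxA; congr (_ *m _).
  by rewrite lastmxM// leq_subr.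
by rewrite exprS; ring.
Qed.

Lemma orth_row n (g : 'M[R]_n) i : orth g -> enorm (row i g) = 1.
Proof.
move=> og; apply/eqP; rewrite -(@eqrXn2 _ 2)// ?enorm_ge0// -dotxx expr1n.
have h : (g *m g^T) i i = 1 by rewrite og mxE eqxx.
by apply/eqP; rewrite -h mxE; apply: eq_bigr => j _; rewrite !mxE.
Qed.
Lemma orth_coor n (g : 'M[R]_n) i j : orth g -> `|g i j| <= 1.
Proof. by move=> /(orth_row i) <-; have := enorm_coor (row i g) j; rewrite mxE. Qed.

(** A lower bound by which the zonotopes of [zon_ball] can be normalized. The squares in the first
    row of a rotation sum to 1, and asymptotic invariance makes their averages nearly equal, so the
    average of [g 0 0 ^+ 2] is at least 1/(n+1) minus an error [c] equal to half of it. Entries are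
    at most 1 in absolute value, so squares may be replaced by absolute values. *)
Lemma net_half n : exists2 c : R, 0 < c & exists N0, forall N, (N0 <= N)%N -> c <= avg (net n.+1 N) (fun g => `|g 0 0|).
Proof.
pose phi (g : 'M[R]_n.+1) := g 0 0 ^+ 2.
have uphi : ucont phi.
  move=> e e0; exists (e / 2%:R); first by rewrite divr_gt0.
  move=> g g' og og' hg; have h1 := le_trans (fn_coor (g - g') 0 0) hg.
  have h2 := orth_coor 0 0 og; have h3 := orth_coor 0 0 og'.
  move: h1 h2 h3; rewrite !mxE /phi !ler_norml => /andP[h1 h1'] /andP[h2 h2'] /andP[h3 h3'].
  nra.
pose c : R := (2%:R * n.+1%:R)^-1.
have n0 : 0 < n.+1%:R :> R by rewrite ltr0n.
have c0 : 0 < c by rewrite invr_gt0 mulr_gt0.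
exists c => //; have [N0 hN] := net_ucont uphi c0; exists N0 => N /hN {}hN.
set S := @net R n.+1 N.
have S0 : (0 < size S)%N by exact: net_size.
have h1 : avg S (fun g => \sum_i g 0 i ^+ 2) = 1.
  rewrite -(avg_cst 1 S0); apply: avg_eq => g /net_orth og.
  by have := dotxx (row 0 g); rewrite orth_row// expr1n => <-; apply: eq_bigr => i _; rewrite mxE expr2.
have h2 i : avg S (fun g => g 0 i ^+ 2) <= avg S phi + c.
  have [h oh hh] := unit_dir (delta_mx 0 i : 'rV[R]_n.+1).
  have := hN h oh; rewrite -/S ler_norml => /andP[_]; rewrite lerBlDr addrC; apply: le_trans.
  rewrite le_eqVlt; apply/orP; left; apply/eqP; apply: avg_eq => g _; rewrite /phi; congr (_ ^+ 2).
  have e1 : enorm (delta_mx 0 i : 'rV[R]_n.+1) = 1.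
    rewrite /enorm (bigD1 i)//= big1 => [|j ji]; first by rewrite mxE !eqxx expr1n addr0 sqrtr1.
    by rewrite mxE (negbTE ji) andbF expr0n.
  have := hh (row 0 g); rewrite e1 mul1r -row_mul [in RHS]mxE => <-.
  rewrite /dot (bigD1 i)//= big1 => [|j ji]; first by rewrite !mxE !eqxx mulr1 addr0.
  by rewrite [delta_mx _ _ _ _]mxE (negbTE ji) andbF mulr0.
have h3 : 1 <= n.+1%:R * (avg S phi + c).
  apply: (@le_trans _ _ (avg S (fun g => \sum_i g 0 i ^+ 2))); first by rewrite h1.
  rewrite avg_sum; apply: (le_trans (ler_sum _ (fun i _ => h2 i))).
  by rewrite sumr_const card_ord mulr_natl.
apply: (@le_trans _ _ (avg S phi)).
  have : n.+1%:R * (c + c) = 1 by rewrite /c; field; rewrite gt_eqF.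
  move=> h4; rewrite -(ler_pM2l n0); move: h3 h4; rewrite !mulrDr; lra.
apply: avg_le => g /net_orth og; rewrite /phi -real_normK ?num_real// expr2.
by rewrite ler_piMl// orth_coor.
Qed.

(** The generators are the first rows of a fine net. Up to a factor, the support function at [v] is
    |v| times the average of [|(g *m h) 0 0|] for a rotation [h] depending on [v], which asymptotic
    invariance makes nearly independent of [v]. Bounds on the support function become inclusions by
    separation. *)
Lemma zon_ball n (d : R) : 0 < d -> d < 1 -> exists U : seq 'rV[R]_n.+1,
  dilate (1 - d) (ball2 n.+1) `<=` zon U /\ zon U `<=` dilate (1 + d) (ball2 n.+1).
Proof.
move=> d0 d1; have [c c0 [N0 hN0]] := net_half n.
pose phi (g : 'M[R]_n.+1) : R := `|g 0 0|.
have uphi : ucont phi.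
  move=> e e0; exists e => // g g' og og' hg; have := le_trans (fn_coor (g - g') 0 0) hg.
  by rewrite !mxE /phi => h; rewrite -lerBlDl; apply: le_trans (lerB_dist _ _) h.
have [N1 hN1] := net_ucont uphi (mulr_gt0 d0 c0).
pose N := maxn N0 N1; pose S := @net R n.+1 N.
have {hN0} hc : c <= avg S phi by apply: hN0; exact: leq_maxl.
have {hN1} hd h : orth h -> `|avg S (fun g => phi (g *m h)) - avg S phi| <= d * c.
  by move=> oh; apply: hN1 => //; exact: leq_maxr.
set cN := avg S phi in hc hd; have cN0 : 0 < cN by exact: lt_le_trans hc.
(* Normalizes the support function to |v| up to the factors 1 - d and 1 + d. *)
pose k := ((size S)%:R * cN)^-1.
have S0 : 0 < (size S)%:R :> R by rewrite ltr0n net_size.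
have k0 : 0 < k by rewrite invr_gt0 mulr_gt0.
pose U := [seq k *: row 0 g | g <- S].
have hU v : (1 - d) * enorm v <= \sum_(u <- U) `|dot u v| <= (1 + d) * enorm v.
  have [h oh hh] := unit_dir v.
  have -> : \sum_(u <- U) `|dot u v| = enorm v * (avg S (fun g => phi (g *m h)) / cN).
    rewrite big_map /avg !mulr_suml mulr_sumr; apply: eq_bigr => g _.
    rewrite dotZl hh -row_mul [in LHS]mxE /phi !normrM (ger0_norm (ltW k0)) (ger0_norm (enorm_ge0 v)) /k.
    by field; rewrite !gt_eqF.
  have := hd h oh; rewrite ler_norml => /andP[h1 h2].
  have h3 : d * c <= d * cN by rewrite ler_wpM2l// ltW.
  rewrite ![_ * enorm v]mulrC; apply/andP; split; apply: ler_wpM2l; rewrite ?enorm_ge0//.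
    rewrite ler_pdivlMr//; lra.
  rewrite ler_pdivrMr//; lra.
exists U; split.
  move=> y; rewrite ball_enormE ?subr_gt0// => /= hy; apply: contrapT => nZ.
  have [v [e e0 he]] := compact_separation (@compact_zon _ U) (@cvx_zon _ U) nZ.
  have [z Zz hz] := zon_attain U (- v).
  have := he z Zz; rewrite dotBl.
  have : dot z v = - \sum_(u <- U) `|dot u (- v)| by rewrite -hz dotNr opprK.
  have /andP[h1 _] := hU (- v); rewrite enormN in h1.
  have := cauchy_schwarz (- y) v; rewrite enormN dotNl => h2 h3 h4.
  have : enorm y * enorm v <= (1 - d) * enorm v by rewrite ler_wpM2r ?enorm_ge0.
  lra.
move=> z Zz; rewrite ball_enormE ?addr_gt0//=.
have := zon_le z Zz; have /andP[_ h] := hU z; rewrite dotxx => h2.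
have := le_trans h2 h; rewrite expr2.
have [->|z0] := eqVneq (enorm z) 0; first by rewrite addr_ge0// ltW.
by rewrite ler_pM2r// lt_neqAle eq_sym z0 enorm_ge0.
Qed.
End ZonotopeApproximation.
#[local] Existing Instance UF_proper.

(** * Steiner's formula with Kubota's coefficients *)

Section Steiner.
Context {R : realType}.
Local Notation lam n := (@lebesgue_rV R n).
Local Notation B n := (@ball2 R n).

(** The inner ball is centred at the origin, so that dilations about the origin compare nearby
    rotations of the body. *)
Definition body n (X : set 'rV[R]_n) : Prop :=
  [/\ compact X, cvx X & exists2 r, 0 < r & forall x, enorm x <= r -> X x].

Definition proj_vol n q (X : set 'rV[R]_n) (g : 'M[R]_n) : R := vol (img (g *m lastmx n q) X).
(* The average volume of the q-dimensional projections of X. *)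
Definition kub n q (X : set 'rV[R]_n) : R := mean (proj_vol q X).

Lemma body_img n (g : 'M[R]_n) X : orth g -> body X -> body (img g X).
Proof.
move=> og [cX vX [r r0 hr]]; split; [exact: compact_img|exact: cvx_img|].
exists r => // x hx; exists (x *m g^T); last by rewrite orthKV.
by apply: hr; rewrite enorm_orth//; exact: orthT.
Qed.

Lemma body_ball n : body (B n).
Proof. by split; [exact: compact_ball2|exact: cvx_ball2|exists 1]. Qed.

Lemma body_scale_ucont n (X : set 'rV[R]_n) p (phi : 'M[R]_n -> R) : body X ->
  (forall g, orth g -> 0 <= phi g) ->
  (forall g g' c, orth g -> orth g' -> 1 <= c -> img g X `<=` dilate c (img g' X) -> phi g <= c ^+ p * phi g') ->
  obnd phi /\ ucont phi.
Proof.
move=> [cX vX [r r0 hr]]; have [r' r'0 hr'] := compact_enorm cX.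
exact: scale_ucont r0 vX hr hr' r'0.
Qed.

Lemma proj_vol_ok n q (X : set 'rV[R]_n) : body X -> obnd (proj_vol q X) /\ ucont (proj_vol q X).
Proof.
move=> bX; have [cX _ _] := bX; apply: (body_scale_ucont (p := q) bX) => [g og|g g' c og og' c1 h].
  exact: vol_ge0.
have c0 : 0 < c by exact: lt_le_trans ltr01 c1.
rewrite /proj_vol !img_mul -vol_dilate//; last by do 2!apply: compact_img.
apply: vol_le; [by do 2!apply: compact_img|by apply: compact_dilate; do 2!apply: compact_img|].
by rewrite -img_dilate; exact: img_sub.
Qed.

(** The rotations attached to the terms of [zon_vol] disappear under averaging, by invariance of
    [mean]. *)
Lemma kub_img n q (X : set 'rV[R]_n) h : body X -> orth h ->
  mean (fun g => vol (img (h *m lastmx n q) (img g X))) = kub q X.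
Proof.
move=> bX oh; have [b u] := proj_vol_ok q bX; rewrite /kub -(mean_invar b u oh).
by apply: mean_eq => g og; rewrite /proj_vol -img_mul mulmxA.
Qed.

Lemma img_ball n (g : 'M[R]_n) : orth g -> img g (B n) = B n.
Proof.
move=> og; rewrite img_orthE//; apply/seteqP; split => x /=; rewrite !ball2E enorm_orth//; exact: orthT.
Qed.

Lemma enorm_row_mx p q (x : 'rV[R]_p) (y : 'rV[R]_q) : enorm (row_mx x y) ^+ 2 = enorm x ^+ 2 + enorm y ^+ 2.
Proof.
rewrite -!dotxx /dot big_split_ord /=; congr (_ + _); apply: eq_bigr => i _; first by rewrite !row_mxEl.
by rewrite !row_mxEr.
Qed.

Lemma img_last_ball n q : (q <= n)%N -> img (lastmx n q) (B n) = B q.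
Proof.
move=> qn; have : n = (n - q + q)%N by lia.
move: (n - q)%N => p -> {n qn}; apply/seteqP; split => [_ [x + <-]|y].
  rewrite !ball2E -[x]hsubmxK row_lastmx; apply: le_trans.
  by rewrite -ler_sqr ?nnegrE ?enorm_ge0// enorm_row_mx lerDr sqr_ge0.
rewrite ball2E => hy; exists (row_mx 0 y); last by rewrite row_lastmx.
rewrite ball2E -(expr_le1 (n := 2))// ?enorm_ge0// enorm_row_mx enorm0 expr0n add0r.
by rewrite expr_le1// enorm_ge0.
Qed.

Lemma kub_ball n q : (q <= n)%N -> kub q (B n) = @omega R q.
Proof.
move=> qn; rewrite /kub -(mean_cst n (@omega R q)); apply: mean_eq => g og.
by rewrite /proj_vol img_mul img_ball// img_last_ball.
Qed.

Lemma vol_ball_sum n (X : set 'rV[R]_n) g t : orth g -> compact X ->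
  vol (minkowski_sum (img g X) (dilate t (B n))) = vol (minkowski_sum X (dilate t (B n))).
Proof.
move=> og cX; rewrite -[X in minkowski_sum _ (dilate t X)](img_ball og) -img_dilate -img_sum vol_img//.
by apply: compact_measurable_rV; apply: compact_sum => //; apply: compact_dilate; exact: compact_ball2.
Qed.

Lemma mean_sum_in n (I : eqType) (s : seq I) (phi : I -> 'M[R]_n -> R) : (forall i, i \in s -> obnd (phi i)) ->
  obnd (fun g => \sum_(i <- s) phi i g) /\ mean (fun g => \sum_(i <- s) phi i g) = \sum_(i <- s) mean (phi i).
Proof.
elim: s => [|i s IH] h.
  split; first by exists 0 => g _; rewrite big_nil normr0.
  by rewrite big_nil -[RHS](mean_cst n 0); apply: mean_eq => g _; rewrite big_nil.
have [|b m] := IH; first by move=> j js; apply: h; rewrite inE js orbT.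
have bi : obnd (phi i) by apply: h; rewrite mem_head.
split.
  have [c hc] := b; have [c' hc'] := bi; exists (c' + c) => g og; rewrite big_cons.
  by apply: (le_trans (ler_normD _ _)); rewrite lerD ?hc ?hc'.
by rewrite big_cons -m -meanD//; apply: mean_eq => g _; rewrite big_cons.
Qed.

Lemma obndZ n c (phi : 'M[R]_n -> R) : obnd phi -> obnd (fun g => c * phi g).
Proof. by move=> [b hb]; exists (`|c| * b) => g og; rewrite normrM ler_wpM2l ?hb. Qed.

(** The zonotope expansion is averaged over all rotations of [X]. This leaves the volume of [X] plus
    a ball unchanged and turns each projection volume into [kub]; the coefficients depend on the
    zonotope only. *)
Lemma steiner_approx n (e : R) : 0 < e -> exists2 kap : nat -> R, (forall i, 0 <= kap i) &
  forall X : set 'rV[R]_n.+1, body X -> forall t, 0 <= t ->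
   vol (minkowski_sum X (dilate t (B n.+1))) <= \sum_(i < n.+2) kap i * t ^+ i * kub (n.+1 - i) X <=
   vol (minkowski_sum X (dilate (t * (1 + e)) (B n.+1))).
Proof.
(* Chosen so that (1 + d) / (1 - d) = 1 + e. *)
move=> e0; pose d := e / (2%:R + e).
have e2 : 0 < 2%:R + e by rewrite addr_gt0.
have d0 : 0 < d by rewrite divr_gt0.
have d1 : d < 1 by rewrite ltr_pdivrMr// mul1r ltrDr.
have d1' : 0 < 1 - d by rewrite subr_gt0.
have [U [hU1 hU2]] := @zon_ball R n d d0 d1.
have [T hT vT] := zon_vol U.
pose kap i := \sum_(c <- T) (if c.1.2 == i then c.1.1 else 0) / (1 - d) ^+ i.
exists kap.
  move=> i; rewrite /kap big_seq; apply: sumr_ge0 => c /hT[c0 _ _].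
  by rewrite divr_ge0 ?exprn_ge0 ?(ltW d1')//; case: ifP.
move=> X bX t t0; have [cX vX _] := bX.
(* With this scaling the dilated zonotope lies between the balls of radii t and t (1 + e). *)
pose s := t / (1 - d); have s0 : 0 <= s by rewrite divr_ge0 ?(ltW d1').
pose F (c : R * nat * 'M[R]_n.+1) (g : 'M[R]_n.+1) :=
  c.1.1 * s ^+ c.1.2 * vol (img (c.2 *m lastmx n.+1 (n.+1 - c.1.2)) (img g X)).
have bF c : c \in T -> obnd (F c).
  move=> /hT[_ _ oc]; apply: obndZ.
  have [b _] := proj_vol_ok (n.+1 - c.1.2) bX; have [k hk] := b; exists k => g og.
  by rewrite -img_mul mulmxA; apply: hk; exact: orthM.
have [bS mS] := mean_sum_in bF.
have eS : \sum_(i < n.+2) kap i * t ^+ i * kub (n.+1 - i) X = mean (fun g => \sum_(c <- T) F c g).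
  rewrite mS; transitivity (\sum_(c <- T) c.1.1 * s ^+ c.1.2 * kub (n.+1 - c.1.2) X); last first.
    apply: eq_big_seq => c cT; have [_ _ oc] := hT c cT; rewrite -(kub_img _ bX oc) /F -meanZ//.
    have [b _] := proj_vol_ok (n.+1 - c.1.2) bX; have [k hk] := b; exists k => g og.
    by rewrite -img_mul mulmxA; apply: hk; exact: orthM.
  under eq_bigr do rewrite /kap -mulrA mulr_suml.
  rewrite exchange_big /=; apply: eq_big_seq => c cT; have [_ c1 _] := hT c cT.
  rewrite -ltnS in c1; rewrite (bigD1 (Ordinal c1))//= eqxx big1 => [|i /eqP ic].
    by rewrite addr0 /s expr_div_n; ring.
  case: eqP => [ci|_]; last by rewrite mul0r mul0r.
  by case: ic; apply: val_inj.
have cB (r : R) : compact (dilate r (B n.+1)) by apply: compact_dilate; exact: compact_ball2.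
have cs g (Y : set 'rV[R]_n.+1) : compact Y -> compact (minkowski_sum (img g X) Y).
  by move=> cY; apply: compact_sum => //; exact: compact_img.
have cZ : compact (dilate s (zon U)) by apply: compact_dilate; exact: compact_zon.
have eT g : \sum_(c <- T) F c g = vol (minkowski_sum (img g X) (dilate s (zon U))).
  by rewrite (vT _ (compact_img cX) (cvx_img vX) s s0).
rewrite eS; apply/andP; split.
  rewrite -[leLHS](mean_cst n.+1); apply: mean_le => //.
    by exists `|vol (minkowski_sum X (dilate t (B n.+1)))| => g _.
  move=> g og; rewrite eT -(vol_ball_sum _ og cX); apply: vol_le; [exact: cs|exact: cs|].
  apply: sum_sub => //; have -> : t = s * (1 - d) by rewrite divfK// gt_eqF.
  by rewrite -(dilate_dilate s (1 - d)); exact: dilate_sub.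
rewrite -[leRHS](mean_cst n.+1); apply: mean_le => //.
  by exists `|vol (minkowski_sum X (dilate (t * (1 + e)) (B n.+1)))| => g _.
move=> g og; rewrite eT -(vol_ball_sum _ og cX); apply: vol_le; [exact: cs|exact: cs|].
apply: sum_sub => //; have -> : t * (1 + e) = s * (1 + d).
  rewrite /s (_ : 1 + d = (1 + e) * (1 - d)); last by rewrite /d; field; rewrite gt_eqF.
  by rewrite [(1 + e) * _]mulrC mulrA divfK// gt_eqF.
by rewrite -(dilate_dilate s (1 + d)); exact: dilate_sub.
Qed.

(** The difference has size at most m and vanishes at the m points 0, ..., m - 1. *)
Lemma poly_eq_nneg m (a b : nat -> R) : (forall t, 0 <= t -> \sum_(i < m) a i * t ^+ i = \sum_(i < m) b i * t ^+ i) ->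
  forall i, (i < m)%N -> a i = b i.
Proof.
move=> h i im; pose p := \poly_(i < m) (a i - b i).
have p0 : p = 0.
  apply: (@roots_geq_poly_eq0 _ _ [seq j%:R | j <- iota 0 m]).
  - apply/allP => _ /mapP[j _ ->]; rewrite rootE horner_poly.
    under eq_bigr do rewrite mulrBl; rewrite sumrB h ?subrr//.
  - rewrite map_inj_uniq ?iota_uniq// => j l; exact: mulrIn.
  - by rewrite size_map size_iota size_poly.
by apply/eqP; rewrite -subr_eq0; have := congr1 (fun q : {poly R} => q`_i) p0; rewrite coef_poly im coef0 => ->.
Qed.

Lemma vol_ball_ball n t : (0 < n)%N -> 0 <= t -> vol (minkowski_sum (B n) (dilate t (B n))) = (1 + t) ^+ n * @omega R n.
Proof.
move=> n0 t0; have -> : minkowski_sum (B n) (dilate t (B n)) = dilate (1 + t) (B n).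
  have t1 : 0 < 1 + t by rewrite ltr_wpDr.
  apply/seteqP; split => [_ [x Bx [_ [y By <-] <-]]|_ [x Bx <-]].
    rewrite ball_enormE//=; apply: (le_trans (enormD _ _)); rewrite enormZ ger0_norm//.
    by move: Bx By; rewrite !ball2E => Bx By; rewrite lerD// ler_piMr.
  by exists x => //; exists (t *: x); [exists x|rewrite scalerDl scale1r].
by rewrite vol_dilate// ?ltr_wpDr//; exact: compact_ball2.
Qed.

(* In steiner_approx the coefficients do not depend on X, so their limits are
   identified by testing on the ball. *)
Lemma steiner_kubota n (X : set 'rV[R]_n.+1) : body X -> forall t, 0 <= t ->
  vol (minkowski_sum X (dilate t (B n.+1))) =
  \sum_(i < n.+2) 'C(n.+1, i)%:R * (@omega R n.+1 / @omega R (n.+1 - i) * kub (n.+1 - i) X) * t ^+ i.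
Proof.
pose e (N : nat) : R := N.+1%:R^-1.
have e0 N : 0 < e N by rewrite invr_gt0 ltr0n.
have e1 N : e N <= 1 by rewrite invf_le1 ?ler1n ?ltr0n.
have hk N : exists kap : nat -> R, (forall i, 0 <= kap i) /\
  forall X : set 'rV[R]_n.+1, body X -> forall t, 0 <= t ->
   vol (minkowski_sum X (dilate t (B n.+1))) <= \sum_(i < n.+2) kap i * t ^+ i * kub (n.+1 - i) X <=
   vol (minkowski_sum X (dilate (t * (1 + e N)) (B n.+1))).
  by have [kap h1 h2] := @steiner_approx n (e N) (e0 N); exists kap.
have [kap hkap] := choice hk.
have w0 m : 0 < @omega R m by exact: omega_gt0.
have kub0 m i (Y : set 'rV[R]_m) : body Y -> 0 <= kub i Y.
  move=> bY; rewrite -(mean_cst m 0); apply: mean_le.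
  - by exists 0 => g _; rewrite normr0.
  - by have [] := proj_vol_ok i bY.
  - by move=> g og; exact: vol_ge0.
(* Tested on the unit ball at t = 1, the upper estimate bounds a sum of nonnegative terms by the
   volume of a ball of radius 2 + e N, at most 3; this bounds each coefficient. *)
have bkap i : (i < n.+2)%N -> bnd (fun N => kap N i).
  move=> im; exists (@omega R n.+1 * 3%:R ^+ n.+1 / @omega R (n.+1 - i)) => N.
  have [k0 hkN] := hkap N; rewrite ger0_norm// ler_pdivlMr//.
  have := hkN _ (@body_ball n.+1) 1 ler01; rewrite mul1r => /andP[_].
  rewrite (bigD1 (Ordinal im))//= expr1n mulr1 kub_ball ?leq_subr// => h.
  apply: (le_trans _ (le_trans h _)).
    rewrite lerDl; apply: sumr_ge0 => j _; rewrite expr1n mulr1 mulr_ge0// kub0//; exact: body_ball.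
  rewrite vol_ball_ball ?addr_ge0 ?(ltW (e0 N))// [leRHS]mulrC ler_pM2r//; apply: lerXn2r; rewrite ?nnegrE ?addr_ge0 ?(ltW (e0 N))//; have := e1 N; lra.
pose P N (Y : set 'rV[R]_n.+1) t := \sum_(i < n.+2) kap N i * t ^+ i * kub (n.+1 - i) Y.
pose V (Y : set 'rV[R]_n.+1) t := vol (minkowski_sum Y (dilate t (B n.+1))).
have PV Y t : body Y -> 0 <= t -> ulim (fun N => P N Y t) = V Y t.
  move=> bY t0; apply: ulim_eq.
  pose C := V Y t * 3%:R ^+ n.+1.
  have : (fun N => V Y t + e N * C) N @[N --> UF] --> V Y t.
    rewrite -[X in _ --> X]addr0 -(mul0r C); apply: cvgD; first exact: cvg_cst.
    apply: cvgMl; apply: cvg_trans (@cvg_harmonic R); exact: cvg_app UF_oo.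
  have hP N : V Y t <= P N Y t <= V Y t + e N * C.
    have [k0 hkN] := hkap N; have /andP[h1 _] := hkN Y bY t t0; rewrite -/(P N Y t) -/(V Y t) in h1.
    rewrite h1 /=.
    (* The upper estimate at t / (1 + e N) involves exactly [V Y t]; returning to t costs at most
       the factor (1 + e N)^(n+1), which tends to 1. *)
    have u0 : 0 < 1 + e N by rewrite addr_gt0.
    have /andP[_] := hkN Y bY (t / (1 + e N)) (divr_ge0 t0 (ltW u0)).
    rewrite divfK ?gt_eqF// -/(V Y t) => h2.
    have h3 : P N Y t <= (1 + e N) ^+ n.+1 * V Y t.
      apply: (le_trans _ (ler_wpM2l (exprn_ge0 n.+1 (ltW u0)) h2)).
      rewrite mulr_sumr; apply: ler_sum => i _; rewrite expr_div_n.
      have -> : (1 + e N) ^+ n.+1 * (kap N i * (t ^+ i / (1 + e N) ^+ i) * kub (n.+1 - i) Y) =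
        (kap N i * t ^+ i * kub (n.+1 - i) Y) * ((1 + e N) ^+ n.+1 / (1 + e N) ^+ i) by ring.
      apply: ler_peMr; first by rewrite mulr_ge0 ?kub0// mulr_ge0 ?exprn_ge0.
      rewrite ler_pdivlMr ?exprn_gt0// mul1r ler_weXn2l ?lerDl ?(ltW (e0 N))//; have := ltn_ord i; lia.
    apply: (le_trans h3); have := bernoulli3 n.+1 (ltW (e0 N)) (e1 N).
    move=> h4; apply: (le_trans (ler_wpM2r (vol_ge0 _) h4)); rewrite /C /V; nra.
  move=> h; apply: (squeeze_cvgr _ (cvg_cst _) h).
  by apply: (@filterE _ UF).
pose ks i := ulim (fun N => kap N i).
have PE Y t : body Y -> 0 <= t -> V Y t = \sum_(i < n.+2) (ks i * kub (n.+1 - i) Y) * t ^+ i.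
  move=> bY t0; rewrite -PV// /P.
  have bi (i : 'I_n.+2) : bnd (fun N => kap N i * t ^+ i * kub (n.+1 - i) Y).
    by apply: bndM; [apply: bndM; [exact: bkap|exact: bnd_cst]|exact: bnd_cst].
  rewrite ulim_sum//; apply: eq_bigr => i _.
  have -> : (fun N => kap N i * t ^+ i * kub (n.+1 - i) Y) = (fun N => (t ^+ i * kub (n.+1 - i) Y) * kap N i).
    by apply/funext => N; ring.
  by rewrite ulimZ; [rewrite /ks; ring|exact: bkap].
have ksE i : (i < n.+2)%N -> ks i * @omega R (n.+1 - i) = 'C(n.+1, i)%:R * @omega R n.+1.
  move=> im; apply: (@poly_eq_nneg n.+2 (fun i => ks i * @omega R (n.+1 - i)) (fun i => 'C(n.+1, i)%:R * @omega R n.+1)) => // t t0.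
  have := PE _ _ (@body_ball n.+1) t0; rewrite /V vol_ball_ball// => h.
  transitivity ((1 + t) ^+ n.+1 * @omega R n.+1).
    by rewrite h; apply: eq_bigr => j _; rewrite kub_ball// leq_subr.
  rewrite exprDn mulr_suml; apply: eq_bigr => j _.
  by rewrite expr1n mul1r -mulr_natl; ring.
move=> bX t t0; rewrite -/(V X t) PE//; apply: eq_bigr => i _; congr (_ * _).
have h := ksE i (ltn_ord i).
have -> : ks i = 'C(n.+1, i)%:R * @omega R n.+1 / @omega R (n.+1 - i) by rewrite -h mulfK// gt_eqF.
by ring.
Qed.

(** [xget] may select any Steiner system; equality of the two polynomials on t >= 0 forces its
    coefficients, and the binomial factor can be cancelled because i <= n + 1. *)
Lemma quermass_kub n (X : set 'rV[R]_n.+1) i : body X -> (i <= n.+1)%N ->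
  quermass X i = @omega R n.+1 / @omega R (n.+1 - i) * kub (n.+1 - i) X.
Proof.
move=> bX im; have [cX vX _] := bX.
pose W i := @omega R n.+1 / @omega R (n.+1 - i) * kub (n.+1 - i) X.
have hW : steiner (lam n.+1) (B n.+1) n.+1 X W.
  move=> t t0; rewrite -(steiner_kubota bX t0) lam_vol//.
  by apply: compact_sum => //; apply: compact_dilate; exact: compact_ball2.
rewrite /quermass /quermass_gen; case: xgetP => [w _ [W' hW' ->]|no]; last first.
  by exfalso; apply: (no (W i)); exists W.
have h (t : R) : 0 <= t -> \sum_(j < n.+2) ('C(n.+1, j)%:R * W' j) * t ^+ j = \sum_(j < n.+2) ('C(n.+1, j)%:R * W j) * t ^+ j.
  by move=> t0; have := hW' t t0; rewrite hW// => -[].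
have := @poly_eq_nneg n.+2 (fun j => 'C(n.+1, j)%:R * W' j) (fun j => 'C(n.+1, j)%:R * W j) h i im.
by apply: mulfI; rewrite pnatr_eq0 -lt0n bin_gt0.
Qed.
End Steiner.

(** * The Brunn-Minkowski inequality *)

Section LayerCake.
Context {R : realType} d (T : measurableType d) (m : {sigma_finite_measure set T -> \bar R}).
Local Notation mu := (@lebesgue_measure R).
Implicit Types (c : R) (F : T -> \bar R).

(* The levels are normalized to t in (0, 1), so that functions with different
   suprema can be compared level by level. *)
Definition level c F (t : R) := m [set x | 0 < t < 1 /\ ((t * c)%:E < F x)%E].

Let S c F : set (T * measurableTypeR R) := [set z | 0 < (z.2 : R) < 1 /\ ((z.2 * c)%:E < F z.1)%E].

Let measS c F : measurable_fun setT F -> measurable (S c F).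
Proof.
move=> mF.
have m1 : measurable ([set z : T * measurableTypeR R | `]0, 1[%classic (z.2 : R)]).
  by apply: (measurable_preim (f := snd)) => //; exact: measurable_snd.
have m2 : measurable ([set z : T * measurableTypeR R | ((z.2 * c)%:E < F z.1)%E]).
  rewrite -[X in measurable X]setTI; apply: emeasurable_fun_lt => //.
    apply/measurable_EFinP; apply: measurable_funM => //; exact: measurable_snd.
  exact: (measurableT_comp mF measurable_fst).
rewrite (_ : S c F = [set z : T * measurableTypeR R | `]0, 1[%classic (z.2 : R)] `&` [set z : T * measurableTypeR R | ((z.2 * c)%:E < F z.1)%E]); first exact: measurableI.
by apply/seteqP; split => z /=; rewrite in_itv.
Qed.

Let levelE c F : measurable_fun setT F -> (\int[mu]_t level c F t = \int[m]_x mu (xsection (S c F) x))%E.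
Proof.
move=> mF; have := @product_measure12 R _ _ _ _ m mu (S c F) (measS _ mF).
rewrite /product_measure1 => ->; apply: eq_integral => t _; rewrite /level; congr (m _).
by apply/seteqP; split => x; rewrite /ysection /= inE.
Qed.

Lemma measurable_level c F : measurable_fun setT F -> measurable_fun setT (level c F : measurableTypeR R -> \bar R).
Proof.
move=> mF; have := @measurable_fun_ysection _ _ _ _ _ m _ (measS c mF).
apply: eq_measurable_fun => t _; rewrite /level; congr (m _).
by apply/seteqP; split => x; rewrite /ysection /= inE.
Qed.

Let xsecE c F x r : 0 < c -> F x = r%:E -> 0 <= r -> r <= c -> mu (xsection (S c F) x) = (r / c)%:E.
Proof.
move=> c0 Fx r0 rc.
have -> : xsection (S c F) x = `]0, (r / c)[%classic.
  apply/seteqP; split => t; rewrite /xsection /= inE /S /= Fx in_itv /= lte_fin.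
    by move=> [/andP[-> _]]; rewrite ltr_pdivlMr.
  move=> /andP[t0 tr]; rewrite t0 -ltr_pdivlMr//; split=> //; apply: (lt_le_trans tr).
  by rewrite ler_pdivrMr// mul1r.
rewrite lebesgue_measure_itv /= lte_fin.
case: ifPn => [_|h]; first by rewrite sube0.
by congr (_%:E); apply/eqP; rewrite eq_le divr_ge0 ?(ltW c0)// leNgt h.
Qed.

Let xsec_ge0 c F x : (0 <= mu (xsection (S c F) x))%E. Proof. exact: measure_ge0. Qed.
Let measx c F : measurable_fun setT F -> measurable_fun setT (fun x => mu (xsection (S c F) x)).
Proof. by move=> mF; apply: measurable_fun_xsection; exact: measS. Qed.

Lemma layer_eq c F : 0 < c -> measurable_fun setT F -> (forall x, 0 <= F x <= c%:E)%E ->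
  (c%:E * \int[mu]_t level c F t = \int[m]_x F x)%E.
Proof.
move=> c0 mF hF; rewrite levelE// -ge0_integralZl//; [|exact: measx|by rewrite lee_fin ltW].
apply: eq_integral => x _; have /andP[] := hF x; case Fx : (F x) => [r| |] //; rewrite !lee_fin => r0 rc.
by rewrite (xsecE c0 Fx)// -EFinM mulrC divfK ?gt_eqF.
Qed.

Lemma layer_le c F : 0 < c -> measurable_fun setT F -> (forall x, 0 <= F x)%E ->
  (c%:E * \int[mu]_t level c F t <= \int[m]_x F x)%E.
Proof.
move=> c0 mF hF.
(* Truncation at [c] leaves the levels unchanged, as these involve only heights below [c]. *)
pose G x := mine (F x) c%:E.
have mG : measurable_fun setT G by apply: measurable_mine => //; exact: measurable_cst.
have hG x : (0 <= G x <= c%:E)%E by rewrite /G ge_min lexx orbT andbT le_min hF lee_fin ltW.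
have -> : (\int[mu]_t level c F t = \int[mu]_t level c G t)%E.
  apply: eq_integral => t _; rewrite /level; congr (m _); apply/seteqP; split => x /= [/andP[t0 t1]].
    move=> h; rewrite t0 t1; split => //; rewrite /G lt_min h lte_fin /=.
    by rewrite -[ltRHS]mul1r ltr_pM2r.
  by rewrite /G lt_min t0 t1 => /andP[].
rewrite layer_eq//; apply: ge0_le_integral => //.
- by move=> x _; have /andP[] := hG x.
- by move=> x _; rewrite /G ge_min lexx.
Qed.
End LayerCake.

Section BrunnMinkowski.
Context {R : realType}.
Local Notation lam n := (@lebesgue_rV R n).
Local Notation mu := (@lebesgue_measure R).

(* C contains a translate of A ending, and a translate of B starting, at (nearly)
   the point sup A + inf B. *)
Lemma bm_line (A B C : set R) (r : R) : measurable A -> measurable B -> measurable C ->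
  A !=set0 -> B !=set0 -> (forall x, A x -> `|x| <= r) -> (forall x, B x -> `|x| <= r) ->
  (forall x y, A x -> B y -> C (x + y)) -> (mu A + mu B <= mu C)%E.
Proof.
move=> mA mB mC A0 B0 bA bB ABC.
apply/lee_addgt0Pr => e e0.
have e2 : 0 < e / 2 by rewrite divr_gt0.
have hA : has_sup A.
  by split => //; exists r => x /bA; rewrite ler_norml => /andP[].
have hB : has_inf B.
  by split => //; exists (- r) => x /bB; rewrite ler_norml => /andP[].
have [a Aa la] := sup_adherent e2 hA.
have [b Bb lb] := inf_adherent e2 hB.
pose A' := A `&` `]-oo, a]%classic; pose B' := B `&` `]b, +oo[%classic.
have mA' : measurable A' by exact: measurableI.
have mB' : measurable B' by exact: measurableI.
have h1 : (mu A <= mu A' + (e / 2)%:E)%E.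
  apply: (@le_trans _ _ (mu (A' `|` `]a, a + e / 2]%classic))).
    apply: le_measure; rewrite ?inE//; first exact: measurableU.
    move=> x Ax; have xs := sup_upper_bound hA Ax.
    case: (leP x a) => xa; [left|right]; first by split => //=; rewrite in_itv.
    rewrite /= in_itv /= xa /=; move: la; lra.
  apply: (le_trans (measureU2 _ _ _)) => //.
  have hi : (mu `]a, (a + e / 2)%R]%classic <= (e / 2)%:E)%E.
    rewrite lebesgue_measure_itv /= lte_fin ltrDl e2 -EFinB lee_fin; lra.
  exact: (leeD2l _ hi).
have h2 : (mu B <= mu B' + (e / 2)%:E)%E.
  apply: (@le_trans _ _ (mu (B' `|` `[b - e / 2, b]%classic))).
    apply: le_measure; rewrite ?inE//; first exact: measurableU.
    move=> x Bx; have xs := ge_inf hB.2 Bx.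
    case: (leP x b) => xb; [right|left]; last by split => //=; rewrite in_itv /= xb.
    rewrite /= in_itv /= xb andbT; move: lb; lra.
  apply: (le_trans (measureU2 _ _ _)) => //.
  have hi : (mu `[(b - e / 2)%R, b]%classic <= (e / 2)%:E)%E.
    rewrite lebesgue_measure_itv /= lte_fin gtrBl e2 -EFinB lee_fin; lra.
  exact: (leeD2l _ hi).
have h3 : (mu A' + mu B' <= mu C)%E.
  have mtr (D : set R) (u : R) : measurable D -> measurable ((fun x => x + u) @^-1` D).
    move=> mD; have mf : measurable_fun setT (fun x : measurableTypeR R => (x + u) : measurableTypeR R).
      by apply: measurable_funD => //; exact: measurable_id.
    exact: (measurable_preim mf mD).
  rewrite -(lebesgue_measure_shift (- b) mA') -(lebesgue_measure_shift (- a) mB').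
  rewrite -measureU//; [|exact: mtr|exact: mtr|].
    apply: le_measure; rewrite ?inE//; first by apply: measurableU; exact: mtr.
    move=> x /= [[h _]|[h _]].
      by rewrite -[x](subrK b) //; exact: ABC.
    by rewrite -[x](subrK a) addrC; exact: ABC.
  apply/seteqP; split => // x [[_ /=]]; rewrite in_itv /= => h [_ /=]; rewrite in_itv /= andbT; lra.
apply: (le_trans (leeD h1 h2)).
rewrite addeACA -EFinD (_ : e / 2 + e / 2 = e); first exact: leeD2r.
by rewrite -mulrDl -mulr2n -[e *+ 2]mulr_natr mulfK.
Qed.

(** Radon's inequality, which reassembles the two level integrals normalized by different suprema.
    With x = p / a and y = q / b the induction step amounts to a b (x - y) (x^(m+1) - y^(m+1)) >=
    0. *)
Lemma radon_le m (p q a b : R) : 0 < a -> 0 < b -> 0 <= p -> 0 <= q ->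
  (p + q) ^+ m.+1 <= (a + b) ^+ m * (p ^+ m.+1 / a ^+ m + q ^+ m.+1 / b ^+ m).
Proof.
move=> a0 b0 p0 q0; elim: m => [|m IH].
  by rewrite !expr0 mul1r !divr1 !expr1.
have ab0 : 0 < a + b by rewrite addr_gt0.
have -> : (p + q) ^+ m.+2 = (p + q) * (p + q) ^+ m.+1 by rewrite exprS.
apply: (le_trans (ler_wpM2l (addr_ge0 p0 q0) IH)).
rewrite (mulrCA (p + q)) (exprSr (a + b)) -(mulrA _ (a + b)) ler_pM2l ?exprn_gt0//.
have [x x0 px] : exists2 x, 0 <= x & p = x * a by exists (p / a); rewrite ?divr_ge0 ?(ltW a0)// divfK// gt_eqF.
have [y y0 qy] : exists2 y, 0 <= y & q = y * b by exists (q / b); rewrite ?divr_ge0 ?(ltW b0)// divfK// gt_eqF.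
have hp k : p ^+ k.+1 / a ^+ k = a * x ^+ k.+1.
  by rewrite px exprMn [a ^+ _.+1]exprS mulrA mulfK ?gt_eqF ?exprn_gt0// mulrC.
have hq k : q ^+ k.+1 / b ^+ k = b * y ^+ k.+1.
  by rewrite qy exprMn [b ^+ _.+1]exprS mulrA mulfK ?gt_eqF ?exprn_gt0// mulrC.
rewrite !hp !hq px qy [x ^+ m.+2]exprS [y ^+ m.+2]exprS.
have h : 0 <= (x - y) * (x ^+ m.+1 - y ^+ m.+1).
  case: (leP x y) => xy.
    by rewrite -mulrNN !opprB mulr_ge0 ?subr_ge0// lerXn2r.
  by rewrite mulr_ge0 ?subr_ge0 ?(ltW xy)// lerXn2r ?nnegrE// ltW.
have h2 : 0 <= a * b * ((x - y) * (x ^+ m.+1 - y ^+ m.+1)) by rewrite mulr_ge0// mulr_ge0// ltW.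
rewrite -subr_ge0; apply: (le_trans h2); rewrite le_eqVlt; apply/orP; left; apply/eqP; ring.
Qed.

Lemma root_exists n (s : R) : 0 <= s -> exists2 a, 0 <= a & a ^+ n.+1 = s.
Proof.
move=> s0; exists (s `^ (n.+1%:R^-1)); first exact: powR_ge0.
by rewrite -powR_mulrn ?powR_ge0// -powRrM mulVf ?powRr1// pnatr_eq0.
Qed.

Lemma lam_consE n (A : set 'rV[R]_n.+1) : measurable A ->
  (lam n.+1 A = \int[mu]_x lam n [set y | A (cons_rV (x, y))])%E.
Proof.
move=> mA; apply: eq_integral => x _; congr (lam n _).
by apply/seteqP; split => y; rewrite /xsection /= inE.
Qed.

Lemma measurable_cons_slice n (A : set 'rV[R]_n.+1) x : measurable A ->
  measurable [set y : 'rV[R]_n | A (cons_rV (x, y))].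
Proof.
move=> mA; have := measurable_xsection x (measurable_preim (@measurable_cons_rV R n) mA).
rewrite (_ : xsection _ x = [set y : 'rV[R]_n | A (cons_rV (x, y))])//.
by apply/seteqP; split => y; rewrite /xsection /= inE.
Qed.

Lemma measurable_lam_cons n (A : set 'rV[R]_n.+1) : measurable A ->
  measurable_fun setT (fun x : measurableTypeR R => lam n [set y | A (cons_rV (x, y))]).
Proof.
move=> mA; have := measurable_fun_xsection (lam n) (measurable_preim (@measurable_cons_rV R n) mA).
apply: eq_measurable_fun => x _ /=; congr (lam n _).
by apply/seteqP; split => y; rewrite /xsection /= inE.
Qed.

Lemma cons_rV_add n (x y : R) (u v : 'rV[R]_n) : cons_rV (x, u) + cons_rV (y, v) = cons_rV (x + y, u + v) :> 'rV[R]_n.+1.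
Proof. by rewrite /cons_rV /= (@add_row_mx _ 1 1 n) -raddfD. Qed.

Lemma enorm_cons n (x : R) (v : 'rV[R]_n) : `|x| <= enorm (cons_rV (x, v)) /\ enorm v <= enorm (cons_rV (x, v)).
Proof.
have e : enorm (cons_rV (x, v)) ^+ 2 = x ^+ 2 + enorm v ^+ 2.
  rewrite (@enorm_row_mx R 1 n x%:M v); congr (_ + _).
  by rewrite -dotxx /dot big_ord1 !mxE eqxx mulr1n expr2.
split; rewrite -(@ler_pXn2r _ 2) ?nnegrE ?enorm_ge0 ?normr_ge0// e ?real_normK ?num_real ?lerDl ?lerDr ?sqr_ge0//.
Qed.

Lemma lam_add_le n (A B C : set 'rV[R]_n) : measurable B -> measurable C -> A !=set0 ->
  (forall x y, A x -> B y -> C (x + y)) -> (lam n B <= lam n C)%E.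
Proof.
move=> mB mC [a Aa] h; rewrite -(lam_shift a mC); apply: le_measure; rewrite ?inE//.
  exact: measurable_shift.
by move=> x Bx /=; rewrite addrC; exact: h.
Qed.

(** [a ^+ n.+1] is the supremum of the volumes of the slices. Every level t in (0, 1) is then
    nonempty, as [bm_line] requires, and the layer formula gives the integral of the levels. *)
Lemma bm_profile n (S : set 'rV[R]_n.+2) (r s : R) (F := fun x => lam n.+1 [set y | S (cons_rV (x, y))]) :
  measurable S -> (forall x, S x -> enorm x <= r) -> 0 < s -> ((s ^+ n.+2)%:E <= lam n.+2 S)%E ->
  exists a, [/\ 0 < a,
    forall t, 0 < t < 1 -> exists x, ((t * a ^+ n.+1)%:E < F x)%E &
    ((s ^+ n.+2 / a ^+ n.+1)%:E <= \int[mu]_t level mu (a ^+ n.+1) F t)%E].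
Proof.
move=> mS bS s0 hs.
pose D : set 'rV[R]_n.+1 := [set y | enorm y <= r].
have mFS x : measurable [set y | S (cons_rV (x, y))] by exact: measurable_cons_slice.
have mD : measurable D by apply: closed_measurable_rV; exact: closed_enorm.
have hfin : lam n.+1 D \is a fin_num by apply: (@lam_bounded_fin _ _ _ r).
have FD x : (F x <= lam n.+1 D)%E.
  apply: le_measure; rewrite ?inE// => y /bS; apply: le_trans; exact: (enorm_cons x y).2.
have fF x : F x = (fine (F x))%:E.
  rewrite fineK// ge0_fin_numE ?measure_ge0//; apply: le_lt_trans (FD x) _.
  by rewrite -ge0_fin_numE.
pose al := sup (range (fun x => fine (F x))).
have hsup : has_sup (range (fun x => fine (F x))).
  split; first by exists (fine (F 0)); exists 0.
  by exists (fine (lam n.+1 D)) => _ [x _ <-]; rewrite -lee_fin -fF fineK.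
have hal x : (F x <= al%:E)%E by rewrite fF lee_fin; apply: sup_upper_bound => //; exists x.
have mF : measurable_fun setT (F : measurableTypeR R -> \bar R) by exact: measurable_lam_cons.
have al0 : 0 < al.
  rewrite ltNge; apply/negP => al0; move: hs; rewrite lam_consE//.
  rewrite (_ : (\int[mu]_x _ = 0)%E); first by rewrite lee_fin leNgt exprn_gt0.
  apply: integral0_eq => x _; apply/eqP; rewrite eq_le measure_ge0 andbT.
  by apply: (le_trans (hal x)); rewrite lee_fin.
have [a a0 ae] := @root_exists n al (ltW al0).
have ap : 0 < a by rewrite lt_neqAle a0 andbT eq_sym; apply: contraTneq al0 => a00; rewrite -ae a00 expr0n ltxx.
exists a; rewrite ae; split => //.
  move=> t /andP[t0 t1].
  have [] := @sup_adherent _ _ ((1 - t) * al) _ hsup; first by rewrite mulr_gt0// subr_gt0.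
  move=> _ [x _ <-] hx; exists x; rewrite fF lte_fin; move: hx; rewrite -/al mulrBl mul1r; lra.
have hl : (al%:E * \int[mu]_t level mu al F t = lam n.+2 S)%E.
  by rewrite lam_consE//; apply: layer_eq => // x; rewrite measure_ge0 hal.
by rewrite mulrC EFinM lee_pdivrMl// hl.
Qed.

Lemma integral_add_le (f g h : measurableTypeR R -> \bar R) :
  measurable_fun setT f -> measurable_fun setT g -> measurable_fun setT h ->
  (forall t, 0 <= f t)%E -> (forall t, 0 <= g t)%E -> (forall t, f t + g t <= h t)%E ->
  (\int[mu]_t f t + \int[mu]_t g t <= \int[mu]_t h t)%E.
Proof.
move=> mf mg mh f0 g0 fgh; rewrite -ge0_integralD//; apply: ge0_le_integral => //.
  by move=> t _; rewrite adde_ge0.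
exact: emeasurable_funD.
Qed.

(* By induction on the dimension: the slices of A above t sup and of B above t sup
   add up, by the induction hypothesis, to slices of C above t (a + b)^(n+1); then
   bm_line is integrated over t. *)
Lemma brunn_minkowski n (A B C : set 'rV[R]_n.+1) (r p q : R) : measurable A -> measurable B -> measurable C ->
  A !=set0 -> B !=set0 -> (forall x, A x -> enorm x <= r) -> (forall x, B x -> enorm x <= r) ->
  (forall x y, A x -> B y -> C (x + y)) -> 0 <= p -> 0 <= q ->
  ((p ^+ n.+1)%:E <= lam n.+1 A)%E -> ((q ^+ n.+1)%:E <= lam n.+1 B)%E -> (((p + q) ^+ n.+1)%:E <= lam n.+1 C)%E.
Proof.
elim: n A B C p q => [|n IH] A B C p q mA mB mC A0 B0 bA bB ABC p0 q0.
  rewrite !lam1E// !expr1 => hp hq; rewrite EFinD; apply: (le_trans (leeD hp hq)).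
  have hs (S : set 'rV[R]_1) : measurable S -> measurable ([set u | S u%:M] : set R).
    move=> mS; apply: (measurable_preim (f := fun u : measurableTypeR R => u%:M : 'rV[R]_1)) => //.
    apply: measurable_fun_rVP => i; apply: (eq_measurable_fun (fun r => r : measurableTypeR R)).
      by move=> u _; rewrite !mxE (ord1 i).
    exact: measurable_id.
  have hb (S : set 'rV[R]_1) : (forall x, S x -> enorm x <= r) -> forall u, S u%:M -> `|u| <= r.
    by move=> h u /h; apply: le_trans; rewrite (le_trans _ (enorm_coor _ ord0))// mxE.
  have hn (S : set 'rV[R]_1) : S !=set0 -> [set u | S u%:M] !=set0.
    by move=> [x Sx]; exists (x 0 0) => /=; rewrite -mx11_scalar.
  apply: (@bm_line _ _ _ r) => //; try exact: hs; try exact: hn; try exact: hb.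
  by move=> x y /= hx hy; rewrite raddfD; exact: ABC.
(* If p or q is 0, a translate of the other set lies in [C]. Otherwise both sets have positive
   volume and [bm_profile] applies. *)
move: p0 q0; rewrite le_eqVlt => /predU1P[<- q0 _ hq|p0].
  by rewrite add0r; apply: (le_trans hq); exact: lam_add_le A0 ABC.
rewrite le_eqVlt => /predU1P[<- hp _|q0 hp hq].
  rewrite addr0; apply: (le_trans hp); apply: (lam_add_le mA mC B0) => x y Bx Ay; rewrite addrC; exact: ABC.

pose F (A : set 'rV[R]_n.+2) x := lam n.+1 [set y | A (cons_rV (x, y))].
have mF S : measurable S -> measurable_fun setT (F S : measurableTypeR R -> \bar R) by exact: measurable_lam_cons.
have [a [a0 aF aL]] : exists a, [/\ 0 < a, forall t, 0 < t < 1 -> exists x, ((t * a ^+ n.+1)%:E < F A x)%E &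
    ((p ^+ n.+2 / a ^+ n.+1)%:E <= \int[mu]_t level mu (a ^+ n.+1) (F A) t)%E] := bm_profile mA bA p0 hp.
have [b [b0 bF bL]] : exists b, [/\ 0 < b, forall t, 0 < t < 1 -> exists x, ((t * b ^+ n.+1)%:E < F B x)%E &
    ((q ^+ n.+2 / b ^+ n.+1)%:E <= \int[mu]_t level mu (b ^+ n.+1) (F B) t)%E] := bm_profile mB bB q0 hq.
have ab0 : 0 < a + b by rewrite addr_gt0.
rewrite (lam_consE mC).
apply: (le_trans _ (@layer_le _ _ _ mu ((a + b) ^+ n.+1) (F C) (exprn_gt0 _ ab0) (mF _ mC) (fun x => measure_ge0 _ _))).
apply: (@le_trans _ _ (((a + b) ^+ n.+1)%:E * (\int[mu]_t level mu (a ^+ n.+1) (F A) t + \int[mu]_t level mu (b ^+ n.+1) (F B) t))%E).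
  apply: (@le_trans _ _ ((a + b) ^+ n.+1 * (p ^+ n.+2 / a ^+ n.+1 + q ^+ n.+2 / b ^+ n.+1))%:E).
    by rewrite lee_fin radon_le// ltW.
  rewrite EFinM; apply: lee_wpmul2l; first by rewrite lee_fin exprn_ge0// ltW.
  exact: (leeD aL bL).
apply: lee_wpmul2l; first by rewrite lee_fin exprn_ge0// ltW.
have mL c S : measurable S -> measurable_fun setT (level mu c (F S) : measurableTypeR R -> \bar R).
  by move=> mS; apply: measurable_level; exact: mF.
have L0 c S t : (0 <= level mu c (F S) t)%E by exact: measure_ge0.
apply: (integral_add_le (mL _ _ mA) (mL _ _ mB) (mL _ _ mC) (L0 _ _) (L0 _ _)).
move=> t; case: (boolP (0 < t < 1)) => [t01|tn]; last first.
  have l0 c G : level mu c G t = 0%E.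
    rewrite /level (_ : [set _ | _] = set0) ?measure0//.
    by apply/seteqP; split => // x [h]; rewrite h in tn.
  by rewrite !l0 adde0.
have mlev c S : measurable S -> measurable ([set x : measurableTypeR R | 0 < t < 1 /\ ((t * c)%:E < F S x)%E]).
  move=> mS; rewrite (_ : [set _ | _] = [set x | ((t * c)%:E < F S x)%E]); last by apply/seteqP; split => x // [].
  rewrite -[X in measurable X]setTI; apply: emeasurable_fun_lt => //; exact: mF.
have ne S x c : 0 < c -> ((t * c)%:E < F S x)%E -> [set y | S (cons_rV (x, y))] !=set0.
  move=> c0 h; apply/set0P; apply: contraTneq h => h0; rewrite /F h0 measure0 -leNgt lee_fin.
  by case/andP: t01 => t0 _; rewrite mulr_ge0// ltW.
have hb S c x : 0 < c -> (forall x, S x -> enorm x <= r) -> ((t * c)%:E < F S x)%E -> `|x| <= r.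
  by move=> c0 bS /(ne _ _ _ c0)[y /bS]; apply: le_trans; exact: (enorm_cons x y).1.
apply: (@bm_line _ _ _ r) => //; try exact: mlev.
- by have [x hx] := aF t t01; exists x.
- by have [x hx] := bF t t01; exists x.
- by move=> x [_]; apply: hb => //; rewrite exprn_gt0.
- by move=> x [_]; apply: hb => //; rewrite exprn_gt0.
move=> x y [_ hx] [_ hy]; split => //.
(* Strictness at level t leaves room for a common larger level s, so that the conclusion for [C] is
   again strict at t. *)
have [s [ts sx sy]] : exists s, [/\ t < s, ((s * a ^+ n.+1)%:E <= F A x)%E & ((s * b ^+ n.+1)%:E <= F B y)%E].
  have hsup c u : 0 < c -> ((t * c)%:E < u)%E -> exists2 s, t < s & forall s', s' <= s -> ((s' * c)%:E <= u)%E.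
    move=> c0; case: u => [u| |] //; last by move=> _; exists (t + 1) => [|s' _]; rewrite ?ltrDl// leey.
    rewrite lte_fin => h; exists (u / c); first by rewrite ltr_pdivlMr.
    by move=> s'; rewrite lee_fin ler_pdivlMr.
  have [s1 t1 h1] := hsup _ _ (exprn_gt0 n.+1 a0) hx.
  have [s2 t2 h2] := hsup _ _ (exprn_gt0 n.+1 b0) hy.
  by exists (Num.min s1 s2); split; [rewrite lt_min t1|apply: h1; rewrite ge_min lexx|apply: h2; rewrite ge_min lexx orbT].
have s0 : 0 <= s by apply: ltW; apply: lt_trans ts; case/andP: t01.
(* The slices have volumes at least (u a)^(n+1) and (u b)^(n+1), and by the induction hypothesis
   their sum has at least (u a + u b)^(n+1) = s (a + b)^(n+1). *)
have [u u0 us] := @root_exists n s s0.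
apply: (@lt_le_trans _ _ ((u * a + u * b) ^+ n.+1)%:E).
  by rewrite -mulrDr exprMn us lte_fin ltr_pM2r// exprn_gt0.
apply: (IH [set z | A (cons_rV (x, z))] [set z | B (cons_rV (y, z))]); try exact: measurable_cons_slice.
- by apply: ne hx; rewrite exprn_gt0.
- by apply: ne hy; rewrite exprn_gt0.
- by move=> z /bA; apply: le_trans; exact: (enorm_cons x z).2.
- by move=> z /bB; apply: le_trans; exact: (enorm_cons y z).2.
- by move=> z w /= hz hw; rewrite -cons_rV_add; exact: ABC.
- by rewrite mulr_ge0// ltW.
- by rewrite mulr_ge0// ltW.
- by rewrite exprMn us.
- by rewrite exprMn us.
Qed.
End BrunnMinkowski.

(** * Slices and projections of a balanced body *)

Section Slices.
Context {R : realType}.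
Local Notation lam n := (@lebesgue_rV R n).
Local Notation mu := (@lebesgue_measure R).

Definition slice p q (X : set 'rV[R]_(p + q)) (x : 'rV[R]_q) : set 'rV[R]_p := [set y | X (row_mx y x)].

Lemma enorm_row_le p q (y : 'rV[R]_p) (x : 'rV[R]_q) : enorm y <= enorm (row_mx y x) /\ enorm x <= enorm (row_mx y x).
Proof.
split; rewrite -(@ler_pXn2r _ 2) ?nnegrE ?enorm_ge0// enorm_row_mx ?lerDl ?lerDr ?sqr_ge0//.
Qed.

Lemma enorm_row0 p q (y : 'rV[R]_p) : enorm (row_mx y (0 : 'rV[R]_q)) = enorm y.
Proof.
by apply/eqP; rewrite -(@eqrXn2 _ 2) ?enorm_ge0// enorm_row_mx enorm0 expr0n addr0.
Qed.

Lemma slice_bounded p q (X : set 'rV[R]_(p + q)) r x : (forall z, X z -> enorm z <= r) ->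
  forall y, slice X x y -> enorm y <= r.
Proof. by move=> h y /h; apply: le_trans; exact: (enorm_row_le y x).1. Qed.

Lemma compact_slice p q (X : set 'rV[R]_(p + q)) x : compact X -> compact (slice X x).
Proof.
move=> cX; have [r _ hr] := compact_enorm cX.
apply: bounded_closed_compact; first by apply: (@bounded_enorm _ _ _ r); exact: slice_bounded.
apply: preimage_closed; last by apply: compact_closed => //; exact: norm_hausdorff.
move=> y _; move: y; apply: (@enorm_lip _ _ _ _ 1) => u v.
rewrite mul1r opp_row_mx add_row_mx subrr; apply: (le_trans (sup_enorm _)); by rewrite enorm_row0.
Qed.

Lemma slice_cvx p q (X : set 'rV[R]_(p + q)) t x y u v : cvx X -> 0 <= t -> t <= 1 ->
  slice X x u -> slice X y v -> slice X (t *: x + (1 - t) *: y) (t *: u + (1 - t) *: v).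
Proof.
by move=> vX t0 t1 hx hy; have := vX _ _ _ t0 t1 hx hy; rewrite !scale_row_mx add_row_mx.
Qed.

Definition nroot n (s : R) := s `^ (n.+1%:R^-1).
Lemma nroot_ge0 n s : 0 <= nroot n s. Proof. exact: powR_ge0. Qed.
Lemma nrootK n s : 0 <= s -> nroot n s ^+ n.+1 = s.
Proof. by move=> s0; rewrite /nroot -powR_mulrn ?powR_ge0// -powRrM mulVf ?powRr1// pnatr_eq0. Qed.
Lemma nroot_le n s u : 0 <= s -> s <= u ^+ n.+1 -> 0 <= u -> nroot n s <= u.
Proof. by move=> s0 su u0; rewrite -(@ler_pXn2r _ n.+1)// ?nnegrE ?nroot_ge0// nrootK. Qed.
Lemma nroot_ge n s u : 0 <= s -> u ^+ n.+1 <= s -> 0 <= u -> u <= nroot n s.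
Proof. by move=> s0 su u0; rewrite -(@ler_pXn2r _ n.+1)// ?nnegrE ?nroot_ge0// nrootK. Qed.

Lemma bm_cvx n (A B C : set 'rV[R]_n.+1) t : compact A -> compact B -> compact C -> A !=set0 -> B !=set0 ->
  0 <= t -> t <= 1 -> (forall x y, A x -> B y -> C (t *: x + (1 - t) *: y)) ->
  t * nroot n (vol A) + (1 - t) * nroot n (vol B) <= nroot n (vol C).
Proof.
move=> cA cB cC A0 B0 t0 t1 h.
have s0 : 0 <= 1 - t by rewrite subr_ge0.
apply: nroot_ge; [exact: vol_ge0| |by rewrite addr_ge0// mulr_ge0// nroot_ge0].
have cA' : compact (dilate t A) by exact: compact_dilate.
have cB' : compact (dilate (1 - t) B) by exact: compact_dilate.
have [r1 r10 h1] := compact_enorm cA'; have [r2 r20 h2] := compact_enorm cB'.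
have hne c (X : set 'rV[R]_n.+1) : X !=set0 -> dilate c X !=set0 by move=> [x Xx]; exists (c *: x); exists x.
have hv c (X : set 'rV[R]_n.+1) : 0 <= c -> compact X -> X !=set0 -> (((c * nroot n (vol X)) ^+ n.+1)%:E <= lam n.+1 (dilate c X))%E.
  move=> c0 cX X0; rewrite lam_vol; last exact: compact_dilate.
  by rewrite lee_fin vol_dilate0// exprMn nrootK// vol_ge0.
rewrite -lee_fin -(lam_vol cC).
apply: (@brunn_minkowski R n (dilate t A) (dilate (1 - t) B) C (Num.max r1 r2)); try exact: compact_measurable_rV; try exact: hne; try exact: hv; try by rewrite mulr_ge0 ?nroot_ge0.
- by move=> x /h1; rewrite le_max => ->.
- by move=> x /h2; rewrite le_max => ->; rewrite orbT.
by move=> _ _ [x Ax <-] [y By <-]; exact: h.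
Qed.

Lemma integral_scale_le (a b : R) (f g : measurableTypeR R -> \bar R) : 0 <= a -> 0 <= b ->
  measurable_fun setT f -> measurable_fun setT g -> (forall t, 0 <= f t)%E -> (forall t, 0 <= g t)%E ->
  (forall t, a%:E * f t <= b%:E * g t)%E -> (a%:E * \int[mu]_t f t <= b%:E * \int[mu]_t g t)%E.
Proof.
move=> a0 b0 mf mg f0 g0 h; rewrite -!ge0_integralZl//; apply: ge0_le_integral => //.
- by move=> t _; rewrite mule_ge0.
- exact: measurable_funeM.
- exact: measurable_funeM.
Qed.

(** The two sides differ by (1 - t) b (a - u). It lets the root [u] of the volume of a level set
    take the place of the larger width [a] in [marg_level]. *)
Lemma mix_le (t a b u : R) : t <= 1 -> 0 <= b -> u <= a ->
  (t * a + (1 - t) * b) * u <= a * (t * u + (1 - t) * b).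
Proof.
move=> t1 b0 ua; rewrite -subr_ge0 (_ : _ - _ = (1 - t) * b * (a - u)); last by ring.
by rewrite mulr_ge0 ?subr_ge0// mulr_ge0// subr_ge0.
Qed.

Section Marginals.
Variables (j m k : nat) (X : set 'rV[R]_((j + m.+1) + k)).
Hypotheses (cX : compact X) (vX : cvx X).

(** The first [j] coordinates are forgotten. Below, [marg] and [width] are the functions f and w of
    the overview. *)
Definition shadow : set 'rV[R]_(m.+1 + k) := img (lastmx ((j + m.+1) + k) (m.+1 + k)) X.
Definition marg (x : 'rV[R]_k) : R := vol (slice X x).
Definition width (x : 'rV[R]_k) : R := nroot m (vol (slice shadow x)).

Lemma row3_lastmx (l : 'rV[R]_j) (w : 'rV[R]_m.+1) (x : 'rV[R]_k) :
  row_mx (row_mx l w) x *m lastmx ((j + m.+1) + k) (m.+1 + k) = row_mx w x.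
Proof.
have h : lastmx ((j + m.+1) + k) (m.+1 + k) = col_mx (row_mx (col_mx 0 1%:M) 0) (row_mx 0 1%:M) :> 'M[R]_((j + m.+1) + k, m.+1 + k).
  apply/matrixP => i l'; case: (split_ordP i) => i' ->; rewrite ?col_mxEu ?col_mxEd; case: (split_ordP l') => l'' ->; rewrite ?row_mxEl ?row_mxEr.
  - case: (split_ordP i') => i'' ->; rewrite ?col_mxEu ?col_mxEd !mxE /= -?val_eqE /=.
      case: eqP => //; have := ltn_ord i''; lia.
    by congr (nat_of_bool _)%:R; lia.
  - rewrite !mxE /=; case: eqP => //; have := ltn_ord i'; lia.
  - rewrite !mxE /=; case: eqP => //; have := ltn_ord l''; lia.
  - by rewrite !mxE /= -?val_eqE /=; congr (nat_of_bool _)%:R; lia.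
by rewrite h mul_row_col !mul_mx_row mul_row_col !mulmx0 !mulmx1 add0r add_row_mx addr0 add0r.
Qed.

Lemma shadowP w x : shadow (row_mx w x) <-> exists l, X (row_mx (row_mx l w) x).
Proof.
split => [[z Xz]|[l Xl]]; last by exists (row_mx (row_mx l w) x) => //; exact: row3_lastmx.
rewrite -[z]hsubmxK -[lsubmx z]hsubmxK row3_lastmx => /eq_row_mx[<- <-].
by exists (lsubmx (lsubmx z)); rewrite !hsubmxK.
Qed.

Lemma compact_shadow : compact shadow. Proof. exact: compact_img. Qed.
Lemma cvx_shadow : cvx shadow. Proof. exact: cvx_img. Qed.

Lemma slice_shadow_cvx t x y u v : 0 <= t -> t <= 1 ->
  slice shadow x u -> slice shadow y v -> slice shadow (t *: x + (1 - t) *: y) (t *: u + (1 - t) *: v).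
Proof. by apply: slice_cvx; exact: cvx_shadow. Qed.

Lemma width_concave x y t : 0 <= t -> t <= 1 -> slice shadow x !=set0 -> slice shadow y !=set0 ->
  t * width x + (1 - t) * width y <= width (t *: x + (1 - t) *: y).
Proof.
move=> t0 t1 x0 y0; apply: bm_cvx => //; try (apply: compact_slice; exact: compact_shadow).
by move=> u v hu hv; exact: slice_shadow_cvx.
Qed.

Let rho x w := lam j (slice (slice X x) w).

Let mslice x : measurable (slice X x).
Proof. by apply: compact_measurable_rV; exact: compact_slice. Qed.

Let mrho x : measurable_fun setT (rho x).
Proof. exact: (measurable_slice2 (mslice x)). Qed.

Let margE x : (marg x)%:E = (\int[lam m.+1]_w rho x w)%E.
Proof. by rewrite /marg -lam_vol ?lam_fubini2//; exact: compact_slice. Qed.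

(** For a point [l0] of the fibre over (w0, x0), convexity puts t times the fibre over (w, x),
    shifted by (1 - t) l0, inside the fibre over the combined point. *)
Let rho_shrink t x x0 w w0 : 0 < t -> t <= 1 -> slice shadow x0 w0 ->
  ((t ^+ j)%:E * rho x w <= rho (t *: x + (1 - t) *: x0) (t *: w + (1 - t) *: w0))%E.
Proof.
move=> t0 t1 /shadowP[l0 hl0].
have cs x' w' : compact (slice (slice X x') w') by do 2!apply: compact_slice.
rewrite /rho -lam_dilate//; last exact: compact_measurable_rV.
rewrite -(lam_translate ((1 - t) *: l0)); last by apply: compact_measurable_rV; exact: compact_dilate.
apply: le_measure; rewrite ?inE; last 1 first.
- move=> _ [_ [l hl <-] <-]; have := vX (ltW t0) t1 hl hl0.
  by rewrite !scale_row_mx !add_row_mx.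
- rewrite shiftE; apply: measurable_shift.
  by apply: compact_measurable_rV; exact: compact_dilate.
- exact: compact_measurable_rV.
Qed.

(** By [rho_shrink], t times the level set of [rho x] plus 1 - t times the shadow slice over [x0]
    lies in a level set over the combined point, with the threshold lowered by t^j. Brunn-Minkowski
    bounds the volume of the latter from below, and [mix_le] replaces the root of the volume of the
    first level set by [width x], which is legitimate because that set lies in the shadow slice over
    [x]. *)
Lemma marg_level c t x x0 s : 0 < c -> 0 < t -> t < 1 -> slice shadow x0 !=set0 ->
  (((t * width x + (1 - t) * width x0) ^+ m.+1)%:E * level (lam m.+1) c (rho x) s <=
   (width x ^+ m.+1)%:E * level (lam m.+1) (t ^+ j * c) (rho (t *: x + (1 - t) *: x0)) s)%E.
Proof.
move=> c0 t0 t1 x00; set x' := t *: x + (1 - t) *: x0.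
have s0 : 0 < 1 - t by rewrite subr_gt0.
have [r _ hr] := compact_enorm cX.
pose U := [set w | 0 < s < 1 /\ ((s * c)%:E < rho x w)%E].
pose V := [set w | 0 < s < 1 /\ ((s * (t ^+ j * c))%:E < rho x' w)%E].
have mlev b y : measurable [set w | 0 < s < 1 /\ ((s * b)%:E < rho y w)%E].
  case: (boolP (0 < s < 1)) => [s01|sn].
    rewrite (_ : [set _ | _] = [set w | ((s * b)%:E < rho y w)%E]); last by apply/seteqP; split => w // [].
    by rewrite -[X in measurable X]setTI; apply: emeasurable_fun_lt.
  by rewrite (_ : [set _ | _] = set0)//; apply/seteqP; split => // w [].
have mU : measurable U by exact: mlev.
rewrite /level -/U -/V.
have w00 y : 0 <= width y by exact: nroot_ge0.
have [U0|U0] := eqVneq (lam m.+1 U) 0%E.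
  by rewrite U0 mule0 mule_ge0// lee_fin exprn_ge0.
have Une : U !=set0 by apply/set0P; apply: contraNneq U0 => ->; rewrite measure0.
have US : U `<=` slice shadow x.
  move=> w [/andP[s1 _] h]; have [l hl] : slice (slice X x) w !=set0.
    apply/set0P; apply: contraTneq h => h; rewrite /rho h measure0 -leNgt lee_fin.
    by rewrite mulr_ge0// ltW.
  by apply/shadowP; exists l.
have cS y : compact (slice shadow y) by apply: compact_slice; exact: compact_shadow.
have Ule : (lam m.+1 U <= (width x ^+ m.+1)%:E)%E.
  rewrite nrootK ?vol_ge0// -lam_vol//; apply: le_measure; rewrite ?inE//.
  exact: compact_measurable_rV.
have Ufin : lam m.+1 U = (fine (lam m.+1 U))%:E.
  by rewrite fineK// ge0_fin_numE// (le_lt_trans Ule)// ltry.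
pose u := nroot m (fine (lam m.+1 U)).
have u0 : 0 <= u by exact: nroot_ge0.
have uE : lam m.+1 U = (u ^+ m.+1)%:E by rewrite nrootK// fine_ge0.
have uw : u <= width x.
  apply: (nroot_le _ _ (w00 x)); first exact: fine_ge0.
  by rewrite -lee_fin -Ufin.
clearbody u.
have [r' _ hr'] := compact_enorm compact_shadow.
have bU y w : slice shadow y w -> enorm w <= r' by exact: slice_bounded.
have bm : (((t * u + (1 - t) * width x0) ^+ m.+1)%:E <= lam m.+1 V)%E.
  have bd a y w : 0 < a -> a < 1 -> slice shadow y w -> enorm (a *: w) <= r'.
    move=> a0 a1 /bU; apply: le_trans; rewrite enormZ gtr0_norm//.
    by rewrite ler_piMl ?enorm_ge0// ltW.
  have mDU : measurable (dilate t U).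
    by rewrite dilateE//; apply: (measurable_preim (f := fun x : 'rV[R]_m.+1 => t^-1 *: x)) => //; exact: measurable_scalemx.
  apply: (@brunn_minkowski R m (dilate t U) (dilate (1 - t) (slice shadow x0)) V r') => //.
  - by apply: compact_measurable_rV; exact: compact_dilate.
  - exact: mlev.
  - by case: Une => w Uw; exists (t *: w); exists w.
  - by case: x00 => w hw; exists ((1 - t) *: w); exists w.
  - by move=> _ [w /US hw <-]; exact: bd hw.
  - by move=> _ [w hw <-]; apply: bd hw => //; rewrite ltrBlDr ltrDl.
  - move=> _ _ [w [s01 hw] <-] [w0 hw0 <-]; split => //.
    apply: (lt_le_trans _ (rho_shrink x w t0 (ltW t1) hw0)).
    by rewrite mulrCA EFinM lte_pmul2l ?lte_fin ?exprn_gt0.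
  - exact: (mulr_ge0 (ltW t0) u0).
  - exact: (mulr_ge0 (ltW s0) (w00 x0)).
  - by rewrite lam_dilate// uE exprMn.
  - rewrite lam_dilate//; last exact: compact_measurable_rV.
    by rewrite lam_vol// exprMn nrootK ?vol_ge0.
rewrite uE; apply: (le_trans _ (lee_wpmul2l _ bm)); last by rewrite lee_fin exprn_ge0.
rewrite -!EFinM lee_fin -!exprMn; apply: lerXn2r; rewrite ?nnegrE.
- exact: (mulr_ge0 (addr_ge0 (mulr_ge0 (ltW t0) (w00 x)) (mulr_ge0 (ltW s0) (w00 x0))) u0).
- exact: (mulr_ge0 (w00 x) (addr_ge0 (mulr_ge0 (ltW t0) u0) (mulr_ge0 (ltW s0) (w00 x0)))).
exact: mix_le (ltW t1) (w00 x0) uw.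
Qed.

(* Brunn-Minkowski for the level sets of the measure of the fibres over R^m. *)
Lemma marg_shrink t x x0 : 0 < t -> t < 1 -> slice shadow x0 !=set0 ->
  t ^+ j * (t * width x + (1 - t) * width x0) ^+ m.+1 * marg x <=
  width x ^+ m.+1 * marg (t *: x + (1 - t) *: x0).
Proof.
move=> t0 t1 x00; set x' := t *: x + (1 - t) *: x0.
have s0 : 0 < 1 - t by rewrite subr_gt0.
have [r _ hr] := compact_enorm cX.
have bs y w l : slice (slice X y) w l -> enorm l <= r.
  by move=> h; apply: slice_bounded h; exact: slice_bounded.
pose D : set 'rV[R]_j := [set l | enorm l <= r].
have mD : measurable D by apply: closed_measurable_rV; exact: closed_enorm.
have fD : lam j D \is a fin_num by apply: (@lam_bounded_fin _ _ _ r).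
pose c := fine (lam j D) + 1.
have c0 : 0 < c by rewrite ltr_wpDl// fine_ge0.
have hc y w : (0 <= rho y w <= c%:E)%E.
  rewrite measure_ge0 /=; apply: (@le_trans _ _ (lam j D)).
    apply: le_measure; rewrite ?inE//; last by move=> l /bs.
    by apply: compact_measurable_rV; do 2!apply: compact_slice.
  by rewrite -[leLHS](fineK fD) lee_fin lerDl.
pose c' := t ^+ j * c.
have c'0 : 0 < c' by rewrite mulr_gt0// exprn_gt0.
have k10 : 0 <= (t * width x + (1 - t) * width x0) by rewrite addr_ge0// mulr_ge0 ?nroot_ge0// ltW.
have wx0 : 0 <= width x := nroot_ge0 m (vol (slice shadow x)).
pose IL y b := (\int[mu]_s level (lam m.+1) b (rho y) s)%E.
have l1 : IL x c = (marg x / c)%:E.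
  have := @layer_eq _ _ _ (lam m.+1) c (rho x) c0 (mrho x) (hc x).
  rewrite -margE mulrC EFinM => <-.
  by rewrite muleA -EFinM mulVf ?mul1e// gt_eqF.
have l2 : (IL x' c' <= (marg x' / c')%:E)%E.
  rewrite mulrC EFinM lee_pdivlMl// margE; exact: layer_le.
have mlev y b : measurable_fun setT (level (lam m.+1) b (rho y) : measurableTypeR R -> \bar R) by exact: measurable_level.
have lev0 y b s : (0 <= level (lam m.+1) b (rho y) s)%E by exact: measure_ge0.
set k1 := t * width x + _ in k10 *.
have l3 : ((k1 ^+ m.+1)%:E * IL x c <= (width x ^+ m.+1)%:E * IL x' c')%E.
  apply: (integral_scale_le (exprn_ge0 _ k10) (exprn_ge0 _ wx0) (mlev x c) (mlev x' c') (lev0 x c) (lev0 x' c')) => s.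
  exact: marg_level.
have : ((k1 ^+ m.+1 * (marg x / c))%:E <= (width x ^+ m.+1 * (marg x' / c'))%:E)%E.
  rewrite EFinM -l1; apply: (le_trans l3); rewrite EFinM; apply: lee_wpmul2l => //.
  by rewrite lee_fin exprn_ge0.
rewrite lee_fin /c' => h.
have tj0 : 0 < t ^+ j by rewrite exprn_gt0.
have := ler_wpM2l (ltW c'0) h; rewrite /c'.
have -> : t ^+ j * c * (k1 ^+ m.+1 * (marg x / c)) = t ^+ j * k1 ^+ m.+1 * marg x.
  by field; rewrite gt_eqF.
have -> : t ^+ j * c * (width x ^+ m.+1 * (marg x' / (t ^+ j * c))) = width x ^+ m.+1 * marg x'.
  by field; rewrite !gt_eqF.
by [].
Qed.
End Marginals.
End Slices.

Section Marginal_integrals.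
Context {R : realType}.
Local Notation lam n := (@lebesgue_rV R n).

Lemma integral_preim d1 d2 (T1 : measurableType d1) (T2 : measurableType d2)
    (m1 : {measure set T1 -> \bar R}) (m2 : {measure set T2 -> \bar R}) (phi : T1 -> T2) (f : T2 -> \bar R) :
  measurable_fun setT phi -> (forall A, measurable A -> m2 A = m1 (phi @^-1` A)) ->
  measurable_fun setT f -> (forall x, 0 <= f x)%E -> (\int[m2]_x f x = \int[m1]_x f (phi x))%E.
Proof.
move=> mphi h mf f0.
have := @ge0_integral_pushforward _ _ _ _ R phi mphi m1 setT f measurableT mf (fun x _ => f0 x).
rewrite preimage_setT => <-; apply: eq_measure_integral => A mA _; exact: h.
Qed.

Lemma integral_affine k (t : R) (a : 'rV[R]_k) (G : 'rV[R]_k -> \bar R) : 0 < t ->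
  measurable_fun setT G -> (forall x, 0 <= G x)%E ->
  ((t ^+ k)%:E * \int[lam k]_x G (t *: x + a)%R = \int[lam k]_x G x)%E.
Proof.
move=> t0 mG G0; pose T (x : 'rV[R]_k) := t *: x + a.
have mT : measurable_fun setT T.
  by apply: measurable_addmx; [exact: measurable_scalemx|exact: measurable_cst].
have tk0 : 0 <= t ^+ k by rewrite exprn_ge0// ltW.
rewrite (integral_preim (m2 := lam k) (m1 := mscale (NngNum tk0) (lam k)) mT _ mG G0); last first.
  move=> A mA.
  have mA' : measurable ((fun x : 'rV[R]_k => x + a) @^-1` A).
    exact: measurable_shift.
  by rewrite -[LHS](lam_shift a mA) -(lam_scale t0 mA').
rewrite ge0_integral_mscale//.
exact: (measurableT_comp mG mT).
Qed.

Lemma integral_marginal p q (X : set 'rV[R]_(p + q)) (l : 'rV[R]_q -> R) : measurable X ->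
  measurable_fun setT l -> (forall x, 0 <= l x) ->
  (\int[lam q]_x ((l x)%:E * lam p (slice X x)) = \int[lam (p + q)%N]_(z in X) (l (z *m lastmx (p + q) q))%:E)%E.
Proof.
move=> mX ml l0.
pose f (z : 'rV[R]_(p + q)) : \bar R := ((\1_X z)%:E * (l (z *m lastmx (p + q) q))%:E)%E.
have mf : measurable_fun setT f.
  apply: emeasurable_funM; first by apply/measurable_EFinP; exact: measurable_indic.
  apply/measurable_EFinP; exact: (measurableT_comp ml (@measurable_mulmx R _ _ _)).
have f0 z : (0 <= f z)%E by rewrite mule_ge0 ?lee_fin.
pose T := (fun z : 'rV[R]_p * 'rV[R]_q => row_mx z.1 z.2).
have mT : measurable_fun setT T by exact: measurable_row_mx.
transitivity (\int[lam (p + q)%N]_z f z)%E; last first.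
  rewrite [RHS]integral_mkcond; apply: eq_integral => z _.
  by rewrite /f indicE /patch; case: ifPn => _; rewrite ?mul1e ?mul0e.
have mfT : measurable_fun setT (f \o T) by exact: (measurableT_comp mf mT).
rewrite (integral_preim (m1 := (lam p \x lam q)%E) mT _ mf f0); last exact: lam_row_mx.
rewrite (@fubini_tonelli2 _ _ _ _ _ (lam p) (lam q) (f \o T) mfT (fun z => f0 (T z))).
apply: eq_integral => x _; rewrite /fubini_G /=.
rewrite (@integral_if_cst R _ _ (lam p) (slice X x) (l x)%:E) ?lee_fin//.
- by rewrite muleC.
- exact: meas_slice2.
- by move=> y Xy; rewrite /f /T /= indicE mem_set// mul1e row_lastmx.
- by move=> y Xy; rewrite /f /T /= indicE memNset// mul0e.
Qed.

Lemma bernoulli_ineq n (u : R) : -1 <= u -> 1 + n%:R * u <= (1 + u) ^+ n.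
Proof.
move=> u1; have u0 : 0 <= 1 + u by rewrite -lerBlDl sub0r.
elim: n => [|n IH]; first by rewrite mul0r addr0 expr0.
apply: (@le_trans _ _ ((1 + n%:R * u) * (1 + u))).
  rewrite -subr_ge0 (_ : _ - _ = n%:R * u ^+ 2); last by rewrite -natr1; ring.
  by rewrite mulr_ge0 ?sqr_ge0.
by rewrite exprSr ler_wpM2r.
Qed.
End Marginal_integrals.

(** * Approximate affine majorants of a concave function *)

Section Majorant.
Context {R : realType}.
Variables (k : nat) (sh : set 'rV[R]_k) (w : 'rV[R]_k -> R).
Hypotheses (w_ge0 : forall x, 0 <= w x)
  (concave : forall x y t, 0 <= t -> t <= 1 -> sh x -> sh y ->
     sh (t *: x + (1 - t) *: y) /\ t * w x + (1 - t) * w y <= w (t *: x + (1 - t) *: y))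
  (ball_sh : exists2 r, 0 < r & forall x, enorm x <= r -> sh x)
  (bounded_sh : exists2 r, 0 < r & forall x, sh x -> enorm x <= r).

(** The origin is a convex combination of [x], with weight 1/(1+t), and of -x/t, which still lies in
    the inner ball; concavity at 0 bounds [w x]. *)
Lemma concave_usc : exists2 r, 0 < r & forall t x, 0 < t -> sh x -> enorm x <= t * r -> w x <= (1 + t) * w 0.
Proof.
have [r r0 hr] := ball_sh; exists r => // t x t0 hx xr.
have t1 : 0 < 1 + t by rewrite addr_gt0.
have hy : sh (- t^-1 *: x).
  by apply: hr; rewrite enormZ normrN gtr0_norm ?invr_gt0// ler_pdivrMl.
have a0 : 0 <= (1 + t)^-1 by rewrite invr_ge0 ltW.
have a1 : (1 + t)^-1 <= 1 by rewrite invf_le1// lerDl ltW.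
have [_] := concave a0 a1 hx hy.
have -> : (1 + t)^-1 *: x + (1 - (1 + t)^-1) *: (- t^-1 *: x) = 0.
  rewrite scalerA -scalerDl (_ : _ + _ = 0) ?scale0r//; field.
  by rewrite !gt_eqF.
move=> h; rewrite -ler_pdivrMl//; apply: le_trans h.
by rewrite lerDl mulr_ge0// subr_ge0.
Qed.

(* Separation of the hypograph of w from a point slightly above (0, w 0). *)
Lemma concave_majorant (e : R) : 0 < e -> exists v, forall x, sh x -> w x <= w 0 + e + dot x v.
Proof.
move=> e0; have [r r0 hr] := concave_usc; have [r' r'0 hr'] := bounded_sh.
have wb x : sh x -> w x <= (1 + r' / r) * w 0.
  move=> hx; apply: hr => //; first by rewrite divr_gt0.
  by rewrite divfK ?gt_eqF//; exact: hr'.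
pose H : set 'rV[R]_(k + 1) := [set z | exists x s, [/\ z = row_mx x s%:M, sh x, 0 <= s & s <= w x]].
have cH : cvx H.
  move=> _ _ t t0 t1 [x [s [-> hx s0 sx]]] [y [u [-> hy u0 uy]]].
  exists (t *: x + (1 - t) *: y), (t * s + (1 - t) * u); split.
  - rewrite !scale_row_mx add_row_mx; congr row_mx.
    by apply/matrixP => a b; rewrite !mxE !ord1 eqxx !mulr1n.
  - by have [] := concave t0 t1 hx hy.
  - by rewrite addr_ge0// mulr_ge0// subr_ge0.
  - apply: le_trans (concave t0 t1 hx hy).2.
    have t1' : 0 <= 1 - t by rewrite subr_ge0.
    exact: (lerD (ler_wpM2l t0 sx) (ler_wpM2l t1' uy)).
(* Makes [t * w 0] at most e / 2, so that over the ball of radius t r the hypograph stays e / 2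
   below the height of [q]. *)
pose t := e / (2%:R * (w 0 + 1)).
have w1 : 0 < w 0 + 1 by rewrite ltr_wpDl.
have t0 : 0 < t by rewrite divr_gt0// mulr_gt0.
have tw : t * w 0 <= e / 2%:R.
  rewrite /t invfM mulrA -mulrA ler_piMr//; first by rewrite divr_ge0// ltW.
  by rewrite ler_pdivrMl// mulr1 lerDl.
pose q : 'rV[R]_(k + 1) := row_mx 0 (w 0 + e)%:M.
have qE x s : row_mx x s%:M - q = row_mx x (s - (w 0 + e))%:M.
  by rewrite opp_row_mx add_row_mx subr0 -raddfB.
have enorm1 (s : R) : enorm (s%:M : 'rV[R]_1) = `|s|.
  by rewrite /enorm big_ord1 mxE eqxx mulr1n sqrtr_sqr.
(* A point of the hypograph is far from [q] either horizontally, by t r, or vertically, by e / 2. *)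
pose d := Num.min (t * r) (e / 2%:R).
have d0 : 0 < d by rewrite lt_min mulr_gt0//= divr_gt0.
have hd z : H z -> d <= enorm (z - q).
  move=> [x [s [-> hx s0 sx]]]; rewrite qE.
  case: (leP (enorm x) (t * r)) => xt.
    apply: (le_trans _ (enorm_row_le _ _).2); rewrite enorm1 ge_min; apply/orP; right.
    have h := hr t x t0 hx xt; rewrite mulrDl mul1r in h.
    rewrite ler0_norm; move: sx tw h; lra.
  apply: (le_trans _ (enorm_row_le _ _).1); rewrite ge_min; apply/orP; left; exact: ltW.
have hb z : H z -> enorm z <= r' + (1 + r' / r) * w 0.
  move=> [x [s [-> hx s0 sx]]].
  have -> : row_mx x s%:M = row_mx x 0 + row_mx 0 s%:M :> 'rV[R]_(k + 1) by rewrite add_row_mx addr0 add0r.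
  apply: (le_trans (enormD _ _)); rewrite enorm_row0; apply: lerD; first exact: hr'.
  have -> : enorm (row_mx (0 : 'rV[R]_k) s%:M) = s.
    apply/eqP; rewrite -(@eqrXn2 _ 2) ?enorm_ge0// enorm_row_mx enorm0 expr0n add0r enorm1.
    by rewrite real_normK// num_real.
  exact: le_trans sx (wb _ hx).
have [V [c c0 hV]] := separation cH d0 hd hb.
pose s := rsubmx V 0 0.
have dE x u : dot (row_mx x u%:M - q) V = dot x (lsubmx V) + (u - (w 0 + e)) * s.
  rewrite qE -[V in LHS]hsubmxK /dot big_split_ord /= big_ord1; congr (_ + _).
    by apply: eq_bigr => i _; rewrite !row_mxEl.
  by rewrite !row_mxEr [X in X * _]mxE eqxx mulr1n.
have h00 : sh 0 by have [r2 r20 h] := ball_sh; apply: h; rewrite enorm0 ltW.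
(* The hypograph contains (0, 0), straight below [q]; hence the separating functional decreases in
   the last coordinate and can be solved for it. *)
have s0 : s < 0.
  have : H (row_mx 0 0%:M) by exists 0, 0; split.
  move=> /hV; rewrite dE dot0l add0r sub0r => h; rewrite ltNge; apply/negP => s0.
  have : 0 <= (w 0 + e) * s by rewrite mulr_ge0// addr_ge0// ltW.
  move: h c0; rewrite mulNr; lra.
exists ((- s)^-1 *: lsubmx V) => x hx.
have : H (row_mx x (w x)%:M) by exists x, (w x); split.
move=> /hV; rewrite dE dotZr => h.
have ns : 0 < - s by rewrite oppr_gt0.
rewrite -lerBlDl ler_pdivlMl// mulrC mulrN.
by move: h c0; lra.
Qed.

End Majorant.

(** * The width inequality and the bound for the shadow *)

Section Core.
(** Both sides of the hypothesis agree at e = 0, and the conclusion compares their first-order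
    terms. Bernoulli replaces (1-e)^a by 1 - a e; the second-order loss a b G e^2 is kept below d e
    by the choice of e. *)
Lemma shrink_limit (R : realType) a (b I G : R) : 0 < b -> 0 <= I -> 0 <= G ->
  (forall e, 0 < e -> e < 1 -> b * e <= 1 -> (1 - e) ^+ a * ((1 - b * e) * I + b * e * G) <= I) ->
  b * G <= (a%:R + b) * I.
Proof.
move=> b0 I0 G0 h; apply/ler_addgt0Pr => d d0.
have a0 : 0 <= a%:R :> R by [].
pose M := a%:R * b * G + 1.
have M0 : 0 < M by rewrite ltr_wpDl// !mulr_ge0// ltW.
pose e := Num.min (2%:R^-1) (Num.min b^-1 (d / M)).
have e0 : 0 < e by rewrite !lt_min !invr_gt0 b0 divr_gt0// ltr0n.
have e1 : e < 1 by apply: (@le_lt_trans _ _ 2%:R^-1); [rewrite ge_min lexx|lra].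
have e2 : e <= b^-1 by rewrite !ge_min lexx orbT.
have e3 : e <= d / M by rewrite !ge_min lexx !orbT.
have be : b * e <= 1 by rewrite -ler_pdivlMl// mulr1.
have Me : M * e <= d by rewrite mulrC -ler_pdivlMr.
have h1 := h e e0 e1 be.
have h2 : 1 - a%:R * e <= (1 - e) ^+ a.
  by rewrite -mulrN; apply: bernoulli_ineq; rewrite lerN2 ltW.
have c0 : 0 <= (1 - b * e) * I + b * e * G.
  by rewrite addr_ge0// ?mulr_ge0 ?subr_ge0 ?(ltW b0) ?(ltW e0).
have h3 := le_trans (ler_wpM2r c0 h2) h1.
have h4 : 0 <= e * (a%:R * b * e * I) by rewrite !mulr_ge0// ltW.
have h5 : b * G * e <= ((a%:R + b) * I + d) * e.
  have h6 : 0 <= (d - M * e) * e by rewrite mulr_ge0 ?subr_ge0// ltW.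
  have h7 : 0 <= e * e by rewrite mulr_ge0// ltW.
  rewrite /M in h6.
  rewrite -subr_ge0; rewrite -subr_ge0 in h3.
  have -> : ((a%:R + b) * I + d) * e - b * G * e = 
    (I - (1 - a%:R * e) * ((1 - b * e) * I + b * e * G)) + (d - (a%:R * b * G + 1) * e) * e + e * (a%:R * b * e * I) + e * e by ring.
  exact: (addr_ge0 (addr_ge0 (addr_ge0 h3 h6) h4) h7).
by rewrite -(ler_pM2r e0).
Qed.

(** Multiplication by c raises the power of t a + (1-t) b to m + 2. Against a^(m+1), Bernoulli
    applied to (1-t)(b-a)/a leaves an expression affine in a, which can be integrated. *)
Lemma shrink_bernoulli (R : realType) j m (t a b c u v : R) : 0 < t -> t < 1 -> 0 <= a -> 0 < b -> 0 <= c -> 0 <= u -> 0 <= v ->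
  t ^+ j * (t * a + (1 - t) * b) ^+ m.+1 * u <= a ^+ m.+1 * v -> t * a + (1 - t) * b <= c ->
  t ^+ j * (a + m.+2%:R * ((1 - t) * (b - a))) * u <= c * v.
Proof.
move=> t0 t1 a0 b0 c0 u0 v0 h1 h2.
move: u0; rewrite le_eqVlt => /predU1P[<-|u0]; first by rewrite mulr0 mulr_ge0.
have s0 : 0 < 1 - t by rewrite subr_gt0.
have tj : 0 < t ^+ j by rewrite exprn_gt0.
have d0 : 0 < t * a + (1 - t) * b by rewrite ltr_wpDl ?mulr_gt0// mulr_ge0// ltW.
have ap : 0 < a.
  rewrite lt_neqAle a0 andbT; apply/eqP => a00.
  move: h1; rewrite -a00 expr0n mul0r leNgt mulr_gt0// mulr_gt0// exprn_gt0//.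
  by rewrite mulr0 add0r mulr_gt0.
have am : 0 < a ^+ m.+1 by rewrite exprn_gt0.
rewrite -(ler_pM2l am).
apply: (@le_trans _ _ ((t * a + (1 - t) * b) * (a ^+ m.+1 * v))); last first.
  by rewrite [leRHS]mulrCA; apply: ler_wpM2r => //; rewrite mulr_ge0// ltW.
apply: (le_trans _ (ler_wpM2l (ltW d0) h1)).
have -> : (t * a + (1 - t) * b) * (t ^+ j * (t * a + (1 - t) * b) ^+ m.+1 * u) =
  (t ^+ j * u) * (t * a + (1 - t) * b) ^+ m.+2 by rewrite [_ ^+ m.+2]exprS; ring.
have -> : a ^+ m.+1 * (t ^+ j * (a + m.+2%:R * ((1 - t) * (b - a))) * u) =
  (t ^+ j * u) * (a ^+ m.+2 * (1 + m.+2%:R * ((1 - t) * (b - a) / a))).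
  by rewrite [a ^+ m.+2]exprS; field; rewrite gt_eqF.
rewrite ler_pM2l ?mulr_gt0//.
have -> : t * a + (1 - t) * b = a * (1 + (1 - t) * (b - a) / a) by field; rewrite gt_eqF.
rewrite exprMn ler_pM2l ?exprn_gt0//; apply: bernoulli_ineq.
rewrite ler_pdivlMr// mulN1r -subr_ge0 (_ : _ - - _ = t * a + (1 - t) * b); last by ring.
exact: ltW.
Qed.

Context {R : realType}.
Local Notation lam n := (@lebesgue_rV R n).

Lemma measurable_dot n (v : 'rV[R]_n) : measurable_fun setT (fun x : 'rV[R]_n => dot x v).
Proof.
apply: (eq_measurable_fun (fun x : 'rV[R]_n => (x *m v^T) ord0 ord0 : measurableTypeR R)).
  by move=> x _; rewrite dotE.
exact: (measurableT_comp (@measurable_rV_coor R 1 ord0) (@measurable_mulmx R _ _ _)).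
Qed.

Lemma integrable_dot n (A : set 'rV[R]_n) v : compact A -> (lam n).-integrable A (fun z => (dot z v)%:E).
Proof.
move=> cA; have [r r0 hr] := compact_enorm cA.
apply: measurable_bounded_integrable; first exact: compact_measurable_rV.
- by rewrite /= lam_vol// ltry.
- by apply: measurable_funS (@measurable_dot _ v).
exists (r * enorm v); split; first exact: num_real.
move=> M rM z Az /=; apply: (le_trans _ (ltW rM)); rewrite ler_norml -lerNl -dotNl.
have h (y : 'rV[R]_n) : enorm y <= r -> dot y v <= r * enorm v.
  by move=> yr; apply: (le_trans (cauchy_schwarz _ _)); apply: ler_wpM2r => //; exact: enorm_ge0.
by rewrite !h// ?enormN; exact: hr.
Qed.

Variables (j m k : nat) (X : set 'rV[R]_((j + m.+1) + k)).
Hypotheses (bX : body X)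
  (hc : forall v, (\int[lam ((j + m.+1) + k)%N]_(z in X) (dot z v)%:E = 0)%E).

Let cX : compact X. Proof. by case: bX. Qed.
Let vX : cvx X. Proof. by case: bX. Qed.
Let sh x := slice (shadow X) x !=set0.
Let w x := width X x.
Let f x := marg X x.

Let w_ge0 x : 0 <= w x. Proof. exact: nroot_ge0. Qed.
Let f_ge0 x : 0 <= f x. Proof. exact: vol_ge0. Qed.

Let shP x : slice X x !=set0 -> sh x.
Proof.
by move=> [y Xy]; exists (rsubmx y); apply/shadowP; exists (lsubmx y); rewrite hsubmxK.
Qed.

Let sh_pr z : X z -> sh (z *m lastmx (j + m.+1 + k) k).
Proof.
rewrite -[z]hsubmxK row_lastmx => Xz; apply: shP; exists (lsubmx z); exact: Xz.
Qed.

Let f0 x : ~ sh x -> f x = 0.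
Proof.
move=> h; rewrite /f /marg (_ : slice X x = set0) ?/vol ?measure0//.
by apply/seteqP; split => // y Xy; apply: h; apply: shP; exists y.
Qed.

Let concave x y t : 0 <= t -> t <= 1 -> sh x -> sh y -> t * w x + (1 - t) * w y <= w (t *: x + (1 - t) *: y).
Proof. exact: width_concave. Qed.

Let ball_sh : exists2 r, 0 < r & forall x, enorm x <= r -> sh x.
Proof.
have [_ _ [r r0 hr]] := bX; exists r => // x xr; exists 0; apply/shadowP; exists 0; apply: hr.
rewrite row_mx0; apply: le_trans xr; rewrite le_eqVlt; apply/orP; left.
by rewrite -(@eqrXn2 _ 2) ?enorm_ge0// enorm_row_mx enorm0 expr0n add0r.
Qed.

Let bounded_sh : exists2 r, 0 < r & forall x, sh x -> enorm x <= r.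
Proof.
have [r r0 hr] := compact_enorm (compact_shadow cX); exists r => // x [u /hr].
by apply: le_trans; exact: (enorm_row_le u x).2.
Qed.

Let width_majorant (e : R) : 0 < e -> exists v, forall x, sh x -> w x <= w 0 + e + dot x v.
Proof.
move=> e0; apply: (@concave_majorant R k sh w w_ge0 _ ball_sh bounded_sh e e0) => x y t t0 t1 hx hy; split; last exact: concave.
case: hx hy => a ha [b hb]; exists (t *: a + (1 - t) *: b); exact: slice_shadow_cvx.
Qed.

Let measurable_f : measurable_fun setT f.
Proof.
apply: (measurableT_comp (fine_measurable measurableT)); apply: measurable_slice2.
exact: compact_measurable_rV.
Qed.

Let measurable_w : measurable_fun setT w.
Proof.
apply: (measurableT_comp (measurable_powR _)).
apply: (measurableT_comp (fine_measurable measurableT)); apply: measurable_slice2.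
apply: compact_measurable_rV; exact: compact_shadow.
Qed.

Let fE x : (f x)%:E = lam (j + m.+1)%N (slice X x).
Proof. by rewrite lam_vol//; exact: compact_slice. Qed.

Lemma integral_marg : (\int[lam k]_x (f x)%:E = (vol X)%:E)%E.
Proof.
rewrite -lam_vol// lam_fubini2; last exact: compact_measurable_rV.
by apply: eq_integral => x _; rewrite fE.
Qed.

(* Jensen's inequality for the concave function w and the density f, whose
   barycenter is 0. *)
Lemma integral_width_le : (\int[lam k]_x (w x * f x)%:E <= (w 0 * vol X)%:E)%E.
Proof.
have mX : measurable X by exact: compact_measurable_rV.
have vX0 : 0 <= vol X by exact: vol_ge0.
apply/lee_addgt0Pr => e' e'0.
pose e := e' / (vol X + 1).
have vX1 : 0 < vol X + 1 by rewrite ltr_wpDl.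
have e0 : 0 < e by rewrite divr_gt0.
have [v hv] := width_majorant e0.
(* The maximum with 0 makes Tonelli applicable. Over points of [X] it is inert: there the affine
   function dominates [w], which is nonnegative. *)
pose l x := Num.max 0 (w 0 + e + dot x v).
have ml : measurable_fun setT l.
  apply: measurable_maxr; first exact: measurable_cst.
  apply: measurable_funD; [exact: measurable_cst|exact: measurable_dot].
have l0 x : 0 <= l x by rewrite le_max lexx.
apply: (@le_trans _ _ (\int[lam k]_x ((l x)%:E * lam (j + m.+1)%N (slice X x)))%E).
  apply: ge0_le_integral => //.
  - by move=> x _; rewrite lee_fin mulr_ge0.
  - by apply/measurable_EFinP; exact: measurable_funM.
  - apply: emeasurable_funM; [exact/measurable_EFinP|exact: measurable_slice2].
  - move=> x _; rewrite -fE -EFinM lee_fin; have [hx|/f0 ->] := pselect (sh x); last by rewrite !mulr0.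
    by apply: ler_wpM2r => //; rewrite le_max; apply/orP; right; exact: hv.
rewrite integral_marginal//.
pose u := v *m (lastmx ((j + m.+1) + k) k)^T.
have -> : (\int[lam (j + m.+1 + k)%N]_(z in X) (l (z *m lastmx (j + m.+1 + k) k))%:E =
   \int[lam (j + m.+1 + k)%N]_(z in X) ((w 0 + e)%:E + (dot z u)%:E))%E.
  apply: eq_integral => z; rewrite inE => Xz; rewrite -EFinD /u -dot_mulmx; congr (_%:E).
  apply/max_idPr; apply: (le_trans (w_ge0 (z *m lastmx (j + m.+1 + k) k))); apply: hv.
  exact: sh_pr.
have Xfin : (lam (j + m.+1 + k)%N X < +oo)%E by rewrite lam_vol// ltry.
rewrite integralD//; last 2 first.
- apply: (@measurable_bounded_integrable _ _ _ _ (cst (w 0 + e))) => //.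
  by exists `|w 0 + e|; split; [exact: num_real|move=> M /ltW hM z _].
- exact: integrable_dot.
have -> : (\int[lam (j + m.+1 + k)%N]_(_ in X) (w 0 + e)%:E = (w 0 + e)%:E * (vol X)%:E)%E.
  by rewrite integral_cst//; congr (_ * _)%E; exact: lam_vol.
rewrite hc adde0 -EFinM -EFinD lee_fin mulrDl lerD2l /e.
by rewrite mulrAC ler_pdivrMr// ler_pM2l// lerDl.
Qed.

Lemma width_marg_shrink t x x0 : 0 < t -> t < 1 -> sh x0 -> 0 < w x0 ->
  t ^+ j * (w x + m.+2%:R * ((1 - t) * (w x0 - w x))) * f x <= w (t *: x + (1 - t) *: x0) * f (t *: x + (1 - t) *: x0).
Proof.
move=> t0 t1 hx0 w0; set x' := t *: x + (1 - t) *: x0.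
have [hx|/f0 ->] := pselect (sh x); last by rewrite mulr0; exact: (mulr_ge0 (w_ge0 x') (f_ge0 x')).
have h1 : t ^+ j * (t * w x + (1 - t) * w x0) ^+ m.+1 * f x <= w x ^+ m.+1 * f x' := marg_shrink cX vX x t0 t1 hx0.
exact: (shrink_bernoulli t0 t1 (w_ge0 x) w0 (w_ge0 x') (f_ge0 x) (f_ge0 x') h1 (concave (ltW t0) (ltW t1) hx hx0)).
Qed.

Let mwf : measurable_fun setT (fun x => (w x * f x)%:E).
Proof. by apply/measurable_EFinP; exact: measurable_funM. Qed.

Let wf0 x : (0 <= (w x * f x)%:E)%E.
Proof. by rewrite lee_fin; exact: (mulr_ge0 (w_ge0 x) (f_ge0 x)). Qed.

(** The pointwise inequality is integrated over x. The substitution x -> t x + (1-t) x0 contributes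
    t^k, which joins the factor t^j of the fibres. *)
Lemma integral_shrink t x0 I : 0 < t -> t < 1 -> m.+2%:R * (1 - t) <= 1 -> sh x0 -> 0 < w x0 ->
  (\int[lam k]_x (w x * f x)%:E = I%:E)%E ->
  t ^+ (k + j) * ((1 - m.+2%:R * (1 - t)) * I + m.+2%:R * (1 - t) * w x0 * vol X) <= I.
Proof.
move=> t0 t1 tm hx0 w0 IE.
have mff : measurable_fun setT (fun x => (f x)%:E) by exact/measurable_EFinP.
have ff0 x : (0 <= (f x)%:E)%E by rewrite lee_fin; exact: f_ge0.
pose a := t ^+ j * (1 - m.+2%:R * (1 - t)); pose b := t ^+ j * (m.+2%:R * (1 - t) * w x0).
have tj0 : 0 <= t ^+ j by rewrite exprn_ge0// ltW.
have a0 : 0 <= a by rewrite mulr_ge0// subr_ge0.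
have b0 : 0 <= b.
  apply: mulr_ge0 => //; apply: mulr_ge0; last exact: ltW.
  by rewrite mulr_ge0// subr_ge0 ltW.
have e1 : (\int[lam k]_x (a%:E * (w x * f x)%:E + b%:E * (f x)%:E) = (a * I + b * vol X)%:E)%E.
  rewrite ge0_integralD//.
  - by rewrite !ge0_integralZl// IE integral_marg -!EFinM -EFinD.
  - by move=> x _; apply: mule_ge0; [rewrite lee_fin|exact: wf0].
  - exact: measurable_funeM.
  - by move=> x _; apply: mule_ge0; [rewrite lee_fin|exact: ff0].
  - exact: measurable_funeM.
have mT : measurable_fun setT (fun x : 'rV[R]_k => t *: x + (1 - t) *: x0).
  by apply: measurable_addmx; [exact: measurable_scalemx|exact: measurable_cst].
have e2 := integral_affine ((1 - t) *: x0) t0 mwf wf0.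
rewrite -lee_fin -IE -e2.
apply: (@le_trans _ _ ((t ^+ k)%:E * (a * I + b * vol X)%:E)%E).
  by rewrite -EFinM lee_fin exprD /a /b le_eqVlt; apply/orP; left; apply/eqP; ring.
apply: lee_wpmul2l; first by rewrite lee_fin exprn_ge0// ltW.
rewrite -e1; apply: ge0_le_integral => //.
- move=> x _; apply: adde_ge0; (apply: mule_ge0; first by rewrite lee_fin); [exact: wf0|exact: ff0].
- by apply: emeasurable_funD; exact: measurable_funeM.
- exact: (measurableT_comp mwf mT).
move=> x _; have := width_marg_shrink x t0 t1 hx0 w0; rewrite -!EFinM -EFinD lee_fin.
have id u v q B p s : q * (1 - B * s) * (u * p) + q * (B * s * v) * p = q * (u + B * (s * (v - u))) * p :> R by ring.
by rewrite id.
Qed.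

(* Letting t tend to 1 in integral_shrink. *)
Lemma width_max x : w x <= ((k + j)%:R + m.+2%:R) / m.+2%:R * w 0.
Proof.
have C0 : 0 <= ((k + j)%:R + m.+2%:R) / m.+2%:R :> R by rewrite divr_ge0// addr_ge0.
have := w_ge0 x; rewrite le_eqVlt => /predU1P[<-|wx0]; first exact: (mulr_ge0 C0 (w_ge0 0)).
have hx : sh x.
  apply: contrapT => h; move: wx0; rewrite /w /width (_ : slice (shadow X) x = set0).
    by rewrite /vol measure0 /= /nroot powR0 ?ltxx// invr_eq0 pnatr_eq0.
  by apply/seteqP; split => // y hy; apply: h; exists y.
pose I := fine (\int[lam k]_y (w y * f y)%:E)%E.
have IE : (\int[lam k]_y (w y * f y)%:E = I%:E)%E.
  rewrite fineK// ge0_fin_numE; last by apply: integral_ge0 => y _; exact: wf0.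
  by apply: (le_lt_trans integral_width_le); rewrite ltry.
have I0 : 0 <= I by rewrite -lee_fin -IE; apply: integral_ge0 => y _; exact: wf0.
have I1 : I <= w 0 * vol X by rewrite -lee_fin -IE; exact: integral_width_le.
have V0 : 0 < vol X.
  have [_ _ [r r0 hr]] := bX; rewrite -lte_fin -lam_vol//.
  apply: (@lam_ball_gt0 R _ 0 r) => //; first exact: compact_measurable_rV.
  by move=> y; rewrite subr0; exact: hr.
have m0 : 0 < m.+2%:R :> R by rewrite ltr0n.
have := @shrink_limit R (k + j) m.+2%:R I (w x * vol X) m0 I0 (mulr_ge0 (ltW wx0) (ltW V0)).
move=> h; have {}h : m.+2%:R * (w x * vol X) <= ((k + j)%:R + m.+2%:R) * I.
  apply: h => e e0 e1 em.
  have t0 : 0 < 1 - e by rewrite subr_gt0.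
  have t1 : 1 - e < 1 by rewrite gtrBl.
  have := integral_shrink t0 t1 _ hx wx0 IE; rewrite subKr mulrA => h; exact: h.
have {}h : m.+2%:R * (w x * vol X) <= ((k + j)%:R + m.+2%:R) * (w 0 * vol X).
  by apply: (le_trans h); apply: ler_wpM2l => //; rewrite addr_ge0.
move: h; rewrite !mulrA ler_pM2r// => h.
by rewrite mulrAC ler_pdivlMr// mulrC.
Qed.

Lemma vol_slice_max x : vol (slice (shadow X) x) <= (((k + j)%:R + m.+2%:R) / m.+2%:R) ^+ m.+1 * vol (slice (shadow X) 0).
Proof.
rewrite -(nrootK m (vol_ge0 (slice (shadow X) x))) -[in leRHS](nrootK m (vol_ge0 (slice (shadow X) 0))) -exprMn.
apply: lerXn2r (width_max x); rewrite nnegrE; first exact: w_ge0.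
apply: mulr_ge0 (w_ge0 0); by rewrite divr_ge0// addr_ge0.
Qed.

(** The bound by the central slice is integrated over the projection of [X] to the last [k]
    coordinates, outside which the slices of the shadow are empty. *)
Lemma vol_shadow_le : vol (shadow X) <=
  (((k + j)%:R + m.+2%:R) / m.+2%:R) ^+ m.+1 * vol (slice (shadow X) 0) * vol (img (lastmx ((j + m.+1) + k) k) X).
Proof.
set C := _ ^+ m.+1; pose P := img (lastmx ((j + m.+1) + k) k) X.
have cS := compact_shadow cX; have cP : compact P by exact: compact_img.
have C0 : 0 <= C * vol (slice (shadow X) 0).
  by rewrite mulr_ge0 ?vol_ge0// exprn_ge0// divr_ge0// addr_ge0.
rewrite -lee_fin -lam_vol// lam_fubini2; last exact: compact_measurable_rV.
have mP : measurable P by exact: compact_measurable_rV.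
rewrite mulrC EFinM -(lam_vol cP).
pose g x : \bar R := (\1_P x * (C * vol (slice (shadow X) 0)))%:E.
rewrite -(@integral_if_cst R _ _ (lam k) P _ g) ?lee_fin//; last 2 first.
- by move=> x Px; rewrite /g indicE mem_set// mul1r.
- by move=> x Px; rewrite /g indicE memNset// mul0r.
have mg : measurable_fun setT g.
  by apply/measurable_EFinP; apply: measurable_funM; [exact: measurable_indic|exact: measurable_cst].
apply: ge0_le_integral => //.
- by apply: measurable_slice2; exact: compact_measurable_rV.
move=> x _; rewrite -[X in (lam _ X <= _)%E]/(slice (shadow X) x).
have [Px|Px] := pselect (P x).
  rewrite /g indicE mem_set// mul1r lam_vol ?lee_fin; last exact: compact_slice.
  exact: vol_slice_max.
have -> : slice (shadow X) x = set0.
  apply/seteqP; split => // y /shadowP[l Xl]; apply: Px.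
  by exists (row_mx (row_mx l y) x) => //; rewrite row_lastmx.
by rewrite measure0 lee_fin; apply: mulr_ge0.
Qed.
End Core.

(** * Centered bodies contain a ball around the origin *)

Section Centered.
Context {R : realType}.
Local Notation lam n := (@lebesgue_rV R n).

(* Unlike centered, this form is visibly invariant under rotations. *)
Definition balanced n (X : set 'rV[R]_n) : Prop :=
  forall v, (\int[lam n]_(z in X) (dot z v)%:E = 0)%E.

Lemma convex_body_ball n (K : set 'rV[R]_n) : convex_body K ->
  [/\ compact K, cvx K & exists p, exists2 r, 0 < r & forall x, enorm (x - p) <= r -> K x].
Proof.
move=> [cK vK [p]]; rewrite /interior => /nbhs_ballP[r /= r0 hr]; split => //.
  exact: convex_set_cvx.
exists p, (r / 2%:R); first by rewrite divr_gt0.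
move=> x xp; apply: hr; rewrite -ball_normE /= distrC; apply: (le_lt_trans (sup_enorm _)).
apply: (le_lt_trans xp); rewrite ltr_pdivrMr//; lra.
Qed.

Lemma centered_balanced n (K : set 'rV[R]_n) : convex_body K -> centered K -> balanced K.
Proof.
move=> bK; have [cK vK [p [r r0 hr]]] := convex_body_ball bK.
have K0 : 0 < vol K.
  rewrite -lte_fin -lam_vol//; apply: (@lam_ball_gt0 R _ p r) => //; exact: compact_measurable_rV.
move=> hc v.
have eE i (z : 'rV[R]_n) : dot z (delta_mx 0 i) = z ord0 i.
  rewrite /dot (bigD1 i)//= big1 => [|l li]; first by rewrite !mxE !eqxx mulr1 addr0.
  by rewrite !mxE (negbTE li) andbF mulr0.
have ie i : (lam n).-integrable K (fun z : 'rV[R]_n => (z ord0 i)%:E).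
  rewrite (_ : (fun z => _) = (fun z : 'rV[R]_n => (dot z (delta_mx 0 i))%:E)); first exact: integrable_dot.
  by apply/funext => z; rewrite eE.
have mK : measurable K by exact: compact_measurable_rV.
have hi i : (\int[lam n]_(z in K) (z ord0 i)%:E = 0)%E.
  have := congr1 (fun u : 'rV[R]_n => u ord0 i) hc; rewrite !mxE => /eqP.
  rewrite mulf_eq0 invr_eq0 -/(vol K) gt_eqF//= => /eqP h.
  by rewrite -[LHS]fineK; [congr (_%:E)|exact: integrable_fin_num].
transitivity (\int[lam n]_(z in K) (\sum_(i < n) (v ord0 i)%:E * (z ord0 i)%:E))%E.
  apply: eq_integral => z _; rewrite /dot -sumEFin; apply: eq_bigr => i _.
  by rewrite mulrC EFinM.
rewrite (integral_sum mK) => [|i]; last exact: integrableZl.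
by apply: big1 => i _; rewrite integralZl// hi mule0.
Qed.

(** If [y] is outside [K], a functional [v] is at least s = c + [dot y v] on [K], and at least s +
    (r/2) |v| on the smaller ball [B]. As [dot z v] has integral 0 over [K], it follows that -s >=
    kap |v|, with [kap] the product of r/2 and the volume ratio of [B] and [K]. This is impossible
    when |y| <= kap. *)
Lemma balanced_body n (K : set 'rV[R]_n) : convex_body K -> balanced K -> body K.
Proof.
move=> /convex_body_ball[cK vK [p [r r0 hr]]] hc; split => //.
have mK : measurable K by exact: compact_measurable_rV.
have K0 : 0 < vol K.
  by rewrite -lte_fin -lam_vol//; apply: (@lam_ball_gt0 R _ p r).
pose B := [set x : 'rV[R]_n | enorm (x - p) <= r / 2%:R].
have r2 : 0 < r / 2%:R by rewrite divr_gt0.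
have BK : B `<=` K by move=> x /= h; apply: hr; apply: (le_trans h); rewrite ler_pdivrMr//; lra.
have mB : measurable B.
  apply: (@measurable_shift _ _ (- p) [set x | enorm x <= r / 2%:R]).
  by apply: closed_measurable_rV; exact: closed_enorm.
have fB : lam n B \is a fin_num.
  rewrite ge0_fin_numE ?measure_ge0//; apply: (@le_lt_trans _ _ (lam n K)); last by rewrite lam_vol// ltry.
  by apply: le_measure; rewrite ?inE.
pose b := fine (lam n B).
have b0 : 0 < b by rewrite -lte_fin fineK//; apply: (@lam_ball_gt0 R _ p (r / 2%:R)).
pose kap := r / 2%:R * b / vol K.
have kap0 : 0 < kap by rewrite divr_gt0// mulr_gt0.
exists kap => // y yk; apply: contrapT => /(compact_separation cK vK)[v [c c0 hv]].
pose s := c + dot y v.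
have hs z : K z -> s <= dot z v by move=> /hv; rewrite dotBl /s lerBrDr.
have v0 : 0 < enorm v.
  rewrite lt_neqAle enorm_ge0 andbT eq_sym; apply/eqP => /enorm_eq0 v0.
  have := hv p (hr p _); rewrite subrr enorm0 v0 dotC dot0l => /(_ (ltW r0)) h; lra.
have hB z : B z -> s + r / 2%:R * enorm v <= dot z v.
  move=> Bz; pose q := z - (r / 2%:R / enorm v) *: v.
  have Kq : K q.
    apply: hr; rewrite /q addrAC; apply: (le_trans (enormB _ _)).
    rewrite enormZ gtr0_norm ?divr_gt0// divfK ?gt_eqF//; have := Bz; rewrite /B /=; lra.
  have := hs q Kq; rewrite /q dotBl dotZl dotxx expr2 mulrA divfK ?gt_eqF// lerBrDr//.
have vK' : lam n K = (vol K)%:E by exact: lam_vol.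
have e1 : (\int[lam n]_(z in K) ((dot z v)%:E + (- s)%:E) = (- s * vol K)%:E)%E.
  rewrite integralD//; last 2 first.
  - exact: integrable_dot.
  - apply: (@measurable_bounded_integrable _ _ _ _ (cst (- s))) => //; first by rewrite /= vK' ltry.
    by exists `|- s|; split; [exact: num_real|move=> M /ltW hM z _].
  rewrite hc add0e EFinM -vK'; exact: integral_cst.
have h1 : r / 2%:R * enorm v * b <= - s * vol K.
  rewrite -lee_fin -e1 EFinM fineK//.
  apply: (@le_trans _ _ (\int[lam n]_(z in B) ((dot z v)%:E + (- s)%:E))%E).
    rewrite -[leLHS](@integral_cst _ _ _ (lam n) B mB).
    apply: ge0_le_integral => //.
    - by move=> z _; rewrite lee_fin mulr_ge0// ltW.
    - by apply/measurable_EFinP; apply: measurable_funD => //; apply: measurable_funS (measurable_dot v).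
    - by move=> z /hB h; rewrite -EFinD lee_fin lerBrDl.
  apply: ge0_subset_integral => //.
  - by apply/measurable_EFinP; apply: measurable_funD => //; apply: measurable_funS (measurable_dot v).
  - by move=> z /hs h; rewrite -EFinD lee_fin subr_ge0.
have h2 : kap * enorm v <= - s.
  rewrite /kap mulrAC ler_pdivrMr//; apply: le_trans h1; by rewrite mulrAC.
have h3 : - dot y v <= enorm y * enorm v by rewrite -dotNl -(enormN y); exact: cauchy_schwarz.
have h4 : enorm y * enorm v <= kap * enorm v by rewrite ler_pM2r.
move: h2 h3 h4 c0; rewrite /s; lra.
Qed.

Lemma balanced_img n (K : set 'rV[R]_n) g : compact K -> orth g -> balanced K -> balanced (img g K).
Proof.
move=> cK og hc v; have mg := @measurable_mulmx R _ _ g.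
have mI : measurable (img g K) by apply: compact_measurable_rV; exact: compact_img.
have pK : (fun x : 'rV[R]_n => x *m g) @^-1` (img g K) = K.
  apply/seteqP; split => [x [y Ky /(congr1 (mulmx^~ g^T))]|x Kx]; last by exists x.
  by rewrite !orthK// => <-.
have mv : measurable_fun setT (fun z : 'rV[R]_n => (dot z v)%:E).
  by apply/measurable_EFinP; exact: measurable_dot.
have e (x : 'rV[R]_n) : dot (x *m g) v = dot x (v *m g^T) by exact: dot_mulmx.
have iv : (lam n).-integrable ((fun x : 'rV[R]_n => x *m g) @^-1` (img g K)) ((fun z : 'rV[R]_n => (dot z v)%:E) \o (fun x : 'rV[R]_n => x *m g)).
  rewrite pK (_ : _ \o _ = (fun x : 'rV[R]_n => (dot x (v *m g^T))%:E)); first exact: integrable_dot.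
  by apply/funext => x /=; rewrite e.
have h := integral_pushforward mg mv iv mI.
rewrite pK in h; rewrite -(hc (v *m g^T)).
transitivity (\int[lam n]_(x in K) (dot (x *m g) v)%:E)%E; last by apply: eq_integral => x _; rewrite e.
rewrite -[RHS]h; apply: eq_measure_integral => A mA _; rewrite /pushforward [RHS]lam_orth//.
Qed.
End Centered.

(** * Averaging over rotations *)

Section Averaging.
Context {R : realType}.
Local Notation lam n := (@lebesgue_rV R n).
Local Notation omega := (@omega R).

Lemma body_slice0 p q (X : set 'rV[R]_(p + q)) : body X -> body (slice X 0).
Proof.
move=> [cX vX [r r0 hr]]; split; first exact: compact_slice.
  by move=> x y t t0 t1 hx hy; have := slice_cvx vX t0 t1 hx hy; rewrite !scaler0 addr0.
by exists r => // x xr; apply: hr; rewrite enorm_row0.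
Qed.

Definition rot0 p q (h : 'M[R]_p) : 'M[R]_(p + q) := block_mx h 0 0 1%:M.

Lemma slice_rot0 p q (h : 'M[R]_p) (X : set 'rV[R]_(p + q)) : slice (img (rot0 q h) X) 0 = img h (slice X 0).
Proof.
apply/seteqP; split => [y [z Xz]|_ [y Xy <-]]; last first.
  by exists (row_mx y 0) => //; rewrite mul_row_block !mulmx0 mul0mx !addr0.
rewrite -[z]hsubmxK mul_row_block !mulmx0 mulmx1 add0r addr0 => /eq_row_mx[<- z0].
by exists (lsubmx z) => //; rewrite /slice /= -z0 hsubmxK.
Qed.

Lemma rot0_lastmx p q (h : 'M[R]_p) : rot0 q h *m lastmx (p + q) q = lastmx (p + q) q.
Proof. by rewrite lastmx_colE mul_block_col !mulmx0 mul0mx mulmx1 !add0r. Qed.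

Lemma slice_shadow0 j m k (X : set 'rV[R]_((j + m.+1) + k)) :
  slice (shadow X) 0 = img (lastmx (j + m.+1) m.+1) (slice X 0).
Proof.
apply/seteqP; split => [w /shadowP[l Xl]|_ [y Xy <-]].
  by exists (row_mx l w) => //; rewrite row_lastmx.
by apply/shadowP; exists (lsubmx y); rewrite -{2}[y]hsubmxK row_lastmx hsubmxK.
Qed.

Section Fixed_body.
Variables (j m k : nat) (K : set 'rV[R]_((j + m.+1) + k)).
Hypotheses (bK : body K) (hK : balanced K).
Let n := ((j + m.+1) + k)%N.
Let C : R := (((k + j)%:R + m.+2%:R) / m.+2%:R) ^+ m.+1.
Let S (g : 'M[R]_((j + m.+1) + k)) := slice (img g K) 0.

Let C0 : 0 <= C.
Proof. by rewrite exprn_ge0// divr_ge0// addr_ge0. Qed.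

(** A rotation [h] of the first coordinates rotates the central section and leaves the projection to
    the last [k] coordinates unchanged, so the last factor is free of [h]. *)
Lemma proj_vol_rot (g : 'M[R]_((j + m.+1) + k)) (h : 'M[R]_(j + m.+1)) : orth g -> orth h ->
  proj_vol (m.+1 + k) K (g *m rot0 k h) <= C * proj_vol m.+1 (S g) h * proj_vol k K g.
Proof.
move=> og oh; have oH : orth (g *m rot0 k h) by apply: orthM => //; exact: orth_blockl.
have [cK _ _] := bK.
have h1 := vol_shadow_le (body_img oH bK) (balanced_img cK oH hK).
have e1 : slice (shadow (img (g *m rot0 k h) K)) 0 = img (h *m lastmx (j + m.+1) m.+1) (S g).
  by rewrite slice_shadow0 (img_mul g) slice_rot0 -img_mul.
by move: h1; rewrite e1 /shadow -!img_mul -[g *m _ *m lastmx _ k]mulmxA rot0_lastmx.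
Qed.

(** The inner average over [h] turns the section factor into [kub]; the outer one over [g] treats
    the last factor. The outer average is taken over one finite net, which commutes with the inner
    [mean] by linearity. On the left both averages collapse into one, since the asymptotic
    invariance of the net is uniform in the rotation [rot0 k h]. *)
Lemma kub_section_le b : (forall g, orth g -> kub m.+1 (S g) <= b) -> 0 <= b ->
  kub (m.+1 + k) K <= C * b * kub k K.
Proof.
move=> hb b0.
have [obp ucp] := proj_vol_ok (m.+1 + k) bK.
have [obq ucq] := proj_vol_ok k bK.
pose phi := proj_vol (m.+1 + k) K.
have orot h : orth h -> orth (rot0 k h : 'M[R]_(j + m.+1 + k)) by move=> oh; exact: orth_blockl.
have obr (g : 'M[R]_((j + m.+1) + k)) : orth g -> obnd (fun h : 'M[R]_(j + m.+1) => phi (g *m rot0 k h)).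
  move=> og; have [c hc] := obp; exists c => h oh; apply: hc; apply: orthM => //; exact: orot.
have hg g : orth g -> mean (fun h => phi (g *m rot0 k h)) <= C * b * proj_vol k K g.
  move=> og; have bS : body (S g) by apply: body_slice0; exact: body_img.
  have [obS ucS] := proj_vol_ok m.+1 bS.
  have obS' : obnd (fun h => C * proj_vol k K g * proj_vol m.+1 (S g) h).
    have [c hc] := obS; exists (`|C * proj_vol k K g| * c) => h oh; rewrite normrM.
    by apply: ler_wpM2l => //; exact: hc.
  apply: (@le_trans _ _ (mean (fun h => C * proj_vol k K g * proj_vol m.+1 (S g) h))).
    apply: mean_le => //; first exact: obr.
    by move=> h oh; apply: (le_trans (proj_vol_rot og oh)); rewrite mulrAC.
  rewrite meanZ// mulrAC; apply: ler_wpM2r; first exact: vol_ge0.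
  by apply: ler_wpM2l => //; exact: hb.
apply/ler_addgt0Pr => e e0.
have [N0 hN] := net_ucont ucp e0.
have cb0 : bnd (fun N => C * b * avg (net (j + m.+1 + k) N) (proj_vol k K)) by apply: bndZ; exact: avg_bnd.
have -> : C * b * kub k K + e = ulim (fun N => C * b * avg (net (j + m.+1 + k) N) (proj_vol k K) + e).
  rewrite ulimD//; last exact: bnd_cst.
  by rewrite ulimZ ?ulim_cst//; exact: avg_bnd.
apply: (@ulim_le _ _ _ N0) => [||N N0N]; first exact: avg_bnd.
  by apply: bndD => //; exact: bnd_cst.
set T := net _ N.
have oT g : g \in T -> orth g by exact: net_orth.
rewrite -lerBlDr; apply: (@le_trans _ _ (avg T (fun g => mean (fun h => phi (g *m rot0 k h))))); last first.
  by rewrite -avgZ; apply: avg_le => g /oT og; exact: hg.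
have [obs ms] := mean_sum_in (fun g gT => obr g (oT g gT)).
have -> : avg T (fun g => mean (fun h => phi (g *m rot0 k h))) = mean (fun h => avg T (fun g => phi (g *m rot0 k h))).
  rewrite /avg -ms mulrC -meanZ//; apply: mean_eq => h oh; by rewrite mulrC.
rewrite -[leLHS](mean_cst (j + m.+1)); apply: mean_le.
- by exists `|avg T (proj_vol (m.+1 + k) K) - e| => h _.
- have [c hc] := obs; exists (c / (size T)%:R) => h oh.
  rewrite /avg normrM [X in _ * X]ger0_norm ?invr_ge0//; apply: ler_wpM2r; first by rewrite invr_ge0.
  exact: hc.
- move=> h oh; have := hN N (rot0 k h) N0N (orot _ oh); rewrite ler_norml => /andP[h1 _].
  by rewrite lerBrDr addrC in h1.
Qed.
End Fixed_body.
End Averaging.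

(** * The maximal section and the passage to quermassintegrals *)

Section Maximum.
Context {R : realType}.
Local Notation lam n := (@lebesgue_rV R n).
Local Notation omega := (@omega R).

Lemma ucont_max n (phi : 'M[R]_n -> R) : ucont phi -> exists2 g0, orth g0 & forall g, orth g -> phi g <= phi g0.
Proof.
move=> uc; pose f (v : 'rV[R]_(n * n)) : R := phi (vec_mx v).
pose A := [set v : 'rV[R]_(n * n) | orth (vec_mx v)].
have cf : {within A, continuous f}.
  apply/subspace_continuousP => x Ax; apply/cvgrPdist_le => e e0.
  have [d d0 hd] := uc e e0.
  pose s : R := Num.sqrt (n * n)%:R + 1.
  have s0 : 0 < s by rewrite ltr_wpDl// sqrtr_ge0.
  rewrite near_withinE; near=> y => Ay.
  have xy : fn (vec_mx x - vec_mx y) <= d.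
    rewrite /fn -raddfB vec_mxK; apply: (le_trans (enorm_sup _)).
    have h : `|x - y| < d / s.
      near: y; apply/nbhs_ballP; exists (d / s); first exact: divr_gt0.
      by move=> y; rewrite -ball_normE.
    apply: (@le_trans _ _ (s * `|x - y|)); first by rewrite ler_wpM2r// /s lerDl.
    by rewrite mulrC -ler_pdivlMr// ltW.
  rewrite ler_norml; apply/andP; split.
    rewrite lerBrDl lerBlDr; apply: hd => //.
    by rewrite /fn raddfB /= -enormN opprB -raddfB in xy *.
  by rewrite lerBlDl; exact: hd.
have A0 : A !=set0 by exists (mxvec 1%:M); rewrite /A /= mxvecK; exact: orth1.
have [c cA hc] := EVT_max_rV A0 (@orth_compact R n) cf.
exists (vec_mx c); first by move: cA; rewrite inE.
by move=> g og; have := hc (mxvec g); rewrite /f mxvecK inE /A /= mxvecK; apply.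
Unshelve. all: by end_near.
Qed.

Lemma quermassE n (X : set 'rV[R]_n) i : body X -> (0 < n)%N -> (i <= n)%N ->
  quermass X i = omega n / omega (n - i) * kub (n - i) X.
Proof. by case: n X => // n X bX _ im; exact: quermass_kub. Qed.

Lemma kub_le n q (X Y : set 'rV[R]_n) : body X -> body Y -> X `<=` Y -> kub q X <= kub q Y.
Proof.
move=> bX bY XY; have [cX _ _] := bX; have [cY _ _] := bY.
apply: mean_le; [exact: (proj_vol_ok q bX).1|exact: (proj_vol_ok q bY).1|].
by move=> g og; apply: vol_le; [exact: compact_img|exact: compact_img|exact: img_sub].
Qed.

Lemma kub_dilate n q c (X : set 'rV[R]_n) : body X -> 0 < c -> kub q (dilate c X) = c ^+ q * kub q X.
Proof.
move=> bX c0; have [cX _ _] := bX.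
rewrite /kub -meanZ; last exact: (proj_vol_ok q bX).1.
by apply: mean_eq => g og; rewrite /proj_vol img_dilate vol_dilate//; exact: compact_img.
Qed.

Lemma body_dilate n c (X : set 'rV[R]_n) : body X -> 0 < c -> body (dilate c X).
Proof.
move=> [cX vX [r r0 hr]] c0; split; [exact: compact_dilate|exact: cvx_dilate|].
exists (c * r); first exact: mulr_gt0.
move=> x xr; exists (c^-1 *: x); last by rewrite scalerA mulfV ?scale1r// gt_eqF.
by apply: hr; rewrite enormZ gtr0_norm ?invr_gt0// ler_pdivrMl.
Qed.

Lemma kub_ge0 n q (X : set 'rV[R]_n) : body X -> 0 <= kub q X.
Proof.
move=> bX; rewrite -(mean_cst n 0); apply: mean_le => [||g og]; last exact: vol_ge0.
  by exists 0 => g _; rewrite normr0.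
exact: (proj_vol_ok q bX).1.
Qed.

(** Makes the maximum over the Grassmannian attained: the function of [g] is monotone and
    homogeneous of degree q in the rotated body, hence continuous on the compact group O(p + k). *)
Lemma kub_section_max p k q (K : set 'rV[R]_(p + k)) : body K ->
  exists2 g0, orth g0 & forall g, orth g -> kub q (slice (img g K) 0) <= kub q (slice (img g0 K) 0).
Proof.
move=> bK; have bS g : orth g -> body (slice (img g K) 0).
  by move=> og; apply: body_slice0; exact: body_img.
apply: (@ucont_max _ (fun g => kub q (slice (img g K) 0))).
apply: (@body_scale_ucont _ _ K q _ bK _ _).2 => [g og|g g' c og og' c1 h].
  by apply: kub_ge0; exact: bS.
have c0 : 0 < c by exact: lt_le_trans c1.
rewrite -kub_dilate//; last exact: bS.
apply: kub_le; [exact: bS|by apply: body_dilate => //; exact: bS|].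
move=> y /h[z Kz zy]; exists (c^-1 *: y); last by rewrite scalerA mulfV ?scale1r// gt_eqF.
rewrite /slice /= (_ : row_mx _ _ = z)//.
rewrite -[0](scaler0 _ c^-1) -scale_row_mx -zy scalerA mulVf ?scale1r// gt_eqF//.
Qed.

(** The factor made of four values of [omega] is what remains of the constants in Kubota's formula
    for the two quermassintegrals of [K] and for that of the section; [omega n] cancels. *)
Lemma section_bound j m k (K : set 'rV[R]_((j + m.+1) + k)) (b : R) : body K -> balanced K ->
  (forall g, orth g -> quermass (slice (img g K) 0) j <= b) ->
  omega (j + m.+1) * omega (m.+1 + k) / (omega m.+1 * omega k) *
   (m.+2%:R / (j + m.+1 + k + 1)%:R) ^+ m.+1 * quermass K j <= quermass K (j + m.+1) * b.
Proof.
move=> bK hK hb; have w0 i : 0 < omega i by exact: omega_gt0.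
have bS g : orth g -> body (slice (img g K) 0).
  by move=> og; apply: body_slice0; exact: body_img.
have n0 : (0 < j + m.+1 + k)%N by lia.
have e1 : (j + m.+1 + k - j = m.+1 + k)%N by lia.
have e2 : (j + m.+1 + k - (j + m.+1) = k)%N by lia.
have e3 : (j + m.+1 - j = m.+1)%N by lia.
rewrite !quermassE//; [|lia|lia]; rewrite e1 e2.
pose b' := omega m.+1 / omega (j + m.+1) * b.
have hb' g : orth g -> kub m.+1 (slice (img g K) 0) <= b'.
  move=> og; have := hb g og; rewrite quermassE ?e3; [|exact: bS|lia|lia].
  rewrite /b' => h; rewrite mulrAC ler_pdivlMr// mulrC -ler_pdivrMl//.
  by apply: le_trans h; rewrite le_eqVlt; apply/orP; left; apply/eqP; rewrite mulrCA mulrA.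
have b0 : 0 <= b' by apply: le_trans (hb' _ (@orth1 R _)); apply: kub_ge0; apply: bS; exact: orth1.
have := kub_section_le bK hK hb' b0.
set n := (j + m.+1 + k)%N; set x := kub (m.+1 + k) K; set y := kub k K => h.
(* The dimension n is j + m + 1 + k, so the denominator produced by [width_max] is n + 1. *)
have en : (k + j)%:R + m.+2%:R = (n + 1)%:R :> R by rewrite -natrD; congr (_%:R); rewrite /n; lia.
rewrite en in h.
have nn0 : 0 < (n + 1)%:R :> R by rewrite ltr0n addn1.
have m0 : 0 < m.+2%:R :> R by rewrite ltr0n.
have c0 : 0 < (m.+2%:R / (n + 1)%:R) ^+ m.+1 :> R by rewrite exprn_gt0// divr_gt0.
have := ler_wpM2l (ltW (mulr_gt0 (divr_gt0 (mulr_gt0 (w0 (j + m.+1)%N) (w0 n)) (mulr_gt0 (w0 m.+1) (w0 k))) c0)) h.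
rewrite /b'; have -> : ((n + 1)%:R / m.+2%:R) ^+ m.+1 = ((m.+2%:R / (n + 1)%:R) ^+ m.+1)^-1 :> R.
  by rewrite -exprVn invfM invrK mulrC.
have f i : omega i != 0 by rewrite gt_eqF.
set c := (m.+2%:R / _) ^+ _ in c0 *.
have cn : c != 0 by rewrite gt_eqF.
set A := (X in X <= _ -> _); set B := (X in _ <= X -> _); set A' := (X in _ -> X <= _); set B' := (X in _ -> _ <= X).
have -> : A' = A by rewrite /A' /A; field; rewrite !f.
have -> // : B' = B by rewrite /B' /B; field; rewrite !f cn.
Qed.
End Maximum.

(** * Subspaces and orthonormal frames *)

Section Grassmannian.
Context {R : realType}.
Local Notation lam n := (@lebesgue_rV R n).

Lemma frame_enorm d n (U : 'M[R]_(d, n)) (y : 'rV[R]_d) : U *m U^T = 1%:M -> enorm (y *m U) = enorm y.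
Proof.
move=> hU; apply/eqP; rewrite -(@eqrXn2 _ 2) ?enorm_ge0// -!dotxx.
by rewrite dot_mulmx -mulmxA hU mulmx1.
Qed.

Lemma frame_inj d n (U : 'M[R]_(d, n)) (x y : 'rV[R]_d) : U *m U^T = 1%:M -> x *m U = y *m U -> x = y.
Proof. by move=> hU /(congr1 (mulmx^~ U^T)); rewrite -!mulmxA hU !mulmx1. Qed.

Lemma frame_mem d n (F : {vspace 'rV[R]_n}) (U : 'M[R]_(d, n)) (y : 'rV[R]_d) :
  (forall i, row i U \in F) -> y *m U \in F.
Proof.
by move=> hU; rewrite mulmx_sum_row; apply: memv_suml => i _; apply: memvZ.
Qed.

Let rmul d n (U : 'M[R]_(d, n)) : 'Hom('rV[R]_d, 'rV[R]_n) := linfun (mulmxr U).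

Let rmulE d n (U : 'M[R]_(d, n)) y : rmul U y = y *m U.
Proof. by rewrite lfunE. Qed.

Let dim_rmul d n (U : 'M[R]_(d, n)) : (\dim (limg (rmul U)) <= d)%N.
Proof.
have := limg_ker_dim (rmul U) fullv; rewrite dimvf /dim /= mul1n => h.
by rewrite -[X in (_ <= X)%N]h leq_addl.
Qed.

Let dim_rmul_frame d n (U : 'M[R]_(d, n)) : U *m U^T = 1%:M -> \dim (limg (rmul U)) = d.
Proof.
move=> hU; rewrite limg_dim_eq ?dimvf /dim /= ?mul1n//.
apply/eqP; rewrite -subv0; apply/subvP => y; rewrite memv_cap => /andP[_].
by rewrite memv_ker rmulE memv0 => /eqP h; apply/eqP; apply: (frame_inj hU); rewrite mul0mx.
Qed.

Lemma frame_span d n (F : {vspace 'rV[R]_n}) (U : 'M[R]_(d, n)) x : \dim F = d -> U *m U^T = 1%:M ->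
  (forall i, row i U \in F) -> x \in F -> exists y, x = y *m U.
Proof.
move=> dF hU rU xF; have sub : (limg (rmul U) <= F)%VS.
  by apply/subvP => _ /memv_imgP[y _ ->]; rewrite rmulE; exact: frame_mem.
have /eqP e : limg (rmul U) == F by rewrite eqEdim sub (dim_rmul_frame hU) dF leqnn.
by move: xF; rewrite -e => /memv_imgP[y _ ->]; exists y; rewrite rmulE.
Qed.

(** Gram-Schmidt: a frame with fewer than dim F rows does not span F, and the normalized residue of
    a vector outside its span extends it. *)
Lemma frame_exists n (F : {vspace 'rV[R]_n}) : exists U, @orthonormal_frame R n F U.
Proof.
suff h d : (d <= \dim F)%N -> exists U : 'M[R]_(d, n), U *m U^T = 1%:M /\ forall i, row i U \in F by exact: h.
elim: d => [_|d IH dF].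
  by exists 0; split; [apply/matrixP => -[]|move=> []].
have [U [hU rU]] := IH (ltnW dF).
have [x xF xU] : exists2 x, x \in F & x - x *m U^T *m U != 0.
  apply: contrapT => h; have : (F <= limg (rmul U))%VS.
    apply/subvP => x xF; apply/memv_imgP; exists (x *m U^T); rewrite ?memvf// rmulE.
    by apply/eqP; rewrite -subr_eq0; apply/negPn/negP => hx; apply: h; exists x.
  by move=> /dimvS /leq_trans /(_ (dim_rmul U)); rewrite leqNgt dF.
pose y := x - x *m U^T *m U.
have yF : y \in F by rewrite memvB//; exact: frame_mem.
have yU : y *m U^T = 0 by rewrite mulmxBl -[_ *m U *m U^T]mulmxA hU mulmx1 subrr.
have y0 : 0 < enorm y.
  rewrite lt_neqAle enorm_ge0 andbT eq_sym; apply: contra_neq xU => /enorm_eq0; exact.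
pose z := (enorm y)^-1 *: y.
have zz : z *m z^T = 1%:M.
  rewrite [LHS]mx11_scalar -dotE dotxx enormZ gtr0_norm ?invr_gt0// mulVf ?gt_eqF// expr1n//.
have zU : z *m U^T = 0 by rewrite -scalemxAl yU scaler0.
have Uz : U *m z^T = 0 by rewrite -[LHS]trmxK trmx_mul trmxK zU trmx0.
exists (col_mx z U : 'M[R]_(1 + d, n)); split.
  have : (col_mx z U : 'M[R]_(1 + d, n)) *m (col_mx z U : 'M[R]_(1 + d, n))^T = 1%:M.
    by rewrite tr_col_mx mul_col_row zz zU Uz hU -scalar_mx_block.
  exact.
move=> i; case: (@split_ordP 1 d i) => l ->.
  rewrite (@rowKu R 1 d n) (_ : row l z = z); first by rewrite memvZ.
  by rewrite (ord1 l); apply/rowP => a; rewrite !mxE.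
by rewrite (@rowKd R 1 d n).
Qed.

(** The frame [U] is the one chosen inside [vol_in]. It identifies F isometrically with a coordinate
    space and carries the unit ball of F to [ball2], so the Steiner systems on both sides are the
    same. *)
Lemma quermass_inE n (F : {vspace 'rV[R]_n}) (K : set 'rV[R]_n) i :
  exists U, @orthonormal_frame R n F U /\
    quermass_in F (K `&` [set` F]) i = quermass [set y | K (y *m U)] i.
Proof.
pose U := xget 0 (@orthonormal_frame R n F).
have hU : orthonormal_frame U by apply: xgetPex; exact: frame_exists.
exists U; split => //; have [UU rU] := hU.
rewrite /quermass_in /quermass /quermass_gen; congr (xget 0 _).
suff e W : steiner (vol_in F) (ball2 n `&` [set` F]) (\dim F) (K `&` [set` F]) W <->
  steiner (lam (\dim F)) (ball2 (\dim F)) (\dim F) [set y | K (y *m U)] W.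
  by apply/seteqP; split => w [W /e hW ->]; exists W.
suff {W} e t : vol_in F (minkowski_sum (K `&` [set` F]) (dilate t (ball2 n `&` [set` F]))) =
    lam (\dim F) (minkowski_sum [set y | K (y *m U)] (dilate t (ball2 (\dim F)))).
  by split => h t t0; rewrite -h// e.
rewrite /vol_in -/U; congr (lam _ _).
apply/seteqP; split => [y [u [Ku uF] [_ [v [Bv vF] <-] uv]]|_ [a Ka [_ [b Bb <-] <-]]].
  have [a ua] := frame_span (erefl _) UU rU uF.
  have [b vb] := frame_span (erefl _) UU rU vF.
  exists a; first by rewrite /= -ua.
  exists (t *: b); first by exists b => //; rewrite ball2E -(frame_enorm b UU) -vb -ball2E.
  by apply: (frame_inj UU); rewrite mulmxDl -scalemxAl -ua -vb.
exists (a *m U); first by split => //=; exact: frame_mem.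
exists (t *: (b *m U)); last by rewrite mulmxDl scalemxAl.
exists (b *m U) => //; split; last by apply: frame_mem.
by rewrite ball2E frame_enorm// -ball2E.
Qed.

Lemma compact_frame d n (U : 'M[R]_(d, n)) (K : set 'rV[R]_n) : compact K -> U *m U^T = 1%:M ->
  compact [set y : 'rV[R]_d | K (y *m U)].
Proof.
move=> cK hU; have [r _ hr] := compact_enorm cK.
apply: bounded_closed_compact.
  by apply: (@bounded_enorm _ _ _ r) => y /hr; rewrite frame_enorm.
apply: preimage_closed; last by apply: compact_closed => //; exact: norm_hausdorff.
by move=> y _; exact: mulmx_continuous.
Qed.

Lemma quermass_img n (g : 'M[R]_n) (S : set 'rV[R]_n) i : orth g -> compact S ->
  quermass (img g S) i = quermass S i.
Proof.
move=> og cS; rewrite /quermass /quermass_gen; congr (xget 0 _).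
suff e t : lam n (minkowski_sum (img g S) (dilate t (ball2 n))) = lam n (minkowski_sum S (dilate t (ball2 n))).
  by apply/seteqP; split => w [W hW ->]; exists W => // t t0; rewrite ?e -?hW// e.
rewrite -{1}(img_ball og) -img_dilate -img_sum lam_img//.
apply: compact_measurable_rV; apply: compact_sum => //; apply: compact_dilate; exact: compact_ball2.
Qed.

(** Two frames of the same subspace differ by the orthogonal matrix [U *m V^T], and
    quermassintegrals are rotation invariant. *)
Lemma quermass_frame d d' n (U : 'M[R]_(d, n)) (V : 'M[R]_(d', n)) (K : set 'rV[R]_n) i : d = d' -> compact K ->
  U *m U^T = 1%:M -> V *m V^T = 1%:M -> (forall l, exists y, row l U = y *m V) ->
  quermass [set y | K (y *m U)] i = quermass [set y | K (y *m V)] i.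
Proof.
move=> e; case: d' / e V => V cK hU hV hUV.
have UV : U = U *m V^T *m V.
  apply/row_matrixP => l; have [y hy] := hUV l.
  by rewrite !row_mul hy -[y *m V *m V^T]mulmxA hV mulmx1.
pose O := U *m V^T; have oO : orth O by rewrite /orth trmx_mul trmxK mulmxA -UV hU.
have e y : y *m O^T *m U = y *m V.
  by transitivity (y *m O^T *m (O *m V)); [rewrite -UV|rewrite mulmxA orthKV].
rewrite -(quermass_img i oO (compact_frame cK hU)); congr (quermass _ i).
by rewrite img_orthE//; apply/seteqP; split => y /=; rewrite e.
Qed.

Lemma slice_frame p k (g : 'M[R]_(p + k)) (K : set 'rV[R]_(p + k)) : orth g ->
  slice (img g K) 0 = [set y | K (y *m (pid_mx p *m g^T))].
Proof.
move=> og; have e (y : 'rV[R]_p) : y *m (pid_mx p : 'M[R]_(p, p + k)) = row_mx y 0.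
  by rewrite pid_mx_row mul_mx_row mulmx1 mulmx0.
rewrite img_orthE// /slice; apply/seteqP; split => y /=; by rewrite mulmxA e.
Qed.

Lemma frame_section d p k (U : 'M[R]_(d, p + k)) (K : set 'rV[R]_(p + k)) i : d = p -> U *m U^T = 1%:M ->
  exists2 g, orth g & quermass [set y | K (y *m U)] i = quermass (slice (img g K) 0) i.
Proof.
move=> e; case: p / e U K => U K /frame_to_std[g og hg]; exists g => //.
by rewrite slice_frame// -hg orthK.
Qed.

Lemma grassmannian_section p k (K : set 'rV[R]_(p + k)) F i : \dim F = p ->
  exists2 g, orth g & quermass_in F (K `&` [set` F]) i = quermass (slice (img g K) 0) i.
Proof.
by move=> dF; have [U [[hU _] ->]] := quermass_inE F K i; exact: frame_section.
Qed.

Lemma section_grassmannian p k (K : set 'rV[R]_(p + k)) g i : compact K -> orth g ->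
  exists2 F, \dim F = p & quermass_in F (K `&` [set` F]) i = quermass (slice (img g K) 0) i.
Proof.
move=> cK og; pose V := pid_mx p *m g^T : 'M[R]_(p, p + k).
have hV : V *m V^T = 1%:M.
  by rewrite trmx_mul trmxK mulmxA orthKV// tr_pid_mx mul_pid_mx minnn (minn_idPr (leq_addr k p)) pid_mx_1.
exists (limg (rmul V)); first exact: dim_rmul_frame.
have [U [[hU rU] ->]] := quermass_inE (limg (rmul V)) K i.
rewrite slice_frame// -/V; apply: quermass_frame => //; first exact: dim_rmul_frame.
by move=> l; have /memv_imgP[y _ ->] := rU l; exists y; rewrite rmulE.
Qed.
End Grassmannian.

Theorem corollary1p2 (R : realType) (n k j : nat)
    (hkn : (k < n)%N) (hj : (j <= n - k - 1)%N)
    (K : set 'rV[R]_n) (hK : convex_body K) (hc : centered K) :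
  exists2 M : R,
    is_max [set quermass_in F (K `&` [set` F]) j | F in grassmannian n (n - k)%N] M &
    gamma_coef n k j * ((n - k - j + 1)%N%:R / (n + 1)%N%:R) ^+ (n - k - j)%N *
      quermass K j <= quermass K (n - k)%N * M.
Proof.
(* Here [m.+1] is n - k - j, positive by the hypotheses. The sum is substituted for [n] at once,
   since the type of [K] depends on it. *)
have [m nE] : exists m, n = (j + m.+1 + k)%N by exists (n - k - j - 1)%N; lia.
clear hkn hj; case: _ / (esym nE) K hK hc => K hK hc.
have nk : (j + m.+1 + k - k = j + m.+1)%N by lia.
have nj : (j + m.+1 + k - j = m.+1 + k)%N by lia.
have nkj : (j + m.+1 - j = m.+1)%N by lia.
have bal := centered_balanced hK hc.
have bK := balanced_body hK bal.
have [cK _ _] := bK.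
have [g0 og0 hmax] := kub_section_max m.+1 bK.
have hq g : orth g -> quermass (slice (img g K) 0) j = omega (j + m.+1) / omega m.+1 * kub m.+1 (slice (img g K) 0).
  move=> og; rewrite quermassE ?nkj//; [|lia..].
  by apply: body_slice0; exact: body_img.
have hle g : orth g -> quermass (slice (img g K) 0) j <= quermass (slice (img g0 K) 0) j.
  move=> og; rewrite (hq _ og) (hq _ og0); apply: (ler_wpM2l _ (hmax _ og)).
  by rewrite divr_ge0// ltW// omega_gt0.
rewrite nk; exists (quermass (slice (img g0 K) 0) j); first split.
- by have [F dF <-] := section_grassmannian j cK og0; exists F.
- by move=> _ [F dF <-]; have [g og ->] := grassmannian_section K j dF; exact: hle.
by rewrite /gamma_coef nk nj nkj addn1; exact: section_bound.
Qed.
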